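(* Let $n\ge 2$, let $B_1,B_2,C$ be $n\times n$ generic matrices over $\mathbb{Q}$, let $K$ be the field generated over $\mathbb{Q}$ by all their entries and $\overline{K}$ its algebraic closure. Consider the equation $$X^2+B_1XB_2+C=0_n\qquad\text{in the unknown }X\in\mathcal{M}_n(\overline{K}).$$ When $n=2$, the solvability complexity of this equation is $(8,S_8)$. For any $n>2$, this equation has a finite number of solutions and is non-solvable.
   Context: Generic matrices: matrices whose entries, taken all together, are independent commuting indeterminates over $\mathbb{Q}$ (algebraically independent over $\mathbb{Q}$). Solvable: when a matrix equation over $K$ has a finite positive number of solutions in $\mathcal{M}_n(\overline{K})$, it is called solvable if the entries of each solution can be calculated by radicals over $K$ (i.e. lie in a radical extension of $K$), and non-solvable otherwise. Solvability complexity (SC): consider a matrix equation over $K$ with a finite number $\nu$ of solutions in $\mathcal{M}_n(\overline{K})$. Assume that finding the entries of each solution is equivalent to finding the roots of a polynomial (over $K$) whose Galois group over $K$ is $G$, in the sense that the extension of $K$ generated by the entries of all the solutions is the splitting field over $K$ of that polynomial. Then the solvability complexity of the equation is the couple $(\nu,G)$. $S_m$ denotes the symmetric group on $m$ letters. *)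

(* Defs.v *)
From HB Require Import structures.
From mathcomp Require Import all_boot all_order all_algebra.
From mathcomp Require Import all_fingroup all_solvable all_field.
From mathcomp Require Import mpoly.

Set Implicit Arguments.
Unset Strict Implicit.
Unset Printing Implicit Defensive.

Import GRing.Theory.
Local Open Scope ring_scope.

(* One indeterminate for each triple (k, i, j): entry (i, j) of the k-th
   matrix. *)
Definition nvars (n : nat) : nat := #|{: 'I_3 * 'I_n * 'I_n}|.

Definition genericK (n : nat) : fieldType := {fraction {mpoly rat[nvars n]}}.

Definition generic_mx (n : nat) (k : 'I_3) : 'M[genericK n]_n :=
  \matrix_(i, j) tofrac ('X_(enum_rank (k, i, j)) : {mpoly rat[nvars n]}).

Section Extensions.

Variables (K : fieldType) (Kbar : closedFieldType).
Variable iota : {rmorphism K -> Kbar}.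

Definition algebraic_closure : Prop := forall z : Kbar, algebraicOver iota z.

(* The subfield K(S) of Kbar; it is in general not a decidable subset, hence
   the Prop-valued predicate. *)
Inductive adjoin (S : Kbar -> Prop) : Kbar -> Prop :=
| adjoin_base a : adjoin S (iota a)
| adjoin_gen x of S x : adjoin S x
| adjoin_sub x y of adjoin S x & adjoin S y : adjoin S (x - y)
| adjoin_mul x y of adjoin S x & adjoin S y : adjoin S (x * y)
| adjoin_inv x of adjoin S x : adjoin S x^-1.

(* s = [:: a_0; ...; a_(r-1)] and each a_i has a positive power in
   K(a_0, ..., a_(i-1)). *)
Definition radical_tower (s : seq Kbar) : Prop :=
  forall i, (i < size s)%N ->
  exists2 m, (0 < m)%N & adjoin (fun x => x \in take i s) (s`_i ^+ m).

Definition by_radicals (x : Kbar) : Prop :=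
  exists2 s, radical_tower s & adjoin (fun y => y \in s) x.

(* p has Galois group G over K, up to isomorphism.  The case p = 0 is excluded
   by splittingFieldFor. *)
Definition has_galois_group (p : {poly K}) (gT : finGroupType)
    (G : {group gT}) : Prop :=
  exists L : splittingFieldType K,
    splittingFieldFor 1 (map_poly (in_alg L) p) {:L}
    /\ 'Gal({:L} / 1) \isog G.

(* An equation in an unknown n x n matrix is given by its set of solutions. *)
Section Equation.

Variables (n : nat) (sol : 'M[Kbar]_n -> Prop).

Definition num_solutions (nu : nat) : Prop :=
  exists s : seq 'M[Kbar]_n,
    [/\ uniq s, size s = nu & forall X, sol X <-> X \in s].

Definition finitely_many_solutions : Prop := exists nu, num_solutions nu.

Definition solution_entry (x : Kbar) : Prop :=
  exists X i j, sol X /\ x = X i j.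

Definition finite_positive_solutions : Prop :=
  exists2 nu, (0 < nu)%N & num_solutions nu.

Definition eq_solvable : Prop :=
  finite_positive_solutions
  /\ forall X i j, sol X -> by_radicals (X i j).

Definition eq_nonsolvable : Prop :=
  finite_positive_solutions /\ ~ eq_solvable.

Definition solvability_complexity (nu : nat) (gT : finGroupType)
    (G : {group gT}) : Prop :=
  num_solutions nu
  /\ exists p : {poly K},
       has_galois_group p G
       /\ forall x : Kbar,
            adjoin solution_entry x
            <-> adjoin (root (map_poly iota p)) x.

End Equation.

End Extensions.

Definition quadratic_sol (K : fieldType) (Kbar : closedFieldType)
    (iota : {rmorphism K -> Kbar}) (n : nat) (B1 B2 C : 'M[K]_n)
    (X : 'M[Kbar]_n) : Prop :=
  X *m X + map_mx iota B1 *m X *m map_mx iota B2 + map_mx iota C = 0.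

(* Main.v *)
(** If n elements are rational functions, with a common denominator, of n
    algebraically dependent ones, they are algebraically dependent themselves
    (count monomials).  Hence a solution X, together with B1 and B2, has
    algebraically independent entries, and each entry of X is a root of a fixed
    nonzero polynomial over K: there are finitely many solutions.

    Lower bounds for the Galois group come from embeddings of K into the
    fraction field of a power series ring k[[eta]], obtained by deforming
    special coefficient matrices in a generic direction.  Simple solutions of
    the special equation lift by Hensel's lemma, and field automorphisms which
    fix the image of K permute the lifts; the relations between these lifts and
    the solutions in Kbar are the same.

    For n > 2, deform a block companion equation whose solvents have as
    eigenvalues n of 2n indeterminates.  The symmetric group of degree 2n acts
    on the lifts and Alt_2n acts nontrivially; as Alt_2n is perfect, no derived
    subgroup of the Galois group fixes all solutions, whereas some derived
    subgroup fixes every element of a given radical tower.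

    For n = 2, elimination of all the unknowns but the trace leaves an equation
    of degree 8, so that there are at most 8 solutions.  Deform an equation with
    six simple solutions and a double one, which splits as x + eta z + O(eta^2)
    and x - eta z + O(eta^2): the substitution of -eta for eta yields a
    transposition of two of eight solutions.  Finally B1, X, Y determine B2 and
    C when X - Y is invertible, so that all pairs of such solutions are
    conjugate, which gives the transpositions of a fixed solution with any
    other one, and hence the whole of S_8. *)

From HB Require Import structures.
Require Import Defs.
From mathcomp Require Import all_boot all_order all_algebra.
From mathcomp Require Import all_fingroup all_solvable all_field.
From mathcomp Require Import boolp.
From mathcomp Require Import mpoly.
From mathcomp Require Import ring zify.

Set Implicit Arguments.
Unset Strict Implicit.
Unset Printing Implicit Defensive.

Import GRing.Theory.
Local Open Scope ring_scope.

(** * Algebraic dependence *)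

(** The obstacle is that [Kbar] has no visible automorphisms, while the series fields that have some
    come with no morphism to or from [Kbar] over K. The link is [conj_over]: two tuples, possibly in
    different extensions of K, satisfy the same polynomial relations over K. Only relations are
    transported. An algebraic tuple has a conjugate in [Kbar], and conjugate tuples inside a finite
    splitting field are exchanged by a Galois automorphism. To embed K, the images of the generic
    entries must be independent. They are special coefficients plus eta^d times the generic matrices
    themselves: at eta = 1, and at 0 for the auxiliary indeterminates, this is the generic matrix
    plus a rational one, so a relation would specialise to one between generic entries. For n = 2 an
    explicit elimination is needed because Bezout's theorem, for four quadratic equations in four
    unknowns, would only give the bound 16. The transposition comes from eta -> - eta, so the
    deformed coefficients have to be even in eta. *)

Lemma frac_numden (R : idomainType) (z : {fraction R}) :
  exists n d : R, d != 0 /\ z * tofrac d = tofrac n.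
Proof.
elim/quotW: z => x; exists \n_x, \d_x; split; first exact: denom_ratioP.
unlock tofrac; rewrite -[LHS]FracField.pi_mul.
apply/eqmodP; rewrite /= FracField.equivfE /FracField.mulf.
by rewrite !numden_Ratio ?(mulf_neq0, oner_eq0, denom_ratioP) // !mulr1 mulrC.
Qed.

Lemma frac_lift (R : idomainType) (F : fieldType) (f : {rmorphism R -> F}) :
  injective f ->
  exists g : {rmorphism {fraction R} -> F}, forall x, g (tofrac x) = f x.
Proof.
move=> f_inj.
have f_neq0 x : x != 0 -> f x != 0 by move=> h; rewrite -(rmorph0 f) (inj_eq f_inj).
(* The chosen value has to be right for every representation n / d of z; additivity and
   multiplicativity then follow from any two representations. *)
have /choice[g gE] (z : {fraction R}) :
    exists w, forall n d, z * tofrac d = tofrac n -> w * f d = f n.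
  have [n [d [d0 zd]]] := frac_numden z; exists (f n / f d) => n' d' zd'.
  apply: (mulIf (f_neq0 _ d0)); rewrite mulrAC divfK ?f_neq0 //.
  rewrite -!rmorphM; congr (f _); apply/eqP; rewrite -tofrac_eq !rmorphM /=.
  by rewrite -zd -zd' mulrAC.
have gT x : g (tofrac x) = f x.
  by rewrite -[LHS]mulr1 -(rmorph1 f) (gE _ x) // rmorph1 mulr1.
have gB : zmod_morphism g.
  move=> x y; have [n [d [d0 xd]]] := frac_numden x.
  have [n' [d' [d0' yd]]] := frac_numden y.
  apply: (mulIf (f_neq0 _ (mulf_neq0 d0 d0'))).
  rewrite (gE _ (n * d' - n' * d)); last first.
    rewrite rmorphB !rmorphM /= -xd -yd mulrBl; congr (_ - _); first by rewrite mulrA.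
    by rewrite mulrA mulrAC.
  rewrite rmorphB !rmorphM /= -(gE _ _ _ xd) -(gE _ _ _ yd) mulrBl.
  by congr (_ - _); rewrite mulrA // mulrAC.
have gM : monoid_morphism g.
  split; first by rewrite -(rmorph1 (@tofrac R)) gT rmorph1.
  move=> x y; have [n [d [d0 xd]]] := frac_numden x.
  have [n' [d' [d0' yd]]] := frac_numden y.
  apply: (mulIf (f_neq0 _ (mulf_neq0 d0 d0'))).
  rewrite (gE _ (n * n')); last by rewrite !rmorphM /= -xd -yd mulrACA.
  by rewrite !rmorphM /= -(gE _ _ _ xd) -(gE _ _ _ yd) mulrACA.
pose gZ := GRing.isZmodMorphism.Build _ _ g gB.
pose gMo := GRing.isMonoidMorphism.Build _ _ g gM.
pose G : {rmorphism {fraction R} -> F} := HB.pack g gZ gMo.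
by exists G.
Qed.

Section BoxDegree.

Variables (F : fieldType) (n : nat).
Implicit Types (p q : {mpoly F[n]}).

(** Bounding each partial degree, rather than the total degree, makes the number of admissible
    monomials exactly (d + 1)^n, which compares easily with D^n. *)
Definition box_le d p := forall m, m \in msupp p -> forall i, (m i <= d)%N.

Lemma box_leW d d' p : (d <= d')%N -> box_le d p -> box_le d' p.
Proof. by move=> le_d hp m hm i; apply: leq_trans (hp _ hm i) le_d. Qed.

Lemma box_leM d d' p q : box_le d p -> box_le d' q -> box_le (d + d') (p * q).
Proof.
move=> hp hq m /msuppM_le/allpairsP[[m1 m2] /= [h1 h2 ->]] i.
by rewrite mnmDE leq_add ?hp ?hq.
Qed.

Lemma box_le1 d : box_le d (1 : {mpoly F[n]}).
Proof.
by move=> m; rewrite msupp1 inE => /eqP-> i; rewrite mnm0E.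
Qed.

Lemma box_leX d p k : box_le d p -> box_le (k * d) (p ^+ k).
Proof.
move=> hp; elim: k => [|k IH]; first by rewrite expr0; apply: box_le1.
by rewrite exprS mulSn; apply: box_leM.
Qed.

Lemma box_le_prod (I : Type) (r : seq I) (e : I -> nat) (p : I -> {mpoly F[n]}) :
  (forall i, box_le (e i) (p i)) -> box_le (\sum_(i <- r) e i) (\prod_(i <- r) p i).
Proof.
move=> h; elim: r => [|i r IH]; first by rewrite !big_nil; apply: box_le1.
by rewrite !big_cons; apply: box_leM.
Qed.

Lemma box_le_mnm d (m : 'X_{1..n}) :
  (forall i, (m i <= d)%N) -> box_le d ('X_[m] : {mpoly F[n]}).
Proof. by move=> h m'; rewrite msuppX inE => /eqP->. Qed.

Lemma box_le_msize p : box_le (msize p) p.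
Proof.
move=> m hm i; apply: leq_trans (ltnW (msize_mdeg_lt hm)).
by rewrite mdegE (bigD1 i) //= leq_addr.
Qed.

(* There are only (d + 1) ^ n monomials of partial degrees at most d. *)
Lemma box_dependent (I : finType) (t : I -> {mpoly F[n]}) d :
  (forall i, box_le d (t i)) -> (d.+1 ^ n < #|I|)%N ->
  exists2 c : I -> F, (exists i, c i != 0) & \sum_i c i *: t i = 0.
Proof.
move=> ht ltI; pose J := {ffun 'I_n -> 'I_d.+1}.
pose mon (f : J) := [multinom (f i : nat) | i < n].
pose A : 'M[F]_(#|I|, #|J|) := \matrix_(i, j) (t (enum_val i))@_(mon (enum_val j)).
have cardJ : #|J| = (d.+1 ^ n)%N by rewrite card_ffun !card_ord.
have : kermx A != 0.
  rewrite kermx_eq0 -row_leq_rank -ltnNge.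
  by apply: leq_ltn_trans (rank_leq_col A) _; rewrite cardJ.
case/rowV0Pn => r /sub_kermxP rA r0.
exists (fun i => r 0 (enum_rank i)).
  have [j] : exists j, r 0 j != 0.
    by apply/existsP; apply: contraR r0; rewrite negb_exists => /forallP h;
       apply/eqP/rowP=> j; rewrite mxE; apply/eqP; have := h j; rewrite negbK.
  by move=> hj; exists (enum_val j); rewrite enum_valK.
apply/mpolyP => m; rewrite raddf_sum /= mcoeff0.
under eq_bigr => i _ do rewrite mcoeffZ.
have [hm|hm] := boolP [forall i, (m i <= d)%N]; last first.
  apply: big1 => i _; apply/eqP; rewrite mulf_eq0; apply/orP; right.
  rewrite mcoeff_eq0; apply: contra hm => hm; apply/forallP => j; exact: ht hm j.
pose f : J := [ffun i => inord (m i)].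
have mE : mon f = m.
  by apply/mnmP => i; rewrite mnmE ffunE inordK // ltnS; apply: (forallP hm).
have := congr1 (fun M : 'rV_ _ => M 0 (enum_rank f)) rA; rewrite !mxE => rf.
rewrite (reindex _ (onW_bij _ (enum_val_bij I))) /= -[RHS]rf.
by apply: eq_bigr => i _; rewrite mxE enum_valK enum_rankK mE.
Qed.

End BoxDegree.

Lemma leq_expl a b e : (a <= b -> a ^ e <= b ^ e)%N.
Proof. by move=> leab; elim: e => // e IH; rewrite !expnS leq_mul. Qed.

(** A discrete mean value inequality for the power function. *)
Lemma leq_expnD Z r k : ((Z + r) ^ k.+1 <= Z ^ k.+1 + k.+1 * r * (Z + r) ^ k)%N.
Proof.
elim: k => [|k IH]; first by rewrite !expn1 expn0 mul1n muln1.
have le_rZ : (r * Z ^ k.+1 <= r * (Z + r) ^ k.+1)%N.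
  by rewrite leq_mul2l leq_exp2r // leq_addr orbT.
move: (leq_mul (leqnn (Z + r)) IH); rewrite -expnS => /leq_trans; apply.
rewrite mulnDr mulnDl -!expnS mulnCA -[in X in (_ + X <= _)%N]expnS.
rewrite -addnA leq_add2l [X in (_ <= X)%N]mulnAC mulSn mulnDl -mulnA.
by rewrite mulnAC -mulnA leq_add2r.
Qed.

(** The left side exceeds (nDd + 1)^n by at most n r (nDd + 1 + r)^(n-1), hence by at most n r (nd +
    1 + r)^(n-1) D^(n-1). [D] is one more than the constant in front of D^(n-1). *)
Lemma box_count_lt n r d :
  let D := (n * r * (n * d + 1 + r) ^ n.-1).+1 in
  ((n * D * d + r).+1 ^ n < D ^ n + (n * D * d).+1 ^ n)%N.
Proof.
case: n => [|k] //=; set D := (_ * _ ^ _).+1; rewrite -addSn.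
apply: leq_ltn_trans (leq_expnD _ _ _) _; rewrite addnC ltn_add2r.
have le_base : ((k.+1 * D * d).+1 + r <= D * (k.+1 * d + 1 + r))%N.
  have -> : (k.+1 * D * d = D * (k.+1 * d))%N by rewrite mulnAC mulnC.
  by rewrite -addn1 -addnA -[X in (_ <= D * X)%N]addnA (mulnDr D) leq_add2l leq_pmull.
apply: (@leq_ltn_trans (k.+1 * r * (D * (k.+1 * d + 1 + r)) ^ k)).
  by apply: leq_mul => //; apply: leq_expl.
by rewrite expnMn mulnCA [X in (_ < X)%N]expnS mulnC ltn_mul2r expn_gt0 /= ltnS.
Qed.

Section AlgebraicDependence.

Variables (F : fieldType) (A : idomainType) (phi : {rmorphism F -> A}).

Definition alg_dependent n (x : 'I_n -> A) :=
  exists2 P : {mpoly F[n]}, P != 0 & mmap phi x P = 0.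

(* Transcendence degree by counting: the D ^ n monomials in [x] of partial
   degrees < D, multiplied by a power of [G(y)], lie in a space of
   polynomials in [y] whose dimension, because of the relation between the
   [y i], grows slower than D ^ n. *)
Lemma alg_dependent_rational n (x y : 'I_n -> A)
    (G : {mpoly F[n]}) (f : 'I_n -> {mpoly F[n]}) :
  mmap phi y G != 0 ->
  (forall i, mmap phi y G * x i = mmap phi y (f i)) ->
  alg_dependent y -> alg_dependent x.
Proof.
move=> G0 fE [P P0 Py].
pose r := msize P; pose d := (msize G + \sum_i msize (f i))%N.
have dG : box_le d G by apply: box_leW (@box_le_msize _ _ G); rewrite leq_addr.
have df i : box_le d (f i).
  apply: box_leW (@box_le_msize _ _ (f i)).
  by rewrite /d (bigD1 i) //= addnCA leq_addr.
pose D := (n * r * (n * d + 1 + r) ^ n.-1).+1; pose Z := (n * D * d)%N.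
have card_lt : ((Z + r).+1 ^ n < D ^ n + Z.+1 ^ n)%N by exact: box_count_lt.
(* Two families in one box: the monomials in [x] times G^(nD), rewritten through [G] and the [f i],
   and the monomial multiples of [P], which vanish at [y]. They are more numerous than the monomials
   of the box, and a linear relation between them becomes, at [y], a relation between monomials in
   [x]. *)
pose I := ({ffun 'I_n -> 'I_D} + {ffun 'I_n -> 'I_Z.+1})%type.
pose mon E (h : {ffun 'I_n -> 'I_E}) := [multinom (h i : nat) | i < n].
pose t (i : I) := match i with
  | inl h => G ^+ (n * D - \sum_i (h i : nat)) * \prod_i (f i ^+ h i)
  | inr h => 'X_[mon _ h] * P end.
have sum_le (h : {ffun 'I_n -> 'I_D}) : (\sum_i (h i : nat) <= n * D)%N.
  rewrite -[X in (_ <= X * _)%N]card_ord -sum_nat_const; apply: leq_sum => i _.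
  exact: ltnW.
have ht i : box_le (Z + r) (t i).
  case: i => h /=.
    apply: (@box_leW _ _ Z); first exact: leq_addr.
    rewrite /Z -(subnK (sum_le h)) mulnDl [(_ - _ + _ - _)%N]addnK.
    apply: box_leM; first exact: box_leX.
    by rewrite big_distrl /=; apply: box_le_prod => i; apply: box_leX.
  apply: box_leM; last exact: box_le_msize.
  by apply: box_le_mnm => i; rewrite mnmE -ltnS.
have cardI : ((Z + r).+1 ^ n < #|{: I}|)%N by rewrite card_sum !card_ffun !card_ord.
have [c [i0 ci0] ct] := box_dependent ht cardI.
pose Q := \sum_h c (inl h) *: 'X_[mon D h] : {mpoly F[n]}.
pose S := \sum_h c (inr h) *: 'X_[mon _ h] : {mpoly F[n]}.
have mon_inj E : injective (@mon E).
  move=> h h' /mnmP e; apply/ffunP => i; apply: val_inj.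
  by have := e i; rewrite !mnmE.
have coefE E (c' : {ffun 'I_n -> 'I_E} -> F) h :
    (\sum_h' c' h' *: 'X_[mon E h'] : {mpoly F[n]})@_(mon E h) = c' h.
  rewrite raddf_sum (bigD1 h) //= mcoeffZ mcoeffX eqxx mulr1 big1 ?addr0 //.
  by move=> h' ne; rewrite mcoeffZ mcoeffX (inj_eq (@mon_inj E)) (negPf ne) mulr0.
exists Q.
  (* Were [Q] zero, the relation would involve multiples of [P] only, and these are linearly
     independent because [P] is not a zero divisor. *)
  apply/eqP => Q0.
  have cl h : c (inl h) = 0 by rewrite -(coefE _ (fun h => c (inl h))) -/Q Q0 mcoeff0.
  have SP : S * P = 0.
    rewrite -[RHS]ct big_sumType /= big1 ?add0r; last by move=> h _; rewrite cl scale0r.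
    by rewrite big_distrl; apply: eq_bigr => h _; rewrite /= scalerAl.
  have S0 : S = 0 by move/eqP: SP; rewrite mulf_eq0 (negPf P0) orbF => /eqP.
  case: i0 ci0 => h; first by rewrite cl eqxx.
  by rewrite -(coefE _ (fun h => c (inr h))) -/S S0 mcoeff0 eqxx.
have := congr1 (mmap phi y) ct; rewrite rmorph0 rmorph_sum big_sumType /=.
rewrite [X in _ + X]big1 ?addr0; last first.
  by move=> h _; rewrite mmapZ rmorphM /= Py !mulr0.
move=> e; apply/eqP; rewrite -(mulrI_eq0 _ (mulfI (expf_neq0 (n * D) G0))); apply/eqP.
rewrite -[RHS]e rmorph_sum /= big_distrr /=; apply: eq_bigr => h _.
rewrite !mmapZ mulrCA; congr (_ * _); rewrite mmapX rmorphM rmorphXn rmorph_prod /=.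
rewrite -{1}(subnK (sum_le h)) exprD -mulrA; congr (_ * _).
rewrite /mmap1 expr_sum -big_split /=; apply: eq_bigr => i _.
by rewrite mnmE rmorphXn /= -fE exprMn.
Qed.

End AlgebraicDependence.

(** * Conjugate tuples *)

Lemma map_poly_intro (K : nzRingType) (L : nzRingType) (f : {rmorphism K -> L})
    (p : {poly L}) :
  (forall i, exists a, p`_i = f a) -> exists q, p = map_poly f q.
Proof.
move=> /choice[g gE]; exists (\poly_(i < size p) g i); apply/polyP => i.
rewrite coef_map coef_poly; case: ifP => [_|]; first exact: gE.
by move=> /negbT; rewrite -leqNgt => hi; rewrite nth_default //; apply/esym; exact: rmorph0.
Qed.

Lemma rmorph_mmap n (R S T : comNzRingType) (f : {rmorphism R -> S})
    (g : {rmorphism S -> T}) (h : 'I_n -> S) (P : {mpoly R[n]}) :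
  g (mmap f h P) = mmap (g \o f) (fun i => g (h i)) P.
Proof.
rewrite /mmap rmorph_sum; apply: eq_bigr => m _; rewrite rmorphM /=.
by congr (_ * _); rewrite /mmap1 rmorph_prod; apply: eq_bigr => i _; rewrite rmorphXn.
Qed.

Lemma eq_mmap n (R S : nzRingType) (f f' : R -> S) (h h' : 'I_n -> S)
    (P : {mpoly R[n]}) : f =1 f' -> h =1 h' -> mmap f h P = mmap f' h' P.
Proof.
move=> ef eh; rewrite /mmap; apply: eq_bigr => m _; rewrite ef; congr (_ * _).
by rewrite /mmap1; apply: eq_bigr => i _; rewrite eh.
Qed.

Lemma mmapXi n (R S : nzRingType) (f : {rmorphism R -> S}) (h : 'I_n -> S) i :
  mmap f h 'X_i = h i.
Proof. by rewrite mmapX mmap1U. Qed.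

Lemma mmap_horner n (R S : comNzRingType) (f : {rmorphism R -> S})
    (h : 'I_n -> S) (p : {poly R}) (Q : {mpoly R[n]}) :
  mmap f h (map_poly (mpolyC n (R:=R)) p).[Q] = (map_poly f p).[mmap f h Q].
Proof.
rewrite -horner_map -map_poly_comp; congr (_.[_]).
by apply: eq_map_poly => c /=; rewrite mmapC.
Qed.

Section TypeEquality.

Variable K : fieldType.
Hypothesis char0K : has_pchar0 K.

(** Equality of the ideals of relations. It stands for a K-isomorphism between the generated fields,
    and makes sense between unrelated extensions. *)
Definition conj_over m (E E' : fieldType) (f : {rmorphism K -> E})
    (f' : {rmorphism K -> E'}) (x : 'I_m -> E) (y : 'I_m -> E') :=
  forall P : {mpoly K[m]}, (mmap f x P == 0) = (mmap f' y P == 0).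

Lemma conj_over_eq m (E E' : fieldType) (f : {rmorphism K -> E})
    (f' : {rmorphism K -> E'}) (x : 'I_m -> E) (y : 'I_m -> E') :
  conj_over f f' x y ->
  forall P Q, (mmap f x P == mmap f x Q) = (mmap f' y P == mmap f' y Q).
Proof. by move=> xy P Q; rewrite -subr_eq0 -mmapB xy mmapB subr_eq0. Qed.

(** The minimal polynomial, for an extension given as a bare morphism of fields: a nonzero
    annihilator of least size. *)
Lemma irreducible_annihilator (E : fieldType) (f : {rmorphism K -> E}) z :
  algebraicOver f z ->
  exists2 p, irreducible_poly p & forall q, root (map_poly f q) z = (p %| q).
Proof.
move=> [p0 p00 p0z].
pose P n := `[< exists p : {poly K}, [/\ p != 0, root (map_poly f p) z & size p = n] >].
have exP : exists n, P n by exists (size p0); apply/asboolP; exists p0.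
have [n /asboolP[p [p_n0 pz sp]] nmin] := find_ex_minn exP.
have dv q : root (map_poly f q) z = (p %| q).
  apply/idP/idP => [qz|/dvdpP[r ->]]; last by rewrite rmorphM rootM pz orbT.
  rewrite /dvdp; apply: contraT => r0.
  have rz : root (map_poly f (q %% p)) z.
    have /(congr1 (fun u => (map_poly f u).[z])) := divp_eq q p.
    rewrite rmorphD rmorphM /= hornerD hornerM (rootP qz) (rootP pz) mulr0 add0r.
    by move/esym/rootP.
  have := nmin (size (q %% p)); rewrite -sp leqNgt ltn_modp p_n0.
  by move=> h; have := h (introT (asboolP _) (ex_intro _ _ (And3 r0 rz erefl))).
exists p => //; split.
  rewrite ltnNge; apply: contraL pz => /size1_polyC pE; rewrite pE map_polyC /=.
  by rewrite rootC fmorph_eq0 -polyC_eq0 -pE.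
move=> q sq /dvdpP[r pE].
have [r0 q0] : r != 0 /\ q != 0.
  by apply/andP; rewrite -negb_or -mulf_eq0 -pE.
have : root (map_poly f (r * q)) z by rewrite -pE.
rewrite rmorphM rootM !dv => /orP[pr|pq].
  have := dvdp_leq r0 pr; rewrite pE size_mul // => h.
  have : (size q <= 1)%N by move: h (size_poly_gt0 r); rewrite r0; lia.
  by move: (size_poly_gt0 q); rewrite q0; move: sq; lia.
by rewrite /eqp pq andbT pE dvdp_mull.
Qed.

(** The two-generator theorem, iterated. The generator is the value at [x] of a polynomial [T], so
    that it can be carried along to any conjugate tuple. *)
Lemma primitive_element m (E : fieldType) (f : {rmorphism K -> E}) (x : 'I_m -> E) :
  (forall i, algebraicOver f (x i)) ->
  exists T : {mpoly K[m]}, algebraicOver f (mmap f x T) /\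
    exists p : 'I_m -> {poly K}, forall i, x i = (map_poly f (p i)).[mmap f x T].
Proof.
move=> algx.
suff [T [aT hT]] : exists T : {mpoly K[m]}, algebraicOver f (mmap f x T) /\
    forall i, i \in enum 'I_m -> exists p : {poly K}, x i = (map_poly f p).[mmap f x T].
  have /choice[p pE] i : exists p : {poly K}, x i = (map_poly f p).[mmap f x T].
    by apply: hT; rewrite mem_enum.
  by exists T; split=> //; exists p.
elim: (enum 'I_m) => [|i s [T [aT IH]]].
  by exists 0; rewrite mmap0; split=> //; apply: algebraic0.
case: (aT) (algx i) => [p p0 pT] [q q0 qx].
have [n /= [[r1 e1] [r2 e2]]] := pchar0_PET p0 pT q0 qx char0K.
have e : mmap f x ('X_i *+ n - T) = x i *+ n - mmap f x T.
  by rewrite mmapB mmapMn mmapXi.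
exists ('X_i *+ n - T); split.
  rewrite e -mulr_natl; apply: algebraic_sub => //; apply: algebraic_mul => //.
  by rewrite -(rmorph_nat f); apply: algebraic_id.
move=> j; rewrite inE => /orP[/eqP->|/IH[r ->]]; first by exists r2; rewrite e e2.
by exists (r \Po r1); rewrite e map_comp_poly horner_comp e1.
Qed.

Lemma mmap_primitive m (E : fieldType) (f : {rmorphism K -> E}) (p : 'I_m -> {poly K})
    (z : E) (P : {mpoly K[m]}) :
  mmap f (fun i => (map_poly f (p i)).[z]) P = (map_poly f (mmap polyC p P)).[z].
Proof.
have := rmorph_mmap polyC (horner_eval z \o map_poly f) p P.
rewrite /= /horner_eval => ->; apply: eq_mmap => // c /=.
by rewrite map_polyC hornerC.
Qed.

(** Each relation reduces to a polynomial r evaluated at the generator. Either q divides r, and both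
    values vanish, or a Bezout identity excludes a common root. *)
Lemma conj_over_irreducible m (E E' : fieldType) (f : {rmorphism K -> E})
    (f' : {rmorphism K -> E'}) (q : {poly K}) z z' (p : 'I_m -> {poly K}) :
  irreducible_poly q ->
  (forall r, root (map_poly f r) z = (q %| r)) -> root (map_poly f' q) z' ->
  conj_over f f' (fun i => (map_poly f (p i)).[z]) (fun i => (map_poly f' (p i)).[z']).
Proof.
move=> [sq irr] qz qz' P; rewrite !mmap_primitive -!rootE qz.
set r := mmap _ _ _; apply/idP/idP => [/dvdpP[s ->]|rz'].
  by rewrite rmorphM rootM qz' orbT.
suff g : size (gcdp q r) != 1.
  by have /andP[_] := irr _ g (dvdp_gcdl _ _); move/dvdp_trans; apply; exact: dvdp_gcdr.
apply: contraL rz' => cop; have /Bezout_eq1_coprimepP[[u v] /= e] : coprimep q r by [].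
apply/negP => rz'; have := congr1 (fun s => (map_poly f' s).[z']) e.
rewrite rmorphD !rmorphM /= hornerD !hornerM (rootP qz') (rootP rz') !mulr0 addr0.
by rewrite rmorph1 hornerC => /eqP; rewrite eq_sym oner_eq0.
Qed.

Lemma conj_over_exists m (E : fieldType) (Kbar : closedFieldType)
    (f : {rmorphism K -> E}) (iota : {rmorphism K -> Kbar}) (x : 'I_m -> E) :
  (forall i, algebraicOver f (x i)) -> exists y, conj_over f iota x y.
Proof.
move=> /primitive_element[T [aT [p xE]]].
have [q irrq qT] := irreducible_annihilator aT.
have [z' qz'] : exists z', root (map_poly iota q) z'.
  apply/closed_rootP; rewrite size_map_poly neq_ltn; case: irrq => -> _; by rewrite orbT.
exists (fun i => (map_poly iota (p i)).[z']).
move=> P; rewrite -(conj_over_irreducible p irrq qT qz').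
by congr (_ == 0); apply: eq_mmap.
Qed.

End TypeEquality.

Section Splitting.

Variable K : fieldType.
Hypothesis char0K : has_pchar0 K.
Variables (Kbar : closedFieldType) (iota : {rmorphism K -> Kbar}).
Hypothesis alg_closure : algebraic_closure iota.

(** K(x) is built abstractly as K[X]/(q), where q is the minimal polynomial of a primitive element
    t, and is embedded into [Kbar] by evaluation at t. The hypothesis makes every root of q a
    polynomial in components of x, so K(x) is normal. *)
Lemma closed_tuple_splitting m (x : 'I_m -> Kbar) :
  (forall y, conj_over iota iota x y -> forall i, exists k, y i = x k) ->
  exists (L : splittingFieldType K) (j : {rmorphism L -> Kbar}) (u : 'I_m -> L),
    [/\ forall a, j a%:A = iota a, forall i, j (u i) = x i
      & <<1 & codom u>>%VS = fullv].
Proof.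
move=> closed_x.
have [T [aT [p xE]]] := primitive_element char0K (fun i => alg_closure (x i)).
set t := mmap iota x T in aT xE.
have [q irrq qT] := irreducible_annihilator aT.
have [L0 dimL0 [z qz genz]] := irredp_FAdjoin irrq.
have Kz w : exists r : {poly K}, w = (map_poly (in_alg L0) r).[z].
  by apply/Fadjoin1_polyP; rewrite genz memvf.
have qzE r : root (map_poly (in_alg L0) r) z = (q %| r).
  apply/idP/idP => [rz|/dvdpP[s ->]]; last by rewrite rmorphM rootM qz orbT.
  have := conj_over_irreducible (fun _ : 'I_1 => 'X) irrq qT qz.
  move/(_ (map_poly (mpolyC 1 (R:=K)) r).['X_ord0]); rewrite !mmap_horner !mmapXi.
  by rewrite !map_polyX !hornerX -!rootE rz qT => ->.
(* Well defined because z and t have the same annihilators. *)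
have /choice[j jE] w : exists v, forall r, w = (map_poly (in_alg L0) r).[z] ->
    v = (map_poly iota r).[t].
  have [r wr] := Kz w; exists (map_poly iota r).[t] => r' wr'.
  apply/eqP; rewrite -subr_eq0 -hornerN -hornerD -rmorphB -rootE qT -qzE rootE.
  by rewrite rmorphB hornerD hornerN -wr -wr' subrr.
have jB : zmod_morphism j.
  move=> w w'; have [r wr] := Kz w; have [r' wr'] := Kz w'.
  rewrite (jE _ (r - r')) ?(jE _ _ wr) ?(jE _ _ wr') ?rmorphB ?hornerD ?hornerN //=.
  by rewrite -wr -wr'.
have jM : monoid_morphism j.
  split=> [|w w']; first by rewrite (jE _ 1) ?rmorph1 ?hornerC.
  have [r wr] := Kz w; have [r' wr'] := Kz w'.
  rewrite (jE _ (r * r')) ?(jE _ _ wr) ?(jE _ _ wr') ?rmorphM ?hornerM //=.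
  by rewrite -wr -wr'.
have [J JE] : exists J : {rmorphism L0 -> Kbar},
    forall w r, w = (map_poly (in_alg L0) r).[z] -> J w = (map_poly iota r).[t].
  pose jz := GRing.isZmodMorphism.Build _ _ j jB.
  pose jm := GRing.isMonoidMorphism.Build _ _ j jM.
  by exists (HB.pack j jz jm : {rmorphism L0 -> Kbar}).
have JA a : J a%:A = iota a by rewrite (JE _ a%:P) ?map_polyC ?hornerC.
have Jz : J z = t by rewrite (JE _ 'X) ?map_polyX ?hornerX.
have Jr (r : {poly K}) w : J (map_poly (in_alg L0) r).[w] = (map_poly iota r).[J w].
  rewrite -horner_map -map_poly_comp; congr (_.[_]); apply: eq_map_poly => a; exact: JA.
have Jm (y : 'I_m -> L0) P : J (mmap (in_alg L0) y P) = mmap iota (fun i => J (y i)) P.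
  by rewrite rmorph_mmap; apply: eq_mmap => // a; apply: JA.
pose u i := (map_poly (in_alg L0) (p i)).[z].
have Ju i : J (u i) = x i by rewrite /u Jr Jz -xE.
have uT y : J (mmap (in_alg L0) (fun i => u (y i)) T) = mmap iota (fun i => x (y i)) T.
  by rewrite Jm; apply: eq_mmap.
have mmap_in (U : {subfield L0}) (y : 'I_m -> L0) P :
    (forall i, y i \in U) -> mmap (in_alg L0) y P \in U.
  move=> hy; rewrite /mmap; apply: rpred_sum => k _; apply: rpredM.
    by rewrite -[X in X \in _]/(_ *: 1) memvZ ?mem1v.
  by apply: rpred_prod => i _; apply: rpredX.
have zE : z = mmap (in_alg L0) u T.
  by apply: (fmorph_inj J); rewrite Jz (uT id).
(* The roots of q correspond to the conjugates of x, which by hypothesis have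
   their components among those of x. *)
have [rs rsE] : exists rs : seq L0,
    map_poly iota q %= \prod_(w <- map J rs) ('X - w%:P).
  have [s sE] := closed_field_poly_normal (map_poly iota q).
  have q0 : map_poly iota q != 0 by rewrite map_poly_eq0 irredp_neq0.
  have hs w : w \in s -> exists v, J v = w.
    move=> ws; have qw : root (map_poly iota q) w.
      rewrite sE rootZ ?lead_coef_eq0 // root_prod_XsubC //.
    pose y i := (map_poly iota (p i)).[w].
    have xy : conj_over iota iota x y.
      move=> P; rewrite -(conj_over_irreducible p irrq qT qw).
      by congr (_ == 0); apply: eq_mmap.
    have wE : w = mmap iota y T.
      rewrite mmap_primitive.
      have : q %| mmap polyC p T - 'X.
        rewrite -qT rmorphB /= map_polyX rootE hornerD hornerN hornerX -mmap_primitive.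
        by rewrite subr_eq0; apply/eqP; apply: eq_mmap => // i; rewrite -xE.
      case/dvdpP=> r /(congr1 (fun r => (map_poly iota r).[w])).
      rewrite rmorphB rmorphM /= hornerD hornerN hornerM (rootP qw) mulr0 map_polyX hornerX.
      by move/eqP; rewrite subr_eq0 => /eqP.
    have /choice[k ky] := closed_x _ xy.
    exists (mmap (in_alg L0) (fun i => u (k i)) T); rewrite uT [RHS]wE.
    by apply: eq_mmap.
  have [rs rsE] : exists rs, map J rs = s.
    elim: (s) hs => [|w s' IH] hs; first by exists [::].
    have [v vE] := hs w (mem_head _ _).
    have [|rs <-] := IH; first by move=> w' hw'; apply: hs; rewrite inE hw' orbT.
    by exists (v :: rs); rewrite -vE.
  by exists rs; rewrite rsE {1}sE eqp_scale // lead_coef_eq0.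
have splits : splitting_field_axiom L0.
  exists (map_poly (in_alg L0) q); first exact: alg_polyOver.
  exists rs.
    rewrite -(eqp_map J) -map_poly_comp (_ : map_poly _ _ = map_poly iota q).
      rewrite (eqp_trans rsE) // rmorph_prod big_map eqp_sym.
      by apply/eqpW; apply: eq_bigr => w _; rewrite rmorphB /= map_polyX map_polyC.
    by apply: eq_map_poly => a; apply: JA.
  have zrs : z \in rs.
    have : root (map_poly iota q) (J z) by rewrite Jz qT.
    by rewrite (eqp_root rsE) root_prod_XsubC mem_map //; apply: fmorph_inj.
  apply/eqP; rewrite eqEsubv subvf -genz /=.
  by apply/FadjoinP; rewrite subv_adjoin_seq seqv_sub_adjoin.
pose Ls := FieldExt_isSplittingField.Build K L0 splits.
pose L : splittingFieldType K := HB.pack L0 Ls.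
exists L, J, u; split=> //.
apply/eqP; rewrite eqEsubv subvf -genz /=; apply/FadjoinP.
split; first exact: subv_adjoin_seq.
by rewrite zE; apply: mmap_in => i; rewrite seqv_sub_adjoin // codom_f.
Qed.

End Splitting.

Section ConjOver.

Variable K : fieldType.

Lemma conj_over_sym m (E E' : fieldType) (f : {rmorphism K -> E})
    (f' : {rmorphism K -> E'}) (x : 'I_m -> E) (y : 'I_m -> E') :
  conj_over f f' x y -> conj_over f' f y x.
Proof. by move=> h P; rewrite h. Qed.

Lemma conj_over_trans m (E E' E'' : fieldType) (f : {rmorphism K -> E})
    (f' : {rmorphism K -> E'}) (f'' : {rmorphism K -> E''})
    (x : 'I_m -> E) (y : 'I_m -> E') (z : 'I_m -> E'') :
  conj_over f f' x y -> conj_over f' f'' y z -> conj_over f f'' x z.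
Proof. by move=> h h' P; rewrite h. Qed.

Lemma conj_over_morph m (E E' : fieldType) (f : {rmorphism K -> E})
    (f' : {rmorphism K -> E'}) (g : {rmorphism E -> E'}) (x : 'I_m -> E) :
  (forall a, g (f a) = f' a) -> conj_over f f' x (fun i => g (x i)).
Proof.
move=> gf P; rewrite -(fmorph_eq0 g) rmorph_mmap.
by congr (_ == 0); apply: eq_mmap.
Qed.

Lemma conj_over_reindex m m' (E E' : fieldType) (f : {rmorphism K -> E})
    (f' : {rmorphism K -> E'}) (x : 'I_m -> E) (y : 'I_m -> E') (s : 'I_m' -> 'I_m) :
  conj_over f f' x y -> conj_over f f' (fun i => x (s i)) (fun i => y (s i)).
Proof.
move=> xy P; pose Q := mmap (mpolyC m (R:=K)) (fun i => 'X_(s i)) P.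
have e (D : fieldType) (h : {rmorphism K -> D}) (z : 'I_m -> D) :
    mmap h (fun i => z (s i)) P = mmap h z Q.
  rewrite /Q (rmorph_mmap (mpolyC m (R:=K)) (mmap h z)).
  by apply: eq_mmap => [c|i] /=; rewrite ?mmapC ?mmapXi.
by rewrite !e.
Qed.

Lemma eq_conj_over m (E E' : fieldType) (f : {rmorphism K -> E})
    (f' : {rmorphism K -> E'}) (x x' : 'I_m -> E) (y y' : 'I_m -> E') :
  x =1 x' -> y =1 y' -> conj_over f f' x y -> conj_over f f' x' y'.
Proof.
move=> ex ey h P; rewrite -(eq_mmap P (frefl f) ex) h.
by rewrite (eq_mmap P (frefl f') ey).
Qed.

End ConjOver.

Section GaloisConjugation.

Variable K : fieldType.
Hypothesis char0K : has_pchar0 K.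

(** The polynomial [T] gives generators z at [x] and z' at [y] with the same minimal polynomial;
    normality yields g with g z = z', and the formulas for the [x i] in terms of z are themselves
    relations, hence hold for [y]. *)
Lemma conj_over_gal (L : splittingFieldType K) m (x y : 'I_m -> L) :
  conj_over (in_alg L) (in_alg L) x y ->
  exists2 g, g \in 'Gal({:L} / 1)%g & forall i, g (x i) = y i.
Proof.
move=> xy.
have alg_L w : algebraicOver (in_alg L) w.
  have /polyOver1P[q qE] := minPolyOver 1 w; exists q.
    by rewrite -(map_poly_eq0 (in_alg L)) -qE monic_neq0 // monic_minPoly.
  by rewrite -qE root_minPoly.
have [T [aT [p xE]]] := primitive_element char0K (fun i => alg_L (x i)).
set z := mmap _ x T in xE; set z' := mmap (in_alg L) y T.
have zz' (q : {poly K}) : root (map_poly (in_alg L) q) z = root (map_poly (in_alg L) q) z'.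
  by rewrite !rootE -!mmap_horner xy.
have [g gG gz] : exists2 g, g \in 'Gal({:L} / 1)%g & g z = z'.
  apply: normalField_root_minPoly; rewrite ?subvf ?normalFieldf ?memvf //.
  have /polyOver1P[q qE] := minPolyOver 1 z.
  by rewrite qE -zz' -qE root_minPoly.
exists g => // i; rewrite xE.
have gA a : g (in_alg L a) = in_alg L a.
  by apply: (fixed_gal (subvf 1%VS) gG); rewrite /= memvZ ?mem1v.
rewrite -horner_map -map_poly_comp (@eq_map_poly _ _ _ (in_alg L) gA).
rewrite [X in _.[X]]gz /z' -mmap_horner.
have := conj_over_eq xy (map_poly (mpolyC m (R:=K)) (p i)).[T] 'X_i.
by rewrite !mmap_horner -xE !mmapXi eqxx => /esym/eqP.
Qed.

(** The tuple of all roots of a product of annihilators satisfies the closure condition of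
    [closed_tuple_splitting], whatever [x] is. *)
Lemma finite_splitting (Kbar : closedFieldType) (iota : {rmorphism K -> Kbar})
    m (x : 'I_m -> Kbar) : algebraic_closure iota ->
  exists (L : splittingFieldType K) (j : {rmorphism L -> Kbar}) (u : 'I_m -> L),
    (forall a, j a%:A = iota a) /\ (forall i, j (u i) = x i).
Proof.
move=> alg.
have /choice[q qP] i : exists q : {poly K}, q != 0 /\ root (map_poly iota q) (x i).
  by have [q] := alg (x i); exists q.
pose p := \prod_i q i.
have p0 : map_poly iota p != 0.
  by rewrite map_poly_eq0; apply/prodf_neq0 => i _; case: (qP i).
have [s sE] := closed_field_poly_normal (map_poly iota p).
have rootP w : root (map_poly iota p) w = (w \in s).
  by rewrite sE rootZ ?lead_coef_eq0 // root_prod_XsubC.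
pose r (k : 'I_(size s)) := s`_k.
have [|L [j [u [jA ju _]]]] := @closed_tuple_splitting K char0K Kbar iota alg _ r.
  move=> y ry i; have : y i \in s.
    rewrite -rootP rootE; have := ry (map_poly (mpolyC _ (R:=K)) p).['X_i].
    by rewrite !mmap_horner !mmapXi => <-; rewrite -rootE rootP mem_nth.
  by move=> /(nthP 0)[k ks <-]; exists (Ordinal ks).
have /choice[v vE] i : exists v, j v = x i.
  have : x i \in s.
    rewrite -rootP /p rmorph_prod rootE horner_prod prodf_seq_eq0 /=.
    by apply/hasP; exists i; rewrite ?mem_index_enum // -rootE; case: (qP i).
  by move=> /(nthP 0)[k ks <-]; exists (u (Ordinal ks)).
by exists L, j, v.
Qed.

End GaloisConjugation.

(** * Radical towers *)

Section Radicals.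

Variables (K : fieldType) (L : splittingFieldType K).
Implicit Types (H : {group gal_of {:L}}) (W : L -> Prop).

(** [H] acts on [W] through an abelian group: the identity s t = t s [s, t] is evaluated at the
    preimage of w under t s. *)
Lemma derived_fix H W :
  (forall s w, s \in H -> W w -> W (s w)) ->
  (forall s t w, s \in H -> t \in H -> W w -> t (s w) = s (t w)) ->
  forall s w, s \in [~: H, H]%g -> W w -> s w = w.
Proof.
move=> HW Hcom s w sH Ww; apply/eqP; move: s sH.
pose S := [set s : gal_of {:L} | s w == w].
have gS : group_set S.
  apply/group_setP; split; first by rewrite inE gal_id.
  by move=> s t; rewrite !inE galM ?memvf // => /eqP-> /eqP->.
suff : [~: H, H]%g \subset Group gS by move=> /subsetP h s /h; rewrite inE.
rewrite gen_subG; apply/subsetP => _ /imset2P[s t sH tH ->]; rewrite inE.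
have st : (s * t)%g = ((t * s) * [~ s, t])%g by exact: commgC.
pose w' := ((t * s)^-1)%g w.
have Ww' : W w' by apply: HW => //; rewrite groupV groupM.
have wE : w = (t * s)%g w' by rewrite -galM ?memvf // mulVg gal_id.
rewrite {1}wE -galM ?memvf // -st wE !galM ?memvf //.
by rewrite Hcom.
Qed.

Local Notation G := 'Gal({:L} / 1)%G.

Lemma derived_fix_unity s (z : L) m :
  (0 < m)%N -> z ^+ m = 1 -> s \in G^`(1)%g -> s z = z.
Proof.
move=> m0 zm sG; apply: (@derived_fix G (fun z => z ^+ m = 1)) => //.
  by move=> t w _ wm; rewrite -rmorphXn wm rmorph1.
move=> t t' w _ _ wm; have [d pd _] := prim_order_exists m0 wm.
have pw (r : gal_of {:L}) : exists i, r w = w ^+ i.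
  have [|i ->] := prim_rootP pd (x := r w); last by exists i.
  by rewrite -rmorphXn (prim_expr_order pd) rmorph1.
have [[i ti] [i' ti']] := (pw t, pw t').
by rewrite ti ti' !rmorphXn /= ti ti' -!exprM mulnC.
Qed.

(** Kummer theory without roots of unity in K: these automorphisms multiply each root w of w^m = v^m
    by m-th roots of unity, which the first derived subgroup fixes, so they commute on such w. *)
Lemma derived_fix_radical k (v : L) m :
  (0 < m)%N -> (forall s, s \in G^`(k.+1)%g -> s (v ^+ m) = v ^+ m) ->
  forall s, s \in G^`(k.+2)%g -> s v = v.
Proof.
move=> m0 fix_vm s sG.
have [->|v0] := eqVneq v 0; first by rewrite rmorph0.
have sub1 t : t \in G^`(k.+1)%g -> t \in G^`(1)%g.
  by apply: subsetP; elim: (k) => [|i IH] //; exact: subset_trans (der_subS _ _) IH.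
apply: (@derived_fix (G^`(k.+1)%G) (fun w => w ^+ m = v ^+ m)) => //.
  by move=> t w tG wm; rewrite -rmorphXn /= wm fix_vm.
move=> t t' w tG t'G wm.
have w0 : w != 0.
  apply: contraNneq v0 => w0; have := esym wm; rewrite w0 expr0n eqn0Ngt m0 => /eqP.
  by rewrite expf_eq0 m0.
have tw r : r \in G^`(k.+1)%g -> exists2 z, z ^+ m = 1 & r w = z * w.
  move=> rG; exists (r w / w); last by rewrite divfK.
  by rewrite expr_div_n -rmorphXn /= wm fix_vm // divff // expf_neq0.
have [[z zm tz] [z' zm' tz']] := (tw _ tG, tw _ t'G).
rewrite tz tz' !rmorphM /= tz tz'.
by rewrite (derived_fix_unity m0 zm (sub1 _ t'G)) (derived_fix_unity m0 zm' (sub1 _ tG)) mulrCA.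
Qed.

Variables (Kbar : closedFieldType) (iota : {rmorphism K -> Kbar}).
Variable j : {rmorphism L -> Kbar}.
Hypothesis jA : forall a, j a%:A = iota a.

(* Inside L, a radical tower is fixed by a derived subgroup of the Galois
   group: no roots of unity need to be adjoined, because the automorphisms act
   on them through an abelian group. *)
Lemma radical_derived_fix s : radical_tower iota s ->
  (forall a, a \in s -> exists v, j v = a) ->
  exists k, forall x, adjoin iota (fun y => y \in s) x ->
    exists2 v, j v = x & forall g, g \in G^`(k)%g -> g v = v.
Proof.
move=> tower js.
(* The i-th field of the tower goes with the derived subgroup of index [i.+1]: the first derivation
   is spent on roots of unity. *)
have adj i : (forall x, x \in take i s -> exists2 v, j v = x &
      forall g, g \in G^`(i.+1)%g -> g v = v) ->
    forall x, adjoin iota (fun y => y \in take i s) x ->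
      exists2 v, j v = x & forall g, g \in G^`(i.+1)%g -> g v = v.
  move=> hgen x; elim=> {x}.
  - move=> a; exists a%:A => // g gG; apply: (fixed_gal (subvf 1%VS)).
      by apply: (subsetP (der_sub i.+1 G)).
    by rewrite memvZ ?mem1v.
  - exact: hgen.
  - move=> x y _ [v <- vP] _ [w <- wP]; exists (v - w); first by rewrite rmorphB.
    by move=> g gG; rewrite rmorphB /= vP ?wP.
  - move=> x y _ [v <- vP] _ [w <- wP]; exists (v * w); first by rewrite rmorphM.
    by move=> g gG; rewrite rmorphM /= vP ?wP.
  - move=> x _ [v <- vP]; exists v^-1; first by rewrite fmorphV.
    by move=> g gG; rewrite fmorphV /= vP.
have gen i : (i <= size s)%N -> forall x, x \in take i s -> exists2 v, j v = x &
      forall g, g \in G^`(i.+1)%g -> g v = v.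
  elim: i => [|i IH] hi x; first by rewrite take0.
  rewrite (take_nth 0) // mem_rcons inE => /orP[/eqP->|xi]; last first.
    have [v <- vP] := IH (ltnW hi) x xi; exists v => // g gG; apply: vP.
    exact: (subsetP (der_subS _ _)) gG.
  have [v jv] := js _ (mem_nth 0 hi); exists v => //.
  have [m m0 /(adj _ (IH (ltnW hi)))[w jw wP]] := tower _ hi.
  apply: (derived_fix_radical m0) => g gG.
  have -> : v ^+ m = w by apply: (fmorph_inj j); rewrite rmorphXn /= jv jw.
  exact: wP.
exists (size s).+1 => x hx; apply: adj; last by rewrite take_size.
by apply: gen.
Qed.

End Radicals.

(** * Power series and lifting of simple solutions *)

Record series (k : Type) := Series { scoef : nat -> k }.

Lemma seriesP (k : Type) (a b : series k) : (forall i, scoef a i = scoef b i) -> a = b.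
Proof. by case: a b => [f] [g] /= /funext->. Qed.

HB.instance Definition _ (k : Type) := gen_eqMixin (series k).
HB.instance Definition _ (k : Type) := gen_choiceMixin (series k).

Section SeriesRing.

Variable k : fieldType.
Local Notation E := (series k).
Implicit Types a b c : E.

Definition series_add a b : E := Series (fun i => scoef a i + scoef b i).
Definition series_opp a : E := Series (fun i => - scoef a i).
Definition series_poly (p : {poly k}) : E := Series (fun i => p`_i).
Definition series_trunc n a : {poly k} := \poly_(i < n) scoef a i.
Definition series_mul a b : E :=
  Series (fun n => \sum_(i < n.+1) scoef a i * scoef b (n - i)).

Fact series_addA : associative series_add.
Proof. by move=> a b c; apply: seriesP => i /=; rewrite addrA. Qed.
Fact series_addC : commutative series_add.
Proof. by move=> a b; apply: seriesP => i /=; rewrite addrC. Qed.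
Fact series_add0 : left_id (series_poly 0) series_add.
Proof. by move=> a; apply: seriesP => i /=; rewrite coef0 add0r. Qed.
Fact series_addN : left_inverse (series_poly 0) series_opp series_add.
Proof. by move=> a; apply: seriesP => i /=; rewrite coef0 addNr. Qed.

HB.instance Definition _ :=
  GRing.isZmodule.Build E series_addA series_addC series_add0 series_addN.

(** Coefficients of products are those of products of truncations, which reduces the ring axioms to
    those of [{poly k}]. *)
Lemma series_mul_trunc n m a b : (n < m)%N ->
  scoef (series_mul a b) n = (series_trunc m a * series_trunc m b)`_n.
Proof.
move=> nm; rewrite coefM; apply: eq_bigr => i _.
have im : (i < m)%N by rewrite (leq_trans _ nm) // ltnS -ltnS.
by rewrite !coef_poly im (leq_ltn_trans (leq_subr _ _) nm).
Qed.

Lemma series_truncE n m a : (n < m)%N -> (series_trunc m a)`_n = scoef a n.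
Proof. by move=> nm; rewrite coef_poly nm. Qed.

Fact series_mulC : commutative series_mul.
Proof.
by move=> a b; apply: seriesP => n; rewrite !(@series_mul_trunc n n.+1) // mulrC.
Qed.

Fact series_mulA : associative series_mul.
Proof.
move=> a b c; apply: seriesP => n.
have trunc_mul (p q r : {poly k}) : (forall i, (i <= n)%N -> q`_i = r`_i) ->
    (p * q)`_n = (p * r)`_n.
  by move=> qr; rewrite !coefM; apply: eq_bigr => i _; rewrite qr // leq_subr.
have tr d e i : (i <= n)%N -> (series_trunc n.+1 (series_mul d e))`_i =
    (series_trunc n.+1 d * series_trunc n.+1 e)`_i.
  by move=> i_n; rewrite series_truncE // (@series_mul_trunc _ n.+1).
rewrite !(@series_mul_trunc n n.+1) // (trunc_mul _ _ _ (tr _ _)) mulrA mulrC.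
by rewrite [in RHS]mulrC; apply/esym/trunc_mul/tr.
Qed.

Fact series_mul1 : left_id (series_poly 1) series_mul.
Proof.
move=> a; apply: seriesP => n; rewrite (@series_mul_trunc n n.+1) //.
rewrite (_ : series_trunc _ (series_poly 1) = 1) ?mul1r ?series_truncE //.
by apply/polyP => i; rewrite coef_poly /= !coef1; case: i => //= i; rewrite if_same.
Qed.

Fact series_mulDl : left_distributive series_mul series_add.
Proof.
move=> a b c; apply: seriesP => n /=; rewrite -big_split /=.
by apply: eq_bigr => i _; rewrite mulrDl.
Qed.

Fact series_1neq0 : series_poly 1 != 0.
Proof.
apply/eqP => /(congr1 (fun a => scoef a 0)) /=; rewrite coef1 coef0.
by apply/eqP/oner_neq0.
Qed.

HB.instance Definition _ := GRing.Zmodule_isComNzRing.Build E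
  series_mulA series_mulC series_mul1 series_mulDl series_1neq0.

Definition series_unit : {pred E} := fun a => `[< exists b, b * a = 1 >].
Definition series_inv a : E :=
  if pselect (exists b, b * a = 1) is left h then projT1 (cid h) else a.

Fact series_mulV : {in series_unit, left_inverse 1 series_inv *%R}.
Proof.
by move=> a /asboolP h; rewrite /series_inv; case: pselect => // h'; case: cid.
Qed.
Fact series_unitP a b : b * a = 1 -> series_unit a.
Proof. by move=> h; apply/asboolP; exists b. Qed.
Fact series_inv_out : {in [predC series_unit], series_inv =1 id}.
Proof.
by move=> a /negP h; rewrite /series_inv; case: pselect => // h'; case: h; apply/asboolP.
Qed.

HB.instance Definition _ := GRing.ComNzRing_hasMulInverse.Build E
  series_mulV series_unitP series_inv_out.

Lemma scoefB a b i : scoef (a - b) i = scoef a i - scoef b i.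
Proof. by []. Qed.

Lemma scoefM a b n : scoef (a * b) n = \sum_(i < n.+1) scoef a i * scoef b (n - i).
Proof. by []. Qed.

Lemma scoef0 i : scoef (0 : E) i = 0.
Proof. exact: coef0. Qed.

Lemma series_neq0 a : a != 0 ->
  exists2 i, scoef a i != 0 & forall j, (j < i)%N -> scoef a j = 0.
Proof.
move=> a0; have exi : exists i, scoef a i != 0.
  apply/not_existsP => h; move/eqP: a0; apply; apply: seriesP => i.
  by rewrite scoef0; apply/eqP; have := h i; move/negP; rewrite negbK.
have [i ai imin] := find_ex_minn exi; exists i => // j ji; apply/eqP.
by apply: contraTT ji => aj; rewrite -leqNgt imin.
Qed.

Fact series_integral : GRing.integral_domain_axiom E.
Proof.
move=> a b ab0; apply/norP => -[/series_neq0[i ai amin] /series_neq0[j bj bmin]].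
have := congr1 (fun d => scoef d (i + j)) ab0; rewrite scoef0 scoefM.
have ij : (i < (i + j).+1)%N by rewrite ltnS leq_addr.
rewrite (bigD1 (Ordinal ij)) //= addKn big1 ?addr0.
  by move/eqP; rewrite mulf_eq0 (negPf ai) (negPf bj).
move=> l; rewrite -val_eqE /= => li.
have [lt_li|le_il] := ltnP l i; first by rewrite amin // mul0r.
rewrite [X in _ * X]bmin ?mulr0 //.
by move: li le_il (ltn_ord l); lia.
Qed.

HB.instance Definition _ := GRing.ComUnitRing_isIntegral.Build E series_integral.

Fact series_poly_zmod : zmod_morphism series_poly.
Proof. by move=> p q; apply: seriesP => i /=; rewrite coefB. Qed.
Fact series_poly_monoid : monoid_morphism series_poly.
Proof. by split=> // p q; apply: seriesP => i /=; rewrite coefM. Qed.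
HB.instance Definition _ := GRing.isZmodMorphism.Build _ _ series_poly series_poly_zmod.
HB.instance Definition _ :=
  GRing.isMonoidMorphism.Build _ _ series_poly series_poly_monoid.

Lemma series_poly_inj : injective series_poly.
Proof.
move=> p q /(congr1 (@scoef k)) /= pq; apply/polyP => i.
by rewrite -[LHS]/((fun i => p`_i) i) pq.
Qed.

Definition sconst (c : k) : E := series_poly c%:P.
Fact sconst_zmod : zmod_morphism sconst.
Proof. by move=> c d; rewrite /sconst !rmorphB. Qed.
Fact sconst_monoid : monoid_morphism sconst.
Proof. by split=> [|c d]; rewrite /sconst ?rmorph1 // !rmorphM. Qed.
HB.instance Definition _ := GRing.isZmodMorphism.Build _ _ sconst sconst_zmod.
HB.instance Definition _ := GRing.isMonoidMorphism.Build _ _ sconst sconst_monoid.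

Definition sresidue a := scoef a 0.
Fact sresidue_zmod : zmod_morphism sresidue.
Proof. by []. Qed.
Fact sresidue_monoid : monoid_morphism sresidue.
Proof. by split=> [|a b]; rewrite /sresidue /= ?coef1 // big_ord1. Qed.
HB.instance Definition _ := GRing.isZmodMorphism.Build _ _ sresidue sresidue_zmod.
HB.instance Definition _ := GRing.isMonoidMorphism.Build _ _ sresidue sresidue_monoid.

Lemma sconstK : cancel sconst sresidue.
Proof. by move=> c; rewrite /sresidue /= coefC. Qed.

Definition svar : E := series_poly 'X.

Lemma sresidue_var : sresidue svar = 0.
Proof. by rewrite /sresidue /= coefX. Qed.

Lemma svar_neq0 : svar != 0.
Proof.
by rewrite /svar -(rmorph0 series_poly) (inj_eq series_poly_inj) polyX_eq0.
Qed.

Definition sshift a : E := Series (fun i => scoef a i.+1).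
Fact sshift_zmod : zmod_morphism sshift.
Proof. by []. Qed.
HB.instance Definition _ := GRing.isZmodMorphism.Build _ _ sshift sshift_zmod.

Lemma scoef_mulVar a i : scoef (svar * a) i = if i is i'.+1 then scoef a i' else 0.
Proof.
rewrite scoefM /=; case: i => [|i]; first by rewrite big_ord1 coefX mul0r.
rewrite !big_ord_recl big1 /= ?coefX ?mul0r ?add0r ?mul1r ?addr0 ?subSS ?subn0 //.
by move=> j _; rewrite coefX mul0r.
Qed.

Lemma svarK a : sshift (svar * a) = a.
Proof. by apply: seriesP => i; exact: (scoef_mulVar a i.+1). Qed.

Lemma sshiftK a : svar * sshift a = a - sconst (sresidue a).
Proof.
apply: seriesP => i; rewrite scoef_mulVar scoefB /= coefC.
by case: i => [|i] /=; rewrite ?subr0 // subrr.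
Qed.

Lemma svar_exprP i a : (forall j, (j < i)%N -> scoef a j = 0) <-> exists b, a = svar ^+ i * b.
Proof.
split=> [|[b ->]].
  elim: i a => [|i IH] a ha; first by exists a; rewrite expr0 mul1r.
  have [j ji|b bE] := IH (sshift a); first by rewrite /= ha.
  exists b; rewrite exprS -mulrA -bE sshiftK /sresidue ha //.
  by rewrite (rmorph0 sconst) subr0.
elim: i => // i IH [|j] ji; rewrite exprS -mulrA scoef_mulVar //.
exact: IH.
Qed.

End SeriesRing.

Arguments sresidue {k} a : simpl never.
Arguments sconst {k} c : simpl never.
Arguments series_poly {k} p : simpl never.
Arguments sshift {k} a : simpl never.
Arguments svar {k} : simpl never.

Section Contraction.

Variables (k : fieldType) (n : nat).
Local Notation E := (series k).
Local Notation eps := (@svar k).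
Implicit Types X Y Z : 'M[E]_n.

Definition series_close i X Y := exists Z, X = Y + eps ^+ i *: Z.

Lemma series_closeP i X Y :
  series_close i X Y <->
  forall r c j, (j < i)%N -> scoef (X r c) j = scoef (Y r c) j.
Proof.
split=> [[Z ->] r c j ji|h].
  rewrite !mxE -[LHS]/(scoef (Y r c) j + scoef (eps ^+ i * Z r c) j).
  have /svar_exprP-> // : exists b, eps ^+ i * Z r c = eps ^+ i * b by exists (Z r c).
  by rewrite addr0.
have /choice[z zE] (rc : 'I_n * 'I_n) :
    exists b, X rc.1 rc.2 - Y rc.1 rc.2 = eps ^+ i * b.
  by apply/svar_exprP => j ji; rewrite scoefB h ?subrr.
exists (\matrix_(r, c) z (r, c)); apply/matrixP => r c.
by rewrite !mxE -(zE (r, c)) addrC subrK.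
Qed.

Lemma series_close_eq X Y : (forall i, series_close i X Y) -> X = Y.
Proof.
move=> h; apply/matrixP => r c; apply: seriesP => i.
by have /series_closeP := h i.+1; apply.
Qed.

Lemma series_close_trans i X Y Z :
  series_close i X Y -> series_close i Y Z -> series_close i X Z.
Proof.
by rewrite !series_closeP => h h' r c j ji; rewrite h ?h'.
Qed.

Lemma series_close_sym i X Y : series_close i X Y -> series_close i Y X.
Proof. by rewrite !series_closeP => h r c j ji; rewrite h. Qed.

Lemma series_closeW i X Y : series_close i.+1 X Y -> series_close i X Y.
Proof. by rewrite !series_closeP => h r c j ji; rewrite h // ltnW. Qed.

(** The eta-adic Banach fixed point theorem: the iterates of 0 stabilise coefficientwise, and the
    limit takes its i-th coefficient from the iterate of index [i.+1]. *)
Lemma contraction_fixpoint (Phi : 'M[E]_n -> 'M[E]_n) :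
  (forall i X Y, series_close i X Y -> series_close i.+1 (Phi X) (Phi Y)) ->
  (exists X, Phi X = X) /\ (forall X Y, Phi X = X -> Phi Y = Y -> X = Y).
Proof.
move=> PhiC; split; last first.
  move=> X Y fX fY; apply: series_close_eq; elim=> [|i IH].
    by apply/series_closeP => r c j.
  by rewrite -fX -fY; apply: PhiC.
pose x i := iter i Phi 0.
have xS i : series_close i (x i) (x i.+1).
  by elim: i => [|i IH]; [apply/series_closeP | apply: PhiC].
have xD i j : (i <= j)%N -> series_close i (x i) (x j).
  elim: j => [|j IH]; first by rewrite leqn0 => /eqP->; apply/series_closeP.
  rewrite leq_eqVlt => /orP[/eqP<-|ij]; first by apply/series_closeP.
  apply: series_close_trans (IH ij) _.
  have /series_closeP h := xS j; apply/series_closeP => r c l li; apply: h.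
  exact: leq_trans li ij.
pose X := \matrix_(r, c) Series (fun i => scoef (x i.+1 r c) i) : 'M[E]_n.
have xX i : series_close i (x i) X.
  apply/series_closeP => r c j ji; rewrite mxE /=.
  have /series_closeP h := xD j.+1 i ji; rewrite h //.
exists X; apply: series_close_eq => i; apply: series_closeW.
apply: series_close_trans (xX i.+1).
by apply/PhiC/series_close_sym/xX.
Qed.

End Contraction.

Lemma series_unit_residue (k : fieldType) (a : series k) :
  sresidue a != 0 -> exists b, a * b = 1.
Proof.
move=> a0; pose c := sconst (sresidue a)^-1.
have ca : sresidue (1 - c * a) = 0.
  by rewrite rmorphB rmorph1 rmorphM /= /c sconstK mulVf ?subrr.
(* The geometric series for the inverse, as the fixed point of X = c + (1 - c a) X. *)
have [|[X XE] _] := @contraction_fixpoint k 1 (fun X => c%:M + (1 - c * a) *: X).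
  move=> i X Y [Z ->]; exists (sshift (1 - c * a) *: Z).
  have -> : 1 - c * a = svar * sshift (1 - c * a).
    by rewrite sshiftK ca (rmorph0 (@sconst k)) subr0.
  rewrite svarK scalerDr !scalerA addrA; congr (_ + _ *: _).
  by rewrite exprS; ring.
exists (X 0 0); have := congr1 (fun X : 'M_1 => X 0 0) XE; rewrite !mxE eqxx mulr1n.
move: (X 0 0) => x xE; have cE : c = c * (a * x).
  move/eqP: xE; rewrite -subr_eq0 => /eqP xE.
  by apply/eqP; rewrite -subr_eq0 -xE; apply/eqP; ring.
have cc : sconst (sresidue a) * c = 1 by rewrite /c -rmorphM divff ?rmorph1.
by rewrite -[LHS]mul1r -cc -mulrA -cE.
Qed.

(** The derivative at x, in the direction H, of X -> X^2 + b1 X b2. *)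
Definition quadratic_diff (R : pzRingType) n (x b1 b2 H : 'M[R]_n) :=
  x *m H + H *m x + b1 *m H *m b2.

Section Hensel.

Variables (k : fieldType) (n : nat).
Local Notation E := (series k).

(** [T] has constant coefficients: its matrix of size n^2 is invertible over k, and the inverse
    matrix still works over the series. *)
Lemma sylvester_inverse (x b1 b2 : 'M[k]_n) :
  (forall H, quadratic_diff x b1 b2 H = 0 -> H = 0) ->
  let T := quadratic_diff (map_mx sconst x) (map_mx sconst b1) (map_mx sconst b2) in
  exists M : 'M[E]_n -> 'M[E]_n,
    [/\ forall a Y Z, M (a *: Y + Z) = a *: M Y + M Z,
        forall Y, T (M Y) = Y & forall Y, M (T Y) = Y].
Proof.
move=> inj T; pose A (R : comNzRingType) (x b1 b2 : 'M[R]_n) : 'M[R]_(n * n) :=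
  lin_mx (mulmx x) + lin_mx (mulmxr x) + lin_mx (mulmx b1) *m lin_mx (mulmxr b2).
have AE (R : comNzRingType) (x' b1' b2' H : 'M[R]_n) : mxvec H *m A R x' b1' b2' =
    mxvec (quadratic_diff x' b1' b2' H).
  by rewrite /quadratic_diff /A !mulmxDr mulmxA !mul_vec_lin /= !raddfD.
have Au : A k x b1 b2 \in unitmx.
  rewrite -row_free_unit -kermx_eq0; apply/rowV0P => v /sub_kermxP vA.
  have := AE k x b1 b2 (vec_mx v); rewrite vec_mxK vA => /esym/eqP.
  by rewrite mxvec_eq0 => /eqP/inj vH; rewrite -[v]vec_mxK vH linear0.
have mapA : map_mx sconst (A k x b1 b2) =
    A E (map_mx sconst x) (map_mx sconst b1) (map_mx sconst b2).
  have lin_map (f : {linear 'M[k]_n -> 'M[k]_n}) (g : {linear 'M[E]_n -> 'M[E]_n}) :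
      (forall H, map_mx sconst (f H) = g (map_mx sconst H)) ->
      map_mx sconst (lin_mx f) = lin_mx g.
    move=> fg; apply/row_matrixP => i; rewrite -map_row !rowE !mul_rV_lin map_mxvec fg.
    by rewrite map_vec_mx map_delta_mx.
  have el (y : 'M[k]_n) : map_mx sconst (lin_mx (mulmx y)) =
      lin_mx (mulmx (map_mx sconst y)) :> 'M[E]_(n * n).
    by apply: lin_map => H; rewrite map_mxM.
  have er (y : 'M[k]_n) : map_mx sconst (lin_mx (mulmxr y)) =
      lin_mx (mulmxr (map_mx sconst y)) :> 'M[E]_(n * n).
    by apply: lin_map => H /=; rewrite map_mxM.
  by rewrite /A !map_mxD map_mxM !el !er.
pose Mi := map_mx sconst (invmx (A k x b1 b2)).
have TE Y : mxvec (T Y) = mxvec Y *m map_mx sconst (A k x b1 b2) by rewrite mapA AE.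
exists (fun Y => vec_mx (mxvec Y *m Mi)); split=> [a Y Z|Y|Y].
- by rewrite linearP mulmxDl -scalemxAl linearP.
- apply: (can_inj mxvecK); rewrite TE vec_mxK -mulmxA -map_mxM mulVmx //.
  by rewrite map_mx1 mulmx1.
- apply: (can_inj mxvecK); rewrite vec_mxK TE -mulmxA -map_mxM mulmxV //.
by rewrite map_mx1 mulmx1.
Qed.

Variables B1 B2 C : 'M[E]_n.
Local Notation b1 := (map_mx sresidue B1).
Local Notation b2 := (map_mx sresidue B2).
Let F X := X *m X + B1 *m X *m B2 + C.

Lemma svar_scaleI (X Y : 'M[E]_n) : svar *: X = svar *: Y -> X = Y.
Proof.
move=> XY; apply/matrixP => r c; apply: (mulfI (svar_neq0 k)).
by have := congr1 (fun Z : 'M_n => Z r c) XY; rewrite !mxE.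
Qed.

Lemma map_sresidue_eq0 (X : 'M[E]_n) :
  map_mx sresidue X = 0 -> svar *: map_mx sshift X = X.
Proof.
move=> X0; apply/matrixP => r c; rewrite !mxE sshiftK.
have := congr1 (fun Y : 'M_n => Y r c) X0; rewrite !mxE => ->.
by rewrite (rmorph0 (@sconst k)) subr0.
Qed.

Lemma map_sresidue_const (X : 'M[E]_n) :
  X = map_mx sconst (map_mx sresidue X) + svar *: map_mx sshift X.
Proof. by apply/matrixP => r c; rewrite !mxE sshiftK addrC subrK. Qed.

Lemma quadratic_sub X Y : F X - F Y = X *m (X - Y) + (X - Y) *m Y + B1 *m (X - Y) *m B2.
Proof.
rewrite /F !mulmxBl !mulmxBr mulmxBl opprD addrACA subrr addr0 opprD addrACA.
by congr (_ + _); rewrite addrA subrK.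
Qed.

(** Newton iteration with the derivative frozen at x. For X = x + eta W the equation is eta G(W) =
    0, and G(W) - G(W') is the constant operator [T] at W - W' up to a multiple of eta, so W - T^-1
    (G W) is a contraction. Existence and uniqueness come from its fixed point. *)
Lemma hensel_quadratic (x : 'M[k]_n) :
  x *m x + b1 *m x *m b2 + map_mx sresidue C = 0 ->
  (forall H, quadratic_diff x b1 b2 H = 0 -> H = 0) ->
  (exists2 X, F X = 0 & map_mx sresidue X = x) /\
  (forall X Y, F X = 0 -> F Y = 0 ->
     map_mx sresidue X = x -> map_mx sresidue Y = x -> X = Y).
Proof.
move=> Fx inj; have [M [linM TM MT]] := sylvester_inverse inj.
have MD Y Z : M (Y + Z) = M Y + M Z by have := linM 1 Y Z; rewrite !scale1r.
have M0 : M 0 = 0 by apply: (addIr (M 0)); rewrite -MD !add0r.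
have MZ a Y : M (a *: Y) = a *: M Y by have := linM a Y 0; rewrite M0 !addr0.
have MN Y : M (- Y) = - M Y by rewrite -scaleN1r MZ scaleN1r.
pose lift W := map_mx sconst x + svar *: W : 'M[E]_n.
have res_lift W : map_mx sresidue (lift W) = x.
  apply/matrixP => r c; rewrite !mxE rmorphD rmorphM /= sresidue_var sconstK.
  by rewrite mul0r addr0.
have liftP X : map_mx sresidue X = x -> X = lift (map_mx sshift X).
  by move=> rX; rewrite /lift -rX; apply: map_sresidue_const.
have resF W : map_mx sresidue (F (lift W)) = 0.
  by rewrite /F !map_mxD !map_mxM res_lift.
have [G FG] : exists G, forall W, F (lift W) = svar *: G W.
  by exists (fun W => map_mx sshift (F (lift W))) => W; rewrite map_sresidue_eq0.
have sub_lift W W' : lift W - lift W' = svar *: (W - W').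
  by rewrite /lift opprD addrACA subrr add0r scalerBr.
pose b1' := map_mx sshift B1; pose b2' := map_mx sshift B2.
have [|[W fW] fixU] := @contraction_fixpoint k n (fun W => W - M (G W)).
  move=> i W W' [Z WW']; have [D DWW] : exists D, D = W - W' by exists (W - W').
  have GD : G W - G W' = lift W *m D + D *m lift W' + B1 *m D *m B2.
    apply: svar_scaleI; rewrite scalerBr -(FG W) -(FG W') quadratic_sub sub_lift.
    by rewrite -DWW -scalemxAr -scalemxAl -[B1 *m _]scalemxAr -scalemxAl -!scalerDr.
  have DE : D = svar ^+ i *: Z by rewrite DWW WW' addrC addKr.
  (* The part of the difference in which x, [B1] or [B2] contributes beyond its constant term,
     divided by eta. *)
  pose R V := W *m V + V *m W' + b1' *m V *m B2 + map_mx sconst b1 *m V *m b2'.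
  have GDE : G W - G W' = quadratic_diff (map_mx sconst x) (map_mx sconst b1)
      (map_mx sconst b2) D + svar *: R D.
    have BD : B1 *m D *m B2 = map_mx sconst b1 *m D *m map_mx sconst b2 +
        svar *: (b1' *m D *m B2 + map_mx sconst b1 *m D *m b2').
      have -> : B1 *m D *m B2 = (map_mx sconst b1 + svar *: b1') *m D *m B2.
        by rewrite -map_sresidue_const.
      have e : map_mx sconst b1 *m D *m B2 =
          map_mx sconst b1 *m D *m (map_mx sconst b2 + svar *: b2').
        by rewrite -map_sresidue_const.
      rewrite 2!mulmxDl {}e mulmxDr -scalemxAr -!scalemxAl scalerDr.
      by rewrite -addrA [_ + svar *: (b1' *m _ *m _)]addrC.
    rewrite GD BD /lift mulmxDl mulmxDr -scalemxAl -scalemxAr.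
    have sort_terms (a b c d e f : 'M[E]_n) :
        a + svar *: b + (c + svar *: d) + (e + svar *: f) =
        a + c + e + svar *: (b + d + f).
      by rewrite !scalerDr (addrACA a) (addrACA (a + c)).
    by rewrite sort_terms /R addrA.
  have RD : R D = svar ^+ i *: R Z.
    by rewrite DE /R -!(scalemxAl, scalemxAr) -!scalerDr.
  have MG : M (G W) - M (G W') = D + svar *: M (R D).
    by rewrite -MN -MD GDE MD MT MZ.
  exists (- M (R Z)); rewrite scalerN exprS -scalerA -MZ -RD.
  have -> : svar *: M (R D) = (M (G W) - M (G W')) - (W - W').
    by rewrite MG DWW [RHS]addrAC subrr add0r.
  rewrite opprB addrACA [W' + _]addrC subrK opprB.
  by rewrite addKr.
have GW0 V : V - M (G V) = V -> F (lift V) = 0.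
  move/eqP; rewrite -subr_eq0 addrAC subrr add0r oppr_eq0 => /eqP MG.
  rewrite FG -(TM (G V)) MG /quadratic_diff !(mulmx0, mul0mx) !addr0; exact: scaler0.
split; first by exists (lift W); [apply: GW0 | apply: res_lift].
move=> X Y FX FY rX rY; rewrite (liftP _ rX) (liftP _ rY); congr (lift _).
have fixG Z : F Z = 0 -> map_mx sresidue Z = x ->
    map_mx sshift Z - M (G (map_mx sshift Z)) = map_mx sshift Z.
  move=> FZ rZ; suff -> : G (map_mx sshift Z) = 0 by rewrite M0 subr0.
  by apply: svar_scaleI; rewrite -FG -liftP // FZ scaler0.
by apply: fixU; apply: fixG.
Qed.

End Hensel.

(** * Generic matrices *)

Section MatrixTuples.

Variables (I : finType) (n : nat).
Local Notation idx := (I * 'I_n * 'I_n)%type.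
Local Notation m := #|{: idx}|.

(** Flattens a family of matrices into a tuple indexed by an ordinal, the form that [mmap] and
    [conj_over] take; for ['I_3] this is the numbering of the generic entries. *)
Definition mxenv (R : Type) (A : I -> 'M[R]_n) (v : 'I_m) : R :=
  let: (a, i, j) := enum_val v in A a i j.

Definition mxvars (R : nzRingType) (a : I) : 'M[{mpoly R[m]}]_n :=
  \matrix_(i, j) 'X_(enum_rank (a, i, j)).

Lemma mxenvE (R : Type) (A : I -> 'M[R]_n) a i j : mxenv A (enum_rank (a, i, j)) = A a i j.
Proof. by rewrite /mxenv enum_rankK. Qed.

Lemma mmap_mxvars (R S : nzRingType) (f : {rmorphism R -> S}) (A : I -> 'M[S]_n) a :
  map_mx (mmap f (mxenv A)) (mxvars R a) = A a.
Proof. by apply/matrixP => i j; rewrite !mxE mmapXi mxenvE. Qed.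

Lemma mmap_mx_const (R S : comNzRingType) (f : {rmorphism R -> S}) (A : I -> 'M[S]_n)
    (B : 'M[R]_n) : map_mx (mmap f (mxenv A)) (map_mx (mpolyC m (R:=R)) B) = map_mx f B.
Proof. by apply/matrixP => i j; rewrite !mxE mmapC. Qed.

Lemma mxenv_surj (R : Type) (x : 'I_m -> R) :
  exists A : I -> 'M[R]_n, x =1 mxenv A.
Proof.
exists (fun a => \matrix_(i, j) x (enum_rank (a, i, j))) => v.
by rewrite /mxenv -{1}(enum_valK v); case: (enum_val v) => -[a i] j; rewrite mxE.
Qed.

Lemma conj_over_mx (K E E' : fieldType) (f : {rmorphism K -> E})
    (f' : {rmorphism K -> E'}) (A : I -> 'M[E]_n) (A' : I -> 'M[E']_n) p q
    (P : 'M[{mpoly K[m]}]_(p, q)) :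
  conj_over f f' (mxenv A) (mxenv A') ->
  map_mx (mmap f (mxenv A)) P = 0 <-> map_mx (mmap f' (mxenv A')) P = 0.
Proof.
move=> AA'; split=> /matrixP P0; apply/matrixP => i j; apply/eqP;
  have /eqP := P0 i j; rewrite !mxE; by rewrite AA'.
Qed.

End MatrixTuples.

Lemma conj_over_mxenv_reindex (K E E' : fieldType) (f : {rmorphism K -> E})
    (f' : {rmorphism K -> E'}) (I I' : finType) n (A : I -> 'M[E]_n) (A' : I -> 'M[E']_n)
    (s : I' -> I) :
  conj_over f f' (mxenv A) (mxenv A') ->
  conj_over f f' (mxenv (fun a => A (s a))) (mxenv (fun a => A' (s a))).
Proof.
pose t (v : 'I_#|{: I' * 'I_n * 'I_n}|) : 'I_#|{: I * 'I_n * 'I_n}| :=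
  let: (a, i, j) := enum_val v in enum_rank (s a, i, j).
move/(conj_over_reindex t); apply: eq_conj_over => v; rewrite /t /mxenv;
  by case: (enum_val v) => -[a i] j; rewrite enum_rankK.
Qed.

Lemma rat_morph_unique (R : idomainType) (f g : {rmorphism rat -> R}) : f =1 g.
Proof.
move=> x; have d0 : f (denq x)%:~R != 0.
  apply/eqP => fd0.
  have : f ((denq x)%:~R * (denq x)%:~R^-1) = 0 by rewrite rmorphM fd0 mul0r.
  by rewrite divff ?intr_eq0 ?denq_neq0 // rmorph1 => /eqP; rewrite oner_eq0.
apply: (mulIf d0); rewrite [in RHS]rmorph_int -(rmorph_int g) -!rmorphM.
by rewrite -{1 3}(divq_num_den x) divfK ?intr_eq0 ?denq_neq0 // !rmorph_int.
Qed.

Section GenericMorphisms.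

Variable n : nat.
Local Notation K := (genericK n).
Local Notation gen := (generic_mx n).

Definition rat_base (F : nzRingType) (f : {rmorphism K -> F}) : {rmorphism rat -> F} :=
  f \o (@tofrac {mpoly rat[nvars n]} \o mpolyC (nvars n) (R:=rat)).

Lemma generic_mmap (F : fieldType) (f : {rmorphism K -> F}) (r : {rmorphism rat -> F}) P :
  f (tofrac P) = mmap r (mxenv (fun k => map_mx f (gen k))) P.
Proof.
rewrite {1}(_ : P = mmap (mpolyC _ (R:=rat)) (fun i => 'X_i) P).
  apply: etrans (rmorph_mmap (mpolyC _ (R:=rat)) (f \o @tofrac {mpoly rat[nvars n]}) _ _) _.
  apply: eq_mmap => [c|v]; first exact: (rat_morph_unique (rat_base f) r).
  rewrite /mxenv /= -{1}(enum_valK v); case: (enum_val v) => -[k i] j.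
  by rewrite !mxE.
rewrite [LHS]mpolyE; apply: eq_bigr => m _; rewrite mul_mpolyC; congr (_ *: _).
by rewrite [LHS]mpolyXE_id.
Qed.

Lemma generic_independent (F : fieldType) (f : {rmorphism K -> F}) (r : {rmorphism rat -> F}) :
  ~ alg_dependent r (mxenv (fun k => map_mx f (gen k))).
Proof.
by case=> P P0 /eqP; rewrite -generic_mmap fmorph_eq0 tofrac_eq0 (negPf P0).
Qed.

(** Independence makes evaluation injective on the polynomial ring, so that it extends to the
    fraction field. *)
Lemma generic_morph (F : fieldType) (r : {rmorphism rat -> F}) (A : 'I_3 -> 'M[F]_n) :
  ~ alg_dependent r (mxenv A) ->
  exists f : {rmorphism K -> F}, forall k, map_mx f (gen k) = A k.
Proof.
move=> indA; pose h : {rmorphism {mpoly rat[nvars n]} -> F} := mmap r (mxenv A).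
have [|f fE] := @frac_lift _ _ h.
  move=> P Q PQ; apply/eqP; rewrite -subr_eq0; apply: contraT => PQ0; case: indA.
  by exists (P - Q) => //; rewrite -[LHS]/(h (P - Q)) rmorphB PQ subrr.
exists f => k; apply/matrixP => i j; rewrite !mxE fE.
by rewrite -[LHS]/(mmap r (mxenv A) _) mmapXi mxenvE.
Qed.

Lemma generic_morph_eq (F : fieldType) (f g : {rmorphism K -> F}) :
  (forall k, map_mx f (gen k) = map_mx g (gen k)) -> f =1 g.
Proof.
move=> fg z; have [p [d [d0 zd]]] := frac_numden z.
have e P : f (tofrac P) = g (tofrac P).
  rewrite !(generic_mmap _ (rat_base f)); apply: eq_mmap => // v.
  by rewrite /mxenv; case: (enum_val v) => -[k i] j; rewrite fg.
have fd0 : f (tofrac d) != 0 by rewrite fmorph_eq0 tofrac_eq0.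
have := congr1 g zd; have := congr1 f zd; rewrite !rmorphM /= -!e => <- zd'.
by apply: (mulIf fd0).
Qed.

Lemma generic_char0 : has_pchar0 K.
Proof.
move=> p; apply/negbTE/negP => /andP[pp /eqP p0].
have := congr1 id p0; rewrite -(rmorph_nat (rat_base idfun)) => /eqP.
by rewrite fmorph_eq0 Num.Theory.pnatr_eq0 => /eqP p00; rewrite p00 in pp.
Qed.

Definition triple (T : Type) (x y z : T) (k : 'I_3) : T := nth x [:: x; y; z] k.

Lemma triple_map (S T : Type) (f : S -> T) x y z k :
  f (triple x y z k) = triple (f x) (f y) (f z) k.
Proof. by case: k => -[|[|[|k]]]. Qed.

Lemma generic_triple (S : Type) (f : K -> S) k :
  map_mx f (gen k) = triple (map_mx f (gen (inord 0))) (map_mx f (gen (inord 1)))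
    (map_mx f (gen (inord 2))) k.
Proof.
case: k => -[|[|[|k]]] //= h; rewrite /triple /=; congr (map_mx f (gen _));
  by apply: val_inj; rewrite /= inordK.
Qed.

Definition sol_over (F : fieldType) (f : {rmorphism K -> F}) (X : 'M[F]_n) : Prop :=
  X *m X + map_mx f (gen (inord 0)) *m X *m map_mx f (gen (inord 1))
    + map_mx f (gen (inord 2)) = 0.

Local Notation V k := (mxvars n rat (k : 'I_3)).

(** The generic entries as polynomials in B1, B2 and X: the variables of index 2 stand for X, and C
    is solved for in the equation. *)
Definition coef_polys (v : 'I_(nvars n)) : {mpoly rat[nvars n]} :=
  mxenv (triple (V (inord 0)) (V (inord 1))
    (- (V (inord 2) *m V (inord 2) + V (inord 0) *m V (inord 2) *m V (inord 1)))) v.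

Lemma mxenv_map (I : finType) (R S : Type) (f : R -> S) (A : I -> 'M[R]_n) v :
  f (mxenv A v) = mxenv (fun a => map_mx f (A a)) v.
Proof. by rewrite /mxenv; case: (enum_val v) => -[a i] j; rewrite mxE. Qed.

Lemma eq_mxenv (I : finType) (R : Type) (A A' : I -> 'M[R]_n) :
  A =1 A' -> mxenv A =1 mxenv A'.
Proof. by move=> AA' v; rewrite /mxenv; case: (enum_val v) => -[a i] j; rewrite AA'. Qed.

Lemma coef_polysE (F : fieldType) (f : {rmorphism K -> F}) (r : {rmorphism rat -> F}) X :
  sol_over f X -> forall v, mmap r (mxenv (triple (map_mx f (gen (inord 0)))
      (map_mx f (gen (inord 1))) X)) (coef_polys v) = mxenv (fun k => map_mx f (gen k)) v.
Proof.
move=> solX v; rewrite /coef_polys (mxenv_map (mmap _ _)); apply: eq_mxenv => k.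
rewrite (generic_triple f k) (triple_map (map_mx (mmap r _))) map_mxN map_mxD !map_mxM.
rewrite !mmap_mxvars /triple !inordK //=.
suff -> : map_mx f (gen (inord 2)) =
  - (X *m X + map_mx f (gen (inord 0)) *m X *m map_mx f (gen (inord 1))) by [].
by apply/eqP; rewrite -addr_eq0 addrC; apply/eqP.
Qed.

Lemma solution_independent (F : fieldType) (f : {rmorphism K -> F})
    (r : {rmorphism rat -> F}) X : sol_over f X ->
  ~ alg_dependent r (mxenv (triple (map_mx f (gen (inord 0))) (map_mx f (gen (inord 1))) X)).
Proof.
move=> solX dep; apply: (@generic_independent F f r).
apply: (alg_dependent_rational (G := 1) (f := coef_polys) _ _ dep).
  by rewrite rmorph1 oner_neq0.
by move=> v; rewrite rmorph1 mul1r coef_polysE.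
Qed.

Lemma lift_max_split N (T : Type) (h : 'I_N -> T) (t : T) :
  exists g : 'I_N.+1 -> T, (forall i, g (lift ord_max i) = h i) /\ g ord_max = t.
Proof.
exists (fun i => if unlift ord_max i is Some i' then h i' else t).
by rewrite unlift_none; split=> // i; rewrite liftK.
Qed.

(* The 3n^2 + 1 polynomials B1, B2, C = -(X^2 + B1 X B2), X_ij in the 3n^2
   entries of B1, B2, X are algebraically dependent. *)
Lemma solution_entry_annihilator (i j : 'I_n) :
  exists2 P : {poly K}, P != 0 &
    forall (F : fieldType) (f : {rmorphism K -> F}) X,
      sol_over f X -> root (map_poly f P) (X i j).
Proof.
set N := nvars n; pose A : idomainType := {mpoly rat[N]}.
(* [alg_dependent_rational] compares tuples of equal length, so the N variables are padded with 0,
   which makes [y] dependent through its last component. The tuple [x] consists of the coefficients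
   followed by X_ij. *)
have [y [yl ym]] := lift_max_split (fun v : 'I_N => 'X_v : A) 0.
have [x [xl xm]] := lift_max_split coef_polys (V (inord 2) i j : A).
have [w [wl wm]] := lift_max_split (fun v : 'I_N => ('X_v : A)%:P) 'X.
pose incl : {rmorphism A -> {mpoly rat[N.+1]}} :=
  mmap (mpolyC N.+1 (R:=rat)) (fun v => 'X_(lift ord_max v)).
have mmap_id k (P : {mpoly rat[k]}) : mmap (mpolyC k (R:=rat)) (fun v => 'X_v) P = P.
  rewrite [RHS]mpolyE; apply: eq_bigr => m _; rewrite mul_mpolyC; congr (_ *: _).
  by rewrite [RHS]mpolyXE_id.
have yincl P : mmap (mpolyC N (R:=rat)) y (incl P) = P.
  rewrite (rmorph_mmap (mpolyC N.+1 (R:=rat)) (mmap (mpolyC N (R:=rat)) y)).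
  rewrite -[RHS]mmap_id; apply: eq_mmap => [c|v] /=; first by rewrite mmapC.
  by rewrite mmapXi yl.
have [Q Q0 Qx] : alg_dependent (mpolyC N (R:=rat)) x.
  apply: (alg_dependent_rational (y := y) (G := 1) (f := fun v => incl (x v))).
  - by rewrite rmorph1 oner_neq0.
  - by move=> v; rewrite rmorph1 mul1r yincl.
  - exists 'X_ord_max; last by rewrite mmapXi ym.
    by rewrite -msupp_eq0 msuppX.
(* [Q] is read as a polynomial in its last variable over the ring in the other ones; the left
   inverse [back] shows that it stays nonzero. *)
pose h : {rmorphism {mpoly rat[N.+1]} -> {poly A}} := mmap (polyC \o mpolyC N (R:=rat)) w.
pose back : {rmorphism {poly A} -> {mpoly rat[N.+1]}} :=
  horner_eval ('X_ord_max : {mpoly rat[N.+1]}) \o map_poly incl.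
have hK P : back (h P) = P.
  rewrite /h (rmorph_mmap (polyC \o mpolyC N (R:=rat)) back) -[RHS]mmap_id.
  apply: eq_mmap => [c|v] /=; rewrite /horner_eval.
    by rewrite map_polyC hornerC /= mmapC.
  have [v' ->|->] := unliftP ord_max v.
    by rewrite wl map_polyC hornerC /= mmapXi.
  by rewrite wm map_polyX hornerX.
have hQ : h Q != 0 by apply: contraNneq Q0 => hQ; rewrite -(hK Q) hQ rmorph0.
exists (map_poly (@tofrac A) (h Q)).
  rewrite -(rmorph0 (map_poly (@tofrac A))) (inj_eq (map_inj_poly _ _)) //.
  by move=> p q /eqP; rewrite tofrac_eq => /eqP.
move=> F f X solX; rewrite rootE -map_poly_comp; apply/eqP.
pose ev : {rmorphism {poly A} -> F} := horner_eval (X i j) \o map_poly (f \o @tofrac A).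
rewrite -[LHS]/(ev (h Q)) /h (rmorph_mmap (polyC \o mpolyC N (R:=rat)) ev).
pose r := rat_base f.
pose evX : {rmorphism A -> F} := mmap r (mxenv (triple (map_mx f (gen (inord 0)))
  (map_mx f (gen (inord 1))) X)).
rewrite -[RHS](rmorph0 evX) -Qx (rmorph_mmap (mpolyC N (R:=rat)) evX).
apply: eq_mmap => [c|v] /=; first by rewrite /horner_eval map_polyC hornerC mmapC.
have [v' ->|->] := unliftP ord_max v.
  rewrite wl xl (coef_polysE _ solX) /horner_eval map_polyC hornerC /=.
  by rewrite (generic_mmap f r) mmapXi.
rewrite wm xm /horner_eval map_polyX hornerX.
have := congr1 (fun Y : 'M_n => Y i j) (mmap_mxvars r (triple (map_mx f (gen (inord 0)))
  (map_mx f (gen (inord 1))) X) (inord 2)).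
by rewrite mxE => ->; rewrite /triple inordK.
Qed.

Lemma solution_algebraic (F : fieldType) (f : {rmorphism K -> F}) X i j :
  sol_over f X -> algebraicOver f (X i j).
Proof. by have [P P0 h] := solution_entry_annihilator i j; exists P => //; apply: h. Qed.

Lemma finitely_many_generic (Kbar : closedFieldType) (iota : {rmorphism K -> Kbar}) :
  finitely_many_solutions (sol_over iota).
Proof.
have /choice[P PP] (ij : 'I_n * 'I_n) : exists P : {poly K}, P != 0 /\
    forall X : 'M[Kbar]_n, sol_over iota X -> root (map_poly iota P) (X ij.1 ij.2).
  by have [P P0 h] := solution_entry_annihilator ij.1 ij.2; exists P; split=> // X /h.
pose Q := \prod_ij map_poly iota (P ij).
have Q0 : Q != 0.
  by apply/prodf_neq0 => ij _; rewrite map_poly_eq0; case: (PP ij).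
have [s sE] := closed_field_poly_normal Q.
pose S := [seq X <- [seq (\matrix_(i, j) s`_(h (i, j)) : 'M[Kbar]_n) |
  h : {ffun 'I_n * 'I_n -> 'I_(size s)}] | `[< sol_over iota X >]].
exists (size (undup S)), (undup S); split=> // [|X]; first exact: undup_uniq.
rewrite mem_undup mem_filter; split=> [solX|/andP[/asboolP]//].
apply/andP; split; first exact/asboolP.
have /choice[h hE] (ij : 'I_n * 'I_n) : exists k : 'I_(size s), s`_k = X ij.1 ij.2.
  have : X ij.1 ij.2 \in s.
    rewrite -root_prod_XsubC -(rootZ _ _ (_ : lead_coef Q != 0)) ?lead_coef_eq0 // -sE.
    rewrite rootE horner_prod prodf_seq_eq0 /=.
    by apply/hasP; exists ij; rewrite ?mem_index_enum // -rootE; case: (PP ij) => _; apply.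
  by case/(nthP 0) => k ks <-; exists (Ordinal ks).
apply/imageP; exists [ffun ij => h ij] => //.
by apply/matrixP => i j; rewrite mxE ffunE hE.
Qed.

End GenericMorphisms.

(** * Actions of alternating groups *)

(** In this range the group is simple and not solvable, so its commutator subgroup cannot be
    trivial. *)
Lemma Alt_derived (T : finType) k : (4 < #|T|)%N -> ((Alt T)^`(k) = Alt T)%g.
Proof.
move=> T5; elim: k => [|k IH] //; rewrite dergSn IH.
have /simpleP[_ simA] := simple_Alt5 T5.
case: (simA [group of [~: Alt T, Alt T]%g]) => [|e|//]; first exact: (der_normal 1).
have : solvable (Alt T) by apply: abelian_sol; rewrite /abelian; apply/commG1P.
by rewrite solvable_AltF.
Qed.

Lemma map_mx_quadratic (R S : comNzRingType) (g : {rmorphism R -> S}) n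
    (X B1 B2 C : 'M[R]_n) :
  map_mx g (X *m X + B1 *m X *m B2 + C) = map_mx g X *m map_mx g X
    + map_mx g B1 *m map_mx g X *m map_mx g B2 + map_mx g C.
Proof. by rewrite !map_mxD !map_mxM. Qed.

Section NonSolvable.

Variables (n : nat).
Local Notation K := (genericK n).
Variables (Kbar : closedFieldType) (iota : {rmorphism K -> Kbar}).
Hypothesis alg : algebraic_closure iota.

(** The equation is a matrix of polynomials over K in the entries, and [conj_over] preserves their
    vanishing in both directions. *)
Lemma sol_over_conj (I : finType) (F F' : fieldType) (f : {rmorphism K -> F})
    (f' : {rmorphism K -> F'}) (T : I -> 'M[F]_n) (T' : I -> 'M[F']_n) a :
  conj_over f f' (mxenv T) (mxenv T') -> sol_over f (T a) <-> sol_over f' (T' a).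
Proof.
move=> TT'; pose c k := map_mx (mpolyC #|{: I * 'I_n * 'I_n}| (R:=K)) (generic_mx n k).
pose P := mxvars n K a *m mxvars n K a + c (inord 0) *m mxvars n K a *m c (inord 1)
  + c (inord 2).
have e (D : fieldType) (h : {rmorphism K -> D}) (S : I -> 'M[D]_n) :
    sol_over h (S a) <-> map_mx (mmap h (mxenv S)) P = 0.
  by rewrite /P map_mx_quadratic (mmap_mxvars h S a) /c !(mmap_mx_const h S).
by rewrite !e; apply: conj_over_mx.
Qed.

Lemma eq_conj_mx (I : finType) (F F' : fieldType) (f : {rmorphism K -> F})
    (f' : {rmorphism K -> F'}) (T : I -> 'M[F]_n) (T' : I -> 'M[F']_n) a b :
  conj_over f f' (mxenv T) (mxenv T') -> T a = T b <-> T' a = T' b.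
Proof.
move=> TT'; have e (D : fieldType) (h : {rmorphism K -> D}) (S : I -> 'M[D]_n) :
    S a = S b <-> map_mx (mmap h (mxenv S)) (mxvars n K a - mxvars n K b) = 0.
  rewrite map_mxB (mmap_mxvars h S a) (mmap_mxvars h S b).
  split=> [->|/eqP]; first by rewrite subrr.
  by rewrite subr_eq0 => /eqP.
by rewrite !e; apply: conj_over_mx.
Qed.

Lemma solution_tuple_transfer (I : finType) (F : fieldType) (f : {rmorphism K -> F})
    (T : I -> 'M[F]_n) : (forall a, sol_over f (T a)) ->
  exists T' : I -> 'M[Kbar]_n, conj_over f iota (mxenv T) (mxenv T').
Proof.
move=> solT; have [|y Ty] := @conj_over_exists K (@generic_char0 n) _ F Kbar f iota (mxenv T).
  by move=> v; rewrite /mxenv; case: (enum_val v) => -[a i] j; apply: solution_algebraic.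
have [T' yT'] := mxenv_surj y; exists T'; exact: eq_conj_over (frefl _) yT' Ty.
Qed.

Lemma gal_mx_conj (L : splittingFieldType K) (j : {rmorphism L -> Kbar})
    (I : finType) (U U' : I -> 'M[L]_n) :
  (forall a, j a%:A = iota a) ->
  conj_over iota iota (mxenv (fun a => map_mx j (U a))) (mxenv (fun a => map_mx j (U' a))) ->
  exists2 g, g \in 'Gal({:L} / 1)%g & forall a, map_mx g (U a) = U' a.
Proof.
move=> jA UU'.
have jU (W : I -> 'M[L]_n) :
    conj_over (in_alg L) iota (mxenv W) (mxenv (fun a => map_mx j (W a))).
  apply: eq_conj_over (frefl _) _ (@conj_over_morph K _ L Kbar (in_alg L) iota j (mxenv W) jA).
  by move=> v; apply: mxenv_map.
have [g gG gE] := conj_over_gal (@generic_char0 n) (conj_over_trans (jU U)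
  (conj_over_trans UU' (conj_over_sym (jU U')))).
exists g => // a; apply/matrixP => i k; rewrite mxE.
by have := gE (enum_rank (a, i, k)); rewrite !mxenvE.
Qed.

(** Right multiplication by q turns [T] into a conjugate family. Hence each q is induced, on a copy
    of [T] in [Kbar], by a Galois automorphism, and iterated commutators of permutations are induced
    by iterated commutators of automorphisms. *)
Lemma nonsolvable_of_Alt_action d (F : fieldType) (f : {rmorphism K -> F})
    (s : 'S_d -> {rmorphism F -> F}) (T : 'S_d -> 'M[F]_n) :
  (4 < d)%N -> (forall p a, s p (f a) = f a) ->
  (forall p q, map_mx (s q) (T p) = T (p * q)%g) ->
  (forall p, sol_over f (T p)) ->
  (exists2 p, p \in Alt 'I_d & T p <> T 1%g) ->
  eq_nonsolvable iota (sol_over iota).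
Proof.
move=> d5 sf sT solT [p0 p0A p0T].
have [T' TT'] := solution_tuple_transfer solT.
have solT' p : sol_over iota (T' p) by apply/(sol_over_conj p TT').
have [nu numS] := finitely_many_generic iota.
have posS : finite_positive_solutions (sol_over iota).
  exists nu => //; case: numS => S [_ <- SP]; have /SP := solT' 1%g.
  by case: (S).
split=> // -[_ rad].
have T'conj q : conj_over iota iota (mxenv T') (mxenv (fun p => T' (p * q)%g)).
  apply: conj_over_trans (conj_over_sym TT') _.
  apply: conj_over_trans (conj_over_mxenv_reindex (fun p => (p * q)%g) TT').
  apply: eq_conj_over (frefl _) _ (conj_over_morph (mxenv T) (sf q)) => v.
  by rewrite (mxenv_map (s q)); apply: eq_mxenv => p; rewrite sT.
have /choice[tw twP] (ij : 'I_n * 'I_n) : exists r : seq Kbar, radical_tower iota r /\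
    adjoin iota (fun y => y \in r) (T' 1%g ij.1 ij.2).
  by have [r] := rad (T' 1%g) ij.1 ij.2 (solT' _); exists r.
(* One finite splitting field has to hold the entries of the whole family and the radicals of all
   the towers in use. *)
pose l := [seq mxenv T' v | v : 'I_#|{: 'S_d * 'I_n * 'I_n}|] ++
  flatten [seq tw ij | ij : 'I_n * 'I_n].
have [L [j [u [jA ju]]]] := finite_splitting (@generic_char0 n)
  (fun i : 'I_(size l) => l`_i) alg.
have inL x : x \in l -> exists v, j v = x.
  by case/(nthP 0) => i il <-; exists (u (Ordinal il)).
have /choice[w wE] (v : 'I_#|{: 'S_d * 'I_n * 'I_n}|) : exists z, j z = mxenv T' v.
  by apply: inL; rewrite mem_cat; apply/orP; left; apply/imageP; exists v.
have [U wU] := mxenv_surj w.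
have UE p : map_mx j (U p) = T' p.
  apply/matrixP => i k; rewrite mxE -[U p i k](mxenvE U) -wU wE.
  by rewrite mxenvE.
pose G := ('Gal({:L} / 1))%G.
have /choice[kk kkP] (ij : 'I_n * 'I_n) : exists k, forall g, g \in G^`(k)%g ->
    g (U 1%g ij.1 ij.2) = U 1%g ij.1 ij.2.
  have [tower adj] := twP ij.
  have [|k kP] := radical_derived_fix jA tower.
    move=> x xt; apply: inL; rewrite mem_cat; apply/orP; right.
    by apply/flattenP; exists (tw ij) => //; apply/imageP; exists ij.
  exists k; have [v jv vP] := kP _ adj => g gG.
  suff -> : U 1%g ij.1 ij.2 = v by apply: vP.
  apply: (fmorph_inj j); rewrite jv.
  by have := congr1 (fun M : 'M_n => M ij.1 ij.2) (UE 1%g); rewrite mxE.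
pose k := (\sum_ij kk ij)%N.
have der_mono i i' : (i <= i')%N -> G^`(i')%g \subset G^`(i)%g.
  elim: i' => [|i' IH]; first by rewrite leqn0 => /eqP->.
  rewrite leq_eqVlt => /orP[/eqP->//|/IH]; apply: subset_trans.
  exact: der_subS.
have fixU1 g : g \in G^`(k)%g -> map_mx g (U 1%g) = U 1%g.
  move=> gG; apply/matrixP => i i'; rewrite mxE; apply: (kkP (i, i')).
  by apply: (subsetP (der_mono _ _ _)) gG; rewrite /k (bigD1 (i, i')) //= leq_addr.
(* Only a relation: [T] need not be injective, so one automorphism may act as several permutations
   and no morphism to the symmetric group is available. This is why the lifting goes by induction on
   the derived series. *)
pose acts (g : gal_of {:L}) (q : 'S_d) := forall p, map_mx g (U p) = U (p * q)%g.
have lift_der i q : q \in (Sym 'I_d)^`(i)%g -> exists2 g, g \in G^`(i)%g & acts g q.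
  elim: i q => [|i IH] q qS.
    have [|g gG gU] := @gal_mx_conj L j _ U (fun p => U (p * q)%g) jA.
      by apply: eq_conj_over (T'conj q) => v; apply: eq_mxenv => p; rewrite UE.
    by exists g.
  pose S := [set q : 'S_d | `[< exists2 g, g \in G^`(i.+1)%g & acts g q >]].
  have actsM g h q1 q2 : acts g q1 -> acts h q2 -> acts (g * h)%g (q1 * q2)%g.
    move=> a1 a2 p; rewrite mulgA -a2 -a1 -map_mx_comp.
    by apply/matrixP => x y; rewrite !mxE /= galM ?memvf.
  have acts1 : acts 1%g 1%g.
    by move=> p; rewrite mulg1; apply/matrixP => x y; rewrite mxE gal_id.
  have actsV g q1 : acts g q1 -> acts g^-1%g q1^-1%g.
    move=> a1 p; rewrite -{1}[p](mulgKV q1) -a1 -map_mx_comp.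
    by apply/matrixP => x y; rewrite mxE /= -galM ?memvf // mulgV gal_id.
  have gS : group_set S.
    apply/group_setP; split; first by rewrite inE; apply/asboolP; exists 1%g.
    move=> q1 q2; rewrite !inE => /asboolP[g gG ag] /asboolP[h hG ah].
    by apply/asboolP; exists (g * h)%g; [rewrite groupM | apply: actsM].
  suff : (Sym 'I_d)^`(i.+1)%g \subset Group gS.
    by move/subsetP/(_ q qS); rewrite inE => /asboolP.
  rewrite dergSn gen_subG; apply/subsetP => _ /imset2P[q1 q2 /IH[g gG ag] /IH[h hG ah] ->].
  rewrite inE; apply/asboolP; exists [~ g, h]%g; first by rewrite dergSn mem_commg.
  rewrite !commgEl /conjg; apply: (actsM _ _ _ _ (actsV _ _ ag)).
  exact: (actsM _ _ _ _ (actsV _ _ ah) (actsM _ _ _ _ ag ah)).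
have p0S : p0 \in (Sym 'I_d)^`(k)%g.
  have subA : (Alt 'I_d)^`(k)%g \subset (Sym 'I_d)^`(k)%g by apply/dergS/subsetT.
  by apply: (subsetP subA); rewrite Alt_derived ?card_ord.
have [g gG gU] := lift_der _ _ p0S; apply: p0T.
apply/(eq_conj_mx _ _ TT'); rewrite -!UE.
by rewrite -[p0]mul1g -gU fixU1.
Qed.

End NonSolvable.

Lemma alg_dependent_morph N (F : fieldType) (A B : idomainType) (r : {rmorphism F -> A})
    (g : {rmorphism A -> B}) (y : 'I_N -> A) :
  alg_dependent r y -> alg_dependent (g \o r) (fun v => g (y v)).
Proof.
case=> P P0 Py; exists P => //.
by rewrite -(rmorph_mmap r g) Py rmorph0.
Qed.

Lemma alg_dependent_inj N (F : fieldType) (A B : idomainType) (r : {rmorphism F -> A})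
    (g : {rmorphism A -> B}) (y : 'I_N -> A) : injective g ->
  alg_dependent (g \o r) (fun v => g (y v)) -> alg_dependent r y.
Proof.
move=> ginj [P P0 Py]; exists P => //; apply: ginj.
by rewrite (rmorph_mmap r g) Py rmorph0.
Qed.

Lemma alg_dependent_ext N (F : fieldType) (A : idomainType) (r r' : {rmorphism F -> A})
    (y y' : 'I_N -> A) : r =1 r' -> y =1 y' -> alg_dependent r y -> alg_dependent r' y'.
Proof. by move=> rr yy [P P0 Py]; exists P => //; rewrite -(eq_mmap P rr yy). Qed.

Lemma tofrac_inj (R : idomainType) : injective (@tofrac R).
Proof. by move=> x y /eqP; rewrite tofrac_eq => /eqP. Qed.

(** * Deformations *)

Section Deformation.

Variables (n : nat) (Kbar : fieldType) (iota : {rmorphism genericK n -> Kbar}).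
Variables (A : idomainType) (k : fieldType) (inc : {rmorphism A -> k}).
Variables (c : {rmorphism Kbar -> A}) (e : {rmorphism A -> Kbar}).
Hypotheses (inc_inj : injective inc) (cK : cancel c e).
Local Notation gen := (generic_mx n).

(* The coefficient matrices with parameter t, equal to x at t = 0 up to the
   order d, and generic; at t = 1 (after e) they are rational translates of the
   generic ones, whence their algebraic independence. *)
Lemma deformation_morph (x : 'I_3 -> 'M[{poly A}]_n) (q : 'I_3 -> 'M[rat]_n) d :
  (forall l, map_mx (horner_eval 1 \o map_poly e) (x l) = map_mx (rat_base iota) (q l)) ->
  exists f : {rmorphism genericK n -> {fraction series k}},
    forall l, map_mx f (gen l) =
      map_mx (@tofrac (series k)) (map_mx (series_poly \o map_poly inc)
        (x l + 'X^d *: map_mx (polyC \o c \o iota) (gen l))).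
Proof.
move=> xq; pose y l := x l + 'X^d *: map_mx (polyC \o c \o iota) (gen l) : 'M[{poly A}]_n.
pose h : {rmorphism {poly A} -> {fraction series k}} :=
  @tofrac (series k) \o series_poly \o map_poly inc.
have hinj : injective h.
  move=> p1 p2 /tofrac_inj/series_poly_inj; apply: map_inj_poly => //; exact: rmorph0.
pose r : {rmorphism rat -> {poly A}} := polyC \o c \o rat_base iota.
have indy : ~ alg_dependent r (mxenv y).
  pose ev : {rmorphism {poly A} -> Kbar} := horner_eval 1 \o map_poly e.
  have rE : ev \o r =1 rat_base iota by apply: rat_morph_unique.
  move=> /(alg_dependent_morph ev)/(alg_dependent_ext rE (frefl _)) dep.
  apply: (@generic_independent n Kbar iota (rat_base iota)).
  apply: (alg_dependent_rational (G := 1) (f := fun v => 'X_v - (mxenv q v)%:MP) _ _ dep).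
    by rewrite rmorph1 oner_neq0.
  move=> v; rewrite rmorph1 mul1r mmapB mmapXi.
  rewrite (_ : mmap _ _ _%:MP = mxenv (fun l => map_mx (rat_base iota) (q l)) v); last first.
    by rewrite mmapC; apply: mxenv_map.
  rewrite (mxenv_map ev) /mxenv.
  case: (enum_val v) => -[l i] j; rewrite -xq !mxE /ev /= /horner_eval.
  rewrite rmorphD rmorphM /= map_polyXn map_polyC /= cK hornerD hornerM hornerXn.
  by rewrite hornerC expr1n mul1r addrC addKr.
have [|f fE] := @generic_morph n _ (h \o r) (fun l => map_mx h (y l)).
  move=> dep; apply: indy; apply: (alg_dependent_inj hinj).
  apply: alg_dependent_ext dep => // v; by rewrite (mxenv_map h).
by exists f => l; rewrite fE -map_mx_comp.
Qed.

End Deformation.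

Section SeriesMap.

Variables (k : fieldType) (t : {rmorphism k -> k}).

Definition smap (a : series k) : series k := Series (fun i => t (scoef a i)).
Fact smap_zmod : zmod_morphism smap.
Proof. by move=> a b; apply: seriesP => i /=; rewrite rmorphB. Qed.
Fact smap_monoid : monoid_morphism smap.
Proof.
split=> [|a b]; apply: seriesP => i /=; first by rewrite coef1 rmorph_nat.
by rewrite rmorph_sum; apply: eq_bigr => j _; rewrite rmorphM.
Qed.
HB.instance Definition _ := GRing.isZmodMorphism.Build _ _ smap smap_zmod.
HB.instance Definition _ := GRing.isMonoidMorphism.Build _ _ smap smap_monoid.

Lemma smap_inj : injective smap.
Proof.
move=> a b /(congr1 (@scoef k)) /= ab; apply: seriesP => i.
by apply: (fmorph_inj t); have := congr1 (fun u => u i) ab.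
Qed.

Lemma smap_poly p : smap (series_poly p) = series_poly (map_poly t p).
Proof. by apply: seriesP => i /=; rewrite coef_map. Qed.

Lemma sresidue_smap a : sresidue (smap a) = t (sresidue a).
Proof. by []. Qed.

End SeriesMap.

(** * Block companion equations and their solvents *)

Section BlockCompanion.

Variables (n : nat).

(* For every root a of d, the vector (1, a^2, a^4, ...) is sent to 0 by
   a^2 + a blockB + blockC; a solvent of X^2 + blockB X + blockC can have any n
   of the 2n roots of d as eigenvalues. *)
Definition blockB (R : nzRingType) (d : {poly R}) : 'M[R]_n :=
  \matrix_(i, j) if i.+1 == n then d`_(j.*2.+1) else 0.
Definition blockC (R : nzRingType) (d : {poly R}) : 'M[R]_n :=
  \matrix_(i, j) if i.+1 == n then d`_(j.*2) else - (j == i.+1 :> nat)%:R.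

Lemma map_blockB (R S : nzRingType) (f : {rmorphism R -> S}) d :
  map_mx f (blockB d) = blockB (map_poly f d).
Proof.
by apply/matrixP => i j; rewrite !mxE; case: ifP; rewrite ?coef_map ?rmorph0.
Qed.

Lemma map_blockC (R S : nzRingType) (f : {rmorphism R -> S}) d :
  map_mx f (blockC d) = blockC (map_poly f d).
Proof.
by apply/matrixP => i j; rewrite !mxE; case: ifP; rewrite ?coef_map ?rmorphN ?rmorph_nat.
Qed.

Definition even_powers (R : nzRingType) (a : R) : 'cV[R]_n := \col_i a ^+ i.*2.

(** The last row is d(a) = 0 with its terms sorted by the parity of the exponent; the other rows
    read a^2 a^(2i) = a^(2(i+1)). *)
Lemma block_companion_vec (R : comNzRingType) (d : {poly R}) a :
  d \is monic -> size d = (n + n).+1 -> root d a ->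
  a ^+ 2 *: even_powers a + a *: (blockB d *m even_powers a) + blockC d *m even_powers a = 0.
Proof.
move=> mond szd /rootP da; apply/matrixP => i j; rewrite !mxE.
have [in_|ni] := boolP (i.+1 == n).
  move: da; rewrite horner_coef szd big_ord_recr /=.
  rewrite (_ : d`_(n + n) = 1) ?mul1r; last first.
    by move/monicP: mond; rewrite lead_coefE szd.
  rewrite (_ : \sum_(l < n + n) _ = \sum_(l < n) (d`_(l.*2) * a ^+ l.*2 +
      d`_(l.*2.+1) * a ^+ l.*2.+1)); last first.
    have := @big_mkord _ 0 +%R (n + n) xpredT (fun l => d`_l * a ^+ l) => <-.
    have := @big_mkord _ 0 +%R n xpredT (fun l => d`_(l.*2) * a ^+ l.*2 +
      d`_(l.*2.+1) * a ^+ l.*2.+1) => <-.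
    elim: n => [|l IH]; first by rewrite !big_geq.
    by rewrite addSn addnS !big_nat_recr //= IH addnn addrA.
  move=> da; rewrite -[RHS]da big_split /= {da}.
  have -> : \sum_(l < n) blockC d i l * even_powers a l j = \sum_(l < n) d`_(l.*2) * a ^+ l.*2.
    by apply: eq_bigr => l _; rewrite !mxE in_.
  have -> : a * (\sum_(l < n) blockB d i l * even_powers a l j) =
      \sum_(l < n) d`_(l.*2.+1) * a ^+ l.*2.+1.
    by rewrite mulr_sumr; apply: eq_bigr => l _; rewrite !mxE in_ exprS mulrCA.
  by rewrite -exprD add2n -doubleS (eqP in_) addnn addrC [X in _ + X]addrC addrA.
have lt_in : (i.+1 < n)%N by rewrite ltn_neqAle ni ltn_ord.
rewrite [X in a * X]big1 ?mulr0 ?addr0; last first.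
  by move=> l _; rewrite !mxE (negPf ni) mul0r.
rewrite (bigD1 (Ordinal lt_in)) //= big1 ?addr0.
  by rewrite !mxE (negPf ni) /= eqxx mulN1r -exprD add2n -doubleS subrr.
move=> l; rewrite -val_eqE /= => nl; rewrite !mxE (negPf ni).
by rewrite (negPf nl) oppr0 mul0r.
Qed.

End BlockCompanion.

Section Solvent.

Variables (k : fieldType) (n' : nat).
Local Notation n := n'.+1.
Variable lam : 'I_(n + n) -> k.
Hypothesis lam2_inj : injective (fun i => lam i ^+ 2).

Let lam_inj : injective lam.
Proof. by move=> i j ij; apply: lam2_inj; rewrite ij. Qed.

Definition prod_roots : {poly k} := \prod_i ('X - (lam i)%:P).
Local Notation d := prod_roots.
Definition solvent_basis : 'M[k]_n := \matrix_(i, j) lam (lshift n j) ^+ i.*2.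
Local Notation V := solvent_basis.
Local Notation Lam := (diag_mx (\row_(j < n) lam (lshift n j))).
Definition solvent : 'M[k]_n := V *m Lam *m invmx V.
Local Notation X := solvent.
Local Notation v := (@even_powers n k).
Local Notation B := (blockB n d).
Local Notation C := (blockC n d).

Lemma size_prod_roots : size d = (n + n).+1.
Proof. by rewrite size_prod_XsubC /index_enum -enumT size_enum_ord. Qed.

Lemma monic_prod_roots : d \is monic.
Proof. by apply: monic_prod_XsubC. Qed.

Lemma root_prod_roots i : root d (lam i).
Proof. by rewrite rootE horner_prod (bigD1 i) //= hornerXsubC subrr mul0r. Qed.

(** A Vandermonde matrix in the squares of the eigenvalues, whence the assumption that the squares,
    and not only the [lam i], are distinct. *)
Lemma solvent_basis_unit : V \in unitmx.
Proof.
rewrite unitmxE unitfE.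
have -> : V = Vandermonde n (\row_j lam (lshift n j) ^+ 2).
  by apply/matrixP => i j; rewrite !mxE -exprM mul2n.
rewrite det_Vandermonde; apply/prodf_neq0 => i _; apply/prodf_neq0 => j ij.
rewrite !mxE subr_eq0; apply: contraTneq ij => /lam2_inj/lshift_inj->.
by rewrite ltnn.
Qed.

Lemma even_powers_lshift j : v (lam (lshift n j)) = V *m delta_mx j 0.
Proof. by rewrite -colE; apply/matrixP => i l; rewrite !mxE. Qed.

Lemma solvent_eigen j : X *m v (lam (lshift n j)) = lam (lshift n j) *: v (lam (lshift n j)).
Proof.
rewrite even_powers_lshift /solvent -!mulmxA mulKmx ?solvent_basis_unit //.
rewrite scalemxAr; congr (V *m _); apply/matrixP => i l.
rewrite mul_diag_mx !mxE; case: eqVneq => [->|_] //; by rewrite /= !mulr0.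
Qed.

Lemma solvent_basis_eq0 (P : 'M[k]_n) : (forall j, P *m v (lam (lshift n j)) = 0) -> P = 0.
Proof.
move=> h; rewrite -[P](mulmxK solvent_basis_unit) (_ : P *m V = 0) ?mul0mx //.
apply/matrixP => i j; have := congr1 (fun M : 'cV_n => M i 0) (h j).
by rewrite even_powers_lshift mulmxA -colE !mxE.
Qed.

Lemma solvent_companion i :
  lam i ^+ 2 *: v (lam i) + lam i *: (B *m v (lam i)) + C *m v (lam i) = 0.
Proof.
exact: block_companion_vec monic_prod_roots size_prod_roots (root_prod_roots i).
Qed.

Lemma solvent_eq : X *m X + B *m X + C = 0.
Proof.
apply: solvent_basis_eq0 => j; rewrite !mulmxDl -(mulmxA X) -(mulmxA B) solvent_eigen.
by rewrite -!scalemxAr solvent_eigen scalerA -expr2 solvent_companion.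
Qed.

Lemma mxtrace_solvent : \tr X = \sum_(j < n) lam (lshift n j).
Proof.
rewrite /solvent mxtrace_mulC mulmxA mulVmx ?solvent_basis_unit // mul1mx mxtrace_diag.
by apply: eq_bigr => j _; rewrite mxE.
Qed.

(** From z^2 + z B + C = (z + X + B)(z - X): for each root a left over by X, the vector (a - X) v(a)
    is killed by a + X + B. *)
Let cosolvent_vec j := lam (rshift n j) *: v (lam (rshift n j)) - X *m v (lam (rshift n j)).

Lemma cosolvent_vec_neq0 j : cosolvent_vec j != 0.
Proof.
rewrite subr_eq0; apply/eqP; set a := lam _ => av.
pose c := invmx V *m v a.
have vE : v a = V *m c by rewrite mulmxA mulmxV ?solvent_basis_unit ?mul1mx.
have Lc : Lam *m c = a *: c.
  by rewrite /c scalemxAr av /solvent !mulmxA mulVmx ?solvent_basis_unit ?mul1mx.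
have c0 : c = 0.
  apply/matrixP => i l; have := congr1 (fun M : 'cV_n => M i l) Lc.
  rewrite mul_diag_mx !mxE => /eqP; rewrite -subr_eq0 -mulrBl mulf_eq0 subr_eq0.
  rewrite (inj_eq lam_inj) eq_lrshift /= => /eqP->.
  by [].
have := congr1 (fun M : 'cV_n => M 0 0) vE; rewrite c0 mulmx0 !mxE /= expr0.
by move/eqP; rewrite oner_eq0.
Qed.

Lemma cosolvent_eigen j :
  (X + B) *m cosolvent_vec j = - lam (rshift n j) *: cosolvent_vec j.
Proof.
rewrite /cosolvent_vec; set a := lam _; set w := v a.
have XB : (X + B) *m (X *m w) = - (C *m w).
  apply/eqP; rewrite -addr_eq0 mulmxA -mulmxDl (mulmxDl X B X) solvent_eq mul0mx.
  by [].
have Bw : a *: (B *m w) + C *m w = - (a ^+ 2 *: w).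
  by apply/eqP; rewrite -addr_eq0 addrC addrA; apply/eqP; exact: solvent_companion.
rewrite mulmxBr XB opprK -scalemxAr mulmxDl scalerDr -addrA Bw.
by rewrite scaleNr scalerBr scalerA -expr2 opprB.
Qed.

(** [X + B] already has the n distinct eigenvalues [- lam (rshift n i)], which leaves room for no
    other. The transpose appears because [eigenvalue] is about row vectors. *)
Lemma solvent_cospectrum j (w : 'cV[k]_n) :
  (X + B) *m w = - lam (lshift n j) *: w -> w = 0.
Proof.
move=> wE; apply/eqP; apply: contraT => w0.
pose g := (X + B)^T; pose p := char_poly g.
have rootg (a : k) (u : 'cV[k]_n) : u != 0 -> (X + B) *m u = a *: u -> root p a.
  move=> u0 uE; rewrite -eigenvalue_root_char; apply/eigenvalueP; exists u^T.
    by rewrite -trmx_mul uE linearZ.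
  by rewrite trmx_eq0.
pose rs := - lam (lshift n j) :: [seq - lam (rshift n i) | i <- enum 'I_n].
have := @max_poly_roots _ p rs; rewrite size_char_poly /= size_map size_enum_ord ltnn.
apply.
- by rewrite monic_neq0 // char_poly_monic.
- rewrite (rootg _ _ w0 wE) /=; apply/allP => _ /mapP[i _ ->].
  exact: rootg (cosolvent_vec_neq0 i) (cosolvent_eigen i).
- rewrite map_inj_uniq ?enum_uniq ?andbT.
    by apply/mapP => -[i _ /oppr_inj/lam_inj/eqP]; rewrite eq_lrshift.
  by move=> i i' /oppr_inj/lam_inj/rshift_inj.
Qed.

(** With b2 = 1 the derivative is the Sylvester operator (X + B) H + H X, and X + B and - X have
    disjoint spectra: H would send an eigenvector of X to one of X + B for the opposite
    eigenvalue. *)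
Lemma solvent_nondegenerate (H : 'M[k]_n) : quadratic_diff X B 1%:M H = 0 -> H = 0.
Proof.
rewrite /quadratic_diff mulmx1 => H0; apply: solvent_basis_eq0 => j.
apply: (@solvent_cospectrum j); apply/eqP; rewrite scaleNr -addr_eq0 mulmxDl.
have := congr1 (fun M => M *m v (lam (lshift n j))) H0.
rewrite mul0mx !mulmxDl -(mulmxA X) -(mulmxA H) -(mulmxA B) solvent_eigen -scalemxAr => e.
by rewrite -[X in _ == X]e addrAC.
Qed.

End Solvent.

(** * Matrices of size greater than 2 *)

Lemma frac_morph_eq (R : idomainType) (F : fieldType) (f g : {rmorphism {fraction R} -> F}) :
  (forall x, f (tofrac x) = g (tofrac x)) -> f =1 g.
Proof.
move=> fg z; have [p [d [d0 zd]]] := frac_numden z.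
have fd0 : f (tofrac d) != 0 by rewrite fmorph_eq0 tofrac_eq0.
apply: (mulIf fd0); have := congr1 g zd; have := congr1 f zd.
by rewrite !rmorphM /= -!fg => <- ->.
Qed.

Lemma sol_over_morph n (F F' : fieldType) (f : {rmorphism genericK n -> F})
    (f' : {rmorphism genericK n -> F'}) (g : {rmorphism F -> F'}) X :
  (forall a, g (f a) = f' a) -> sol_over f X -> sol_over f' (map_mx g X).
Proof.
move=> gf /(congr1 (map_mx g)); rewrite map_mx_quadratic map_mx0.
have e l : map_mx g (map_mx f (generic_mx n l)) = map_mx f' (generic_mx n l).
  by apply/matrixP => i j; rewrite !mxE.
by rewrite !e.
Qed.

Section HigherDegree.

Variables (n' : nat) (Kbar : closedFieldType).
Local Notation n := n'.+1.
Local Notation K := (genericK n).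
Variable iota : {rmorphism K -> Kbar}.
Hypothesis alg : algebraic_closure iota.

Let A : idomainType := {mpoly Kbar[n + n]}.
Let k : fieldType := {fraction A}.
Let lam (i : 'I_(n + n)) : k := tofrac ('X_i : A).

Let perm_vars (p : 'S_(n + n)) : {rmorphism A -> A} :=
  mmap (mpolyC (n + n) (R:=Kbar)) (fun i => 'X_(p i)).

Let perm_varsX p i : perm_vars p 'X_i = 'X_(p i).
Proof. exact: mmapXi. Qed.

Let perm_varsM p q P : perm_vars q (perm_vars p P) = perm_vars (p * q)%g P.
Proof.
rewrite {2}/perm_vars /= (rmorph_mmap (mpolyC (n + n) (R:=Kbar)) (perm_vars q)).
apply: eq_mmap => [a|i] /=; first exact: mmapC.
by rewrite permM; apply: perm_varsX.
Qed.

Let perm_vars1 P : perm_vars 1%g P = P.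
Proof.
rewrite /= [RHS]mpolyE; apply: eq_bigr => m _; rewrite mul_mpolyC; congr (_ *: _).
by rewrite [RHS]mpolyXE_id; apply: eq_bigr => i _; rewrite perm1.
Qed.

Let perm_vars_inj p : injective (perm_vars p).
Proof. by apply: (can_inj (g := perm_vars p^-1%g)) => P; rewrite perm_varsM mulgV perm_vars1. Qed.

Let field_action : exists t : 'S_(n + n) -> {rmorphism k -> k},
  forall p P, t p (tofrac P) = tofrac (perm_vars p P).
Proof.
have /choice[t tE] p : exists t : {rmorphism k -> k},
    forall P, t (tofrac P) = tofrac (perm_vars p P).
  have [|t tE] := @frac_lift A k (@tofrac A \o perm_vars p); last by exists t.
  by apply: inj_comp; [apply: tofrac_inj | apply: perm_vars_inj].
by exists t.
Qed.

Let lam2_inj : injective (fun i => lam i ^+ 2).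
Proof.
move=> i j; rewrite /lam -!tofracXn => /tofrac_inj; rewrite !mpolyXn => ij.
have := congr1 (mcoeff (U_(i) *+ 2)%MM) ij; rewrite !mcoeffX eqxx.
case: eqVneq => [/mnmP/(_ i)|_ /eqP]; last by rewrite oner_eq0.
by rewrite !mulmnE !mnm1E eqxx; case: eqVneq.
Qed.

Let dA : {poly A} := \prod_i ('X - ('X_i)%:P).

Let perm_dA p : map_poly (perm_vars p) dA = dA.
Proof.
rewrite /dA rmorph_prod /= [RHS](reindex_inj (@perm_inj _ p)) /=.
by apply: eq_bigr => i _; rewrite rmorphB /= map_polyX map_polyC /= mmapXi.
Qed.

Let frac_dA : map_poly (@tofrac A) dA = prod_roots lam.
Proof.
rewrite /dA rmorph_prod; apply: eq_bigr => i _.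
by rewrite rmorphB /= map_polyX map_polyC.
Qed.

(** Sending all indeterminates to 0 turns d into X^(2n), hence the special coefficients into
    rational matrices, as [deformation_morph] requires. *)
Let ev0 : {rmorphism A -> Kbar} := mmap (@idfun Kbar) (fun _ => 0).

Let ev0_dA : map_poly ev0 dA = 'X^(n + n).
Proof.
rewrite /dA rmorph_prod (eq_bigr (fun _ => 'X)) ?prodr_const ?card_ord // => i _.
by rewrite rmorphB /= map_polyX map_polyC /= mmapXi subr0.
Qed.

Let x0 : 'I_3 -> 'M[{poly A}]_n := fun l =>
  map_mx polyC (triple (blockB n dA) 1%:M (blockC n dA) l).
Let q0 : 'I_3 -> 'M[rat]_n :=
  triple (blockB n 'X^(n + n)) 1%:M (blockC n 'X^(n + n)).

Lemma higher_nonsolvable : (2 < n)%N -> eq_nonsolvable iota (sol_over iota).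
Proof.
move=> n3; have [t tE] := field_action.
have [|f fE] := @deformation_morph n Kbar iota A k (@tofrac A) (mpolyC (n + n) (R:=Kbar))
    ev0 (@tofrac_inj A) (fun a => mmapC _ _ a) x0 q0 1.
  move=> l; rewrite /x0 /q0 -map_mx_comp (triple_map (map_mx (rat_base iota))).
  rewrite (_ : map_mx _ _ = map_mx ev0 (triple (blockB n dA) 1%:M (blockC n dA) l)).
    rewrite (triple_map (map_mx ev0)) !map_blockB !map_blockC !map_mx1.
    by rewrite ev0_dA map_polyXn.
  by apply/matrixP => i j; rewrite !mxE /= map_polyC /horner_eval hornerC.
(* The integral form of the deformed coefficients. Permutations of the indeterminates fix it: [dA]
   is symmetric, and the generic term involves none of them. *)
have [BE [ff resBE smapBE]] : exists BE : 'I_3 -> 'M[series k]_n,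
    [/\ forall l, map_mx f (generic_mx n l) = map_mx (@tofrac (series k)) (BE l),
        forall l, map_mx sresidue (BE l) =
          triple (blockB n (prod_roots lam)) 1%:M (blockC n (prod_roots lam)) l
      & forall p l, map_mx (smap (t p)) (BE l) = BE l].
  pose BE l : 'M[series k]_n := map_mx (series_poly \o map_poly (@tofrac A))
    (x0 l + 'X^1 *: map_mx (polyC \o mpolyC (n + n) (R:=Kbar) \o iota) (generic_mx n l)).
  exists BE; split=> [l|l|p l]; first by rewrite fE.
    rewrite -frac_dA -!map_blockB -!map_blockC -(map_mx1 (@tofrac A)) -(triple_map (map_mx _)).
    apply/matrixP => i j; rewrite !mxE /sresidue /= coef_map /=.
    by rewrite coefD coefC /= coefMC coefX mul0r addr0.
  rewrite /BE -map_mx_comp; apply/matrixP => i j; rewrite !mxE /= smap_poly.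
  congr (series_poly _); rewrite -map_poly_comp.
  set P := (X in map_poly _ X = _); have PE : map_poly (perm_vars p) P = P.
    rewrite /P rmorphD rmorphM /= map_polyXn !map_polyC /= mmapC; congr (_%:P + _).
    have := congr1 (fun M : 'M_n => M i j)
      (triple_map (map_mx (perm_vars p)) (blockB n dA) 1%:M (blockC n dA) l).
    by rewrite mxE map_blockB map_blockC map_mx1 perm_dA.
  apply: etrans (congr1 (map_poly (@tofrac A)) PE); rewrite -map_poly_comp.
  by apply: eq_map_poly => a; apply: tE.
pose E : idomainType := series k.
have [] := @hensel_quadratic k n (BE (inord 0)) (BE (inord 1)) (BE (inord 2)) (solvent lam).
- by rewrite !resBE /triple !inordK //= mulmx1 solvent_eq.
- by move=> H; rewrite !resBE /triple !inordK //=; apply: solvent_nondegenerate.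
move=> [XE XEsol XEres] _.
have /choice[s sE] p : exists s : {rmorphism {fraction E} -> {fraction E}},
    forall a, s (tofrac a) = tofrac (smap (t p) a).
  have [|s sE] := @frac_lift E _ (@tofrac E \o smap (t p)); last by exists s.
  by apply: inj_comp; [apply: tofrac_inj | apply: smap_inj].
have sf p a : s p (f a) = f a.
  apply: (generic_morph_eq (f := s p \o f)) => l.
  rewrite map_mx_comp ff -map_mx_comp; rewrite -[in RHS](smapBE p) -map_mx_comp.
  by apply/matrixP => i j; rewrite !mxE /= sE.
pose T p : 'M[{fraction E}]_n := map_mx (@tofrac E \o smap (t p)) XE.
have TE p : T p = map_mx (s p) (map_mx (@tofrac E) XE).
  by apply/matrixP => i j; rewrite !mxE /= sE.
have sol1 : sol_over f (map_mx (@tofrac E) XE).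
  rewrite /sol_over !ff -map_mx_quadratic XEsol; exact: map_mx0.
apply: (@nonsolvable_of_Alt_action n Kbar iota alg (n + n) _ f s T).
- by move: n3; lia.
- exact: sf.
- move=> p q; apply/matrixP => i j; rewrite !mxE /= sE; congr tofrac.
  apply: seriesP => m /=.
  apply: (frac_morph_eq (f := t q \o t p)) => P /=; rewrite !tE; congr tofrac.
  exact: perm_varsM.
- by move=> p; rewrite TE; apply: sol_over_morph sol1; apply: sf.
pose i0 : 'I_n := ord0; pose r0 := rshift n (inord 0 : 'I_n).
pose r1 := rshift n (inord 1 : 'I_n); pose r2 := rshift n (inord 2 : 'I_n).
have r12 : r1 != r2.
  by rewrite (inj_eq (@rshift_inj _ _)) -val_eqE /= !inordK // ltnW.
(* The first factor trades an eigenvalue for a root outside the spectrum; the second, between two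
   further outside roots, makes the permutation even. Three outside roots exist because n > 2. *)
exists (tperm (lshift n i0) r0 * tperm r1 r2)%g.
  by rewrite Alt_even odd_permM !odd_tperm r12 eq_lrshift.
set p := (_ * _)%g => Tp.
(* The two lifts are told apart by the traces of their residues, which are sums of n
   indeterminates. *)
have : \tr (map_mx (t p) (solvent lam)) = \tr (map_mx (t 1%g) (solvent lam)).
  congr mxtrace; rewrite -XEres; apply/matrixP => i j.
  have := congr1 (fun M : 'M_n => M i j) Tp; rewrite !mxE => /tofrac_inj.
  by move/(congr1 sresidue); rewrite !sresidue_smap.
have tl p' i : t p' (lam i) = lam (p' i) by rewrite tE perm_varsX.
have trE p' : \tr (map_mx (t p') (solvent lam)) = \sum_(j < n) lam (p' (lshift n j)).
  rewrite trace_map_mx (mxtrace_solvent lam2_inj) (rmorph_sum (t p')).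
  by apply: eq_bigr => j _; apply: tl.
rewrite !trE (bigD1 i0) //= [in RHS](bigD1 i0) //= perm1 permM tpermL.
rewrite (eq_bigr (fun i => lam ((1 : 'S_(n + n))%g (lshift n i)))); last first.
  move=> i ii0; have ne0 : lshift n i0 != lshift n i.
    by rewrite (inj_eq (@lshift_inj _ _)) eq_sym.
  by rewrite perm1 permM !tpermD ?eq_rlshift.
move/addIr/tofrac_inj.
rewrite tpermD; first last.
- by rewrite (inj_eq (@rshift_inj _ _)) -val_eqE /= !inordK // ltnW.
- by rewrite (inj_eq (@rshift_inj _ _)) -val_eqE /= !inordK // ltnW.
move/(congr1 (mcoeff U_(r0)%MM)); rewrite !mcoeffXU eqxx /r0 eq_lrshift.
by move/eqP; rewrite oner_eq0.
Qed.

End HigherDegree.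

(** * Trace elimination for 2 x 2 matrices *)

Lemma ord2P (P : 'I_2 -> Prop) : P 0 -> P 1 -> forall i, P i.
Proof. by move=> P0 P1 [[|[|]] //= h]; [move: P0 | move: P1]; congr P; apply: val_inj. Qed.

Lemma mulmx2E (R : pzSemiRingType) m p (A : 'M[R]_(m, 2)) (B : 'M[R]_(2, p)) i j :
  (A *m B) i j = A i 0 * B 0 j + A i 1 * B 1 j.
Proof.
rewrite mxE !big_ord_recl big_ord0 addr0.
by rewrite (_ : lift ord0 ord0 = 1) //; apply: val_inj.
Qed.

Lemma mxtrace2 (R : pzSemiRingType) (A : 'M[R]_2) : \tr A = A 0 0 + A 1 1.
Proof.
rewrite /mxtrace !big_ord_recl big_ord0 addr0.
by rewrite (_ : lift ord0 ord0 = 1) //; apply: val_inj.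
Qed.

(** The equations for x and z give u D = t q1 q2 + v. After multiplication by u, each right-hand
    side becomes divisible by [q1] or [q2], off the diagonal by the two determinant relations;
    dividing these factors out keeps the degree low. Substitution into D = x z - y w then eliminates
    D. *)
Lemma trace_elimination (F : fieldType) (q1 q2 r11 r12 r21 r22 s11 s12 s21 s22 c12 c21
    x y w z : F) :
  q1 * q2 != 0 -> let t := x + z in let D := x * z - y * w in
  q1 * x = D * r11 - s11 -> q1 * y = D * r12 - s12 ->
  q2 * w = D * r21 - s21 -> q2 * z = D * r22 - s22 ->
  r11 * s12 - r12 * s11 = q1 * c12 -> r21 * s22 - r22 * s21 = - (q2 * c21) ->
  let u := r11 * q2 + r22 * q1 in let v := s11 * q2 + s22 * q1 in
  let m := s22 * r11 - r22 * s11 in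
  let g12 := s22 * r12 - r22 * s12 - q2 * c12 in
  let g21 := s11 * r21 - r11 * s21 - q1 * c21 in
  (t * q2 * r11 + m) * (t * q1 * r22 - m) - (t * q2 * r12 + g12) * (t * q1 * r21 + g21)
    - u * (t * (q1 * q2) + v) = 0.
Proof.
move=> q0 t D ex ey ew ez det1 det2 u v m g12 g21.
have uD : u * D = t * (q1 * q2) + v.
  have -> : t * (q1 * q2) = q2 * (q1 * x) + q1 * (q2 * z) by rewrite /t; ring.
  by rewrite ex ez /u /v; ring.
have h12 : u * (D * r12 - s12) = q1 * (t * q2 * r12 + g12).
  rewrite mulrBr mulrA uD [RHS](_ : _ = t * (q1 * q2) * r12
    + q1 * (s22 * r12 - r22 * s12) - q2 * (q1 * c12)); last by rewrite /g12; ring.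
  by rewrite -det1 /u /v; ring.
have h21 : u * (D * r21 - s21) = q2 * (t * q1 * r21 + g21).
  rewrite mulrBr mulrA uD [RHS](_ : _ = t * (q1 * q2) * r21
    + q2 * (s11 * r21 - r11 * s21) + q1 * (- (q2 * c21))); last by rewrite /g21; ring.
  by rewrite -det2 /u /v; ring.
have h11 : u * (D * r11 - s11) = q1 * (t * q2 * r11 + m).
  by rewrite mulrBr mulrA uD /u /v /m; ring.
have h22 : u * (D * r22 - s22) = q2 * (t * q1 * r22 - m).
  by rewrite mulrBr mulrA uD /u /v /m; ring.
have eqn : (q1 * q2) * (u * (u * D)) =
    (q1 * (t * q2 * r11 + m)) * (q2 * (t * q1 * r22 - m)) -
    (q1 * (t * q2 * r12 + g12)) * (q2 * (t * q1 * r21 + g21)).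
  rewrite -h11 -h12 -h21 -h22 -ex -ey -ew -ez /D; ring.
apply: (mulfI q0); rewrite mulr0 -uD.
move: eqn; move: (t * q2 * r11 + m) (t * q1 * r22 - m) (t * q2 * r12 + g12)
  (t * q1 * r21 + g21) => X1 X2 X3 X4 eqn.
rewrite [LHS](_ : _ = q1 * X1 * (q2 * X2) - q1 * X3 * (q2 * X4) - q1 * q2 * (u * (u * D)));
  last by ring.
by rewrite -eqn subrr.
Qed.

Section DiagonalQuadratic.

Variables (F : fieldType) (l1 l2 a b c d c11 c12 c21 c22 : F).

(* The row x_i of a solution satisfies x_i (t + l_i B2) = delta e_i - c_i, with
   t and delta the trace and determinant of the solution; r_i and s_i are e_i
   and c_i times the adjugate of t + l_i B2, whose determinant is q_i. *)
Let q1 : {poly F} := ('X + (l1 * (a + d))%:P) * 'X + (l1 ^+ 2 * (a * d - b * c))%:P.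
Let q2 : {poly F} := ('X + (l2 * (a + d))%:P) * 'X + (l2 ^+ 2 * (a * d - b * c))%:P.
Let r11 : {poly F} := 'X + (l1 * d)%:P.
Let r12 : {poly F} := (- (l1 * b))%:P.
Let r21 : {poly F} := (- (l2 * c))%:P.
Let r22 : {poly F} := 'X + (l2 * a)%:P.
Let s11 : {poly F} := c11%:P * ('X + (l1 * d)%:P) - (c12 * (l1 * c))%:P.
Let s12 : {poly F} := c12%:P * ('X + (l1 * a)%:P) - (c11 * (l1 * b))%:P.
Let s21 : {poly F} := c21%:P * ('X + (l2 * d)%:P) - (c22 * (l2 * c))%:P.
Let s22 : {poly F} := c22%:P * ('X + (l2 * a)%:P) - (c21 * (l2 * b))%:P.
Let u := r11 * q2 + r22 * q1.
Let v := s11 * q2 + s22 * q1.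
Let m := s22 * r11 - r22 * s11.
Let g12 := s22 * r12 - r22 * s12 - q2 * c12%:P.
Let g21 := s11 * r21 - r11 * s21 - q1 * c21%:P.

Definition trace_poly : {poly F} :=
  ('X * q2 * r11 + m) * ('X * q1 * r22 - m)
  - ('X * q2 * r12 + g12) * ('X * q1 * r21 + g21) - u * ('X * (q1 * q2) + v).

Let monicXC z : ('X + z%:P : {poly F}) \is monic.
Proof. by rewrite -(opprK z) polyCN monicXsubC. Qed.
Let sizeXC z : size ('X + z%:P : {poly F}) = 2.
Proof. by rewrite -(opprK z) polyCN size_XsubC. Qed.

Let quad_monic z z' : (('X + z%:P) * 'X + z'%:P : {poly F}) \is monic /\
  size (('X + z%:P) * 'X + z'%:P : {poly F}) = 3.
Proof.
have s3 : size (('X + z%:P) * 'X : {poly F}) = 3.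
  by rewrite size_mulX ?sizeXC // monic_neq0.
have lt : (size (z'%:P : {poly F}) < size (('X + z%:P) * 'X : {poly F})%R)%N.
  by rewrite s3 size_polyC; case: eqP.
rewrite size_polyDl // s3; split=> //.
by rewrite monicE lead_coefDl // -monicE monicMl ?monicX.
Qed.

Let q1_monic : q1 \is monic.
Proof. by case: (quad_monic (l1 * (a + d)) (l1 ^+ 2 * (a * d - b * c))). Qed.
Let q2_monic : q2 \is monic.
Proof. by case: (quad_monic (l2 * (a + d)) (l2 ^+ 2 * (a * d - b * c))). Qed.
Let q1_size : size q1 = 3.
Proof. by case: (quad_monic (l1 * (a + d)) (l1 ^+ 2 * (a * d - b * c))). Qed.
Let q2_size : size q2 = 3.
Proof. by case: (quad_monic (l2 * (a + d)) (l2 ^+ 2 * (a * d - b * c))). Qed.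

Let size_leM k k' (p p' : {poly F}) :
  (size p <= k.+1)%N -> (size p' <= k')%N -> (size (p * p')%R <= k + k')%N.
Proof. by move=> h h'; apply: leq_trans (size_polyMleq _ _) _; lia. Qed.
Let size_leD k (p p' : {poly F}) :
  (size p <= k)%N -> (size p' <= k)%N -> (size (p + p')%R <= k)%N.
Proof. by move=> h h'; apply: leq_trans (size_polyD _ _) _; rewrite geq_max h. Qed.
Let size_leB k (p p' : {poly F}) :
  (size p <= k)%N -> (size p' <= k)%N -> (size (p - p')%R <= k)%N.
Proof. by move=> h h'; apply: size_leD => //; rewrite size_polyN. Qed.
Let size_leC k z : (size (z%:P : {poly F}) <= k.+1)%N.
Proof. by apply: leq_trans (size_polyC_leq1 _) _. Qed.

(** The dominant part is - t q1 q2 w, where w = u - t r11 r22 is monic of degree 3: the leading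
    terms 2 t^3 and t^3 leave t^3. What remains has degree at most 6. *)
Lemma size_trace_poly : size trace_poly = 9.
Proof.
pose w := r11 * (q2 - 'X * r22) + r22 * q1.
have wq : q2 - 'X * r22 = (l2 * d)%:P * 'X + (l2 ^+ 2 * (a * d - b * c))%:P.
  by rewrite /q2 /r22 !(polyCM, polyCD, polyCB); ring.
have s_low : (size (r11 * (q2 - 'X * r22))%R <= 3)%N.
  apply: (@size_leM 1 2); rewrite ?sizeXC // wq; apply: size_leD; last exact: size_leC.
  by apply: (@size_leM 0 2); rewrite ?size_polyX ?size_leC.
have r22_monic : r22 \is monic by apply: monicXC.
have rq_size : size (r22 * q1)%R = 4.
  by rewrite size_monicM ?monic_neq0 // q1_size /r22 sizeXC.
have w_monic : w \is monic.
  by rewrite monicE /w addrC lead_coefDl ?rq_size // -monicE monicMl.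
have w_size : size w = 4 by rewrite /w addrC size_polyDl rq_size.
pose low := m * ('X * q1 * r22 - m) - 'X * q2 * r11 * m
  - ('X * q2 * r12 + g12) * ('X * q1 * r21 + g21) - u * v.
have sm : (size m <= 3)%N.
  apply: size_leB; apply: (@size_leM 1 2); rewrite ?sizeXC //;
  apply: size_leB; rewrite ?size_leC //; apply: (@size_leM 0 2); rewrite ?size_leC ?sizeXC //.
have s_s z z' z'' : (size (z%:P * ('X + z'%:P) - z''%:P : {poly F})%R <= 2)%N.
  by apply: size_leB; rewrite ?size_leC //; apply: (@size_leM 0 2); rewrite ?size_leC ?sizeXC.
have sg12 : (size ('X * q2 * r12 + g12)%R <= 4)%N.
  apply: size_leD.
    apply: (@size_leM 3 1); rewrite ?size_leC // (@size_leM 1 3) ?size_polyX ?q2_size //.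
  apply: size_leB; [apply: size_leB|]; apply: (@leq_trans 3) => //.
  - by apply: (@size_leM 1 2); rewrite ?s_s // (leq_trans (size_leC 0 _)).
  - by apply: (@size_leM 1 2); rewrite ?s_s ?sizeXC.
  - by apply: (@size_leM 2 1); rewrite ?q2_size ?size_leC.
have sg21 : (size ('X * q1 * r21 + g21)%R <= 4)%N.
  apply: size_leD.
    apply: (@size_leM 3 1); rewrite ?size_leC // (@size_leM 1 3) ?size_polyX ?q1_size //.
  apply: size_leB; [apply: size_leB|]; apply: (@leq_trans 3) => //.
  - by apply: (@size_leM 1 2); rewrite ?s_s // (leq_trans (size_leC 0 _)).
  - by apply: (@size_leM 1 2); rewrite ?s_s ?sizeXC.
  - by apply: (@size_leM 2 1); rewrite ?q1_size ?size_leC.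
have s_low7 : (size low <= 7)%N.
  have sXqr (q : {poly F}) z : size q = 3 -> (size ('X * q * ('X + z%:P))%R <= 5)%N.
    by move=> sq; apply: (@size_leM 3 2); rewrite ?sizeXC // (@size_leM 1 3) ?size_polyX ?sq.
  rewrite /low; apply: size_leB; [apply: size_leB; [apply: size_leB|]|].
  - apply: (@size_leM 2 5) => //; apply: size_leB; first exact: sXqr.
    exact: leq_trans sm _.
  - by apply: (@size_leM 4 3) => //; apply: sXqr.
  - by apply: (@size_leM 3 4).
  - apply: (@size_leM 3 4); rewrite /u /v; apply: size_leD;
      [apply: (@size_leM 1 3)|apply: (@size_leM 1 3)|apply: (@size_leM 1 3)|apply: (@size_leM 1 3)];
      by rewrite ?sizeXC ?q1_size ?q2_size ?s_s.
pose main := 'X * q1 * q2 * w.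
have main_size : size main = 9.
  rewrite /main !size_monicM ?monic_neq0 ?monicMl ?monicX //.
  by rewrite size_polyX q1_size q2_size w_size.
have -> : trace_poly = - main + low.
  by rewrite /trace_poly /main /low /w /u; ring.
by rewrite size_polyDl size_polyN main_size // (leq_ltn_trans s_low7).
Qed.

Section Roots.

Variables x y w z : F.
Hypothesis eq11 : x * x + y * w + l1 * (x * a + y * c) + c11 = 0.
Hypothesis eq12 : x * y + y * z + l1 * (x * b + y * d) + c12 = 0.
Hypothesis eq21 : w * x + z * w + l2 * (w * a + z * c) + c21 = 0.
Hypothesis eq22 : w * y + z * z + l2 * (w * b + z * d) + c22 = 0.
Let t := x + z.
Let D := x * z - y * w.

(** Cayley-Hamilton, X^2 = t X - D, is what makes the equation linear in the rows of X. *)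
Lemma diagonal_entries :
  [/\ q1.[t] * x = D * r11.[t] - s11.[t], q1.[t] * y = D * r12.[t] - s12.[t],
      q2.[t] * w = D * r21.[t] - s21.[t] & q2.[t] * z = D * r22.[t] - s22.[t]].
Proof.
have e11 : c11 = - (x * x + y * w + l1 * (x * a + y * c)).
  by apply/eqP; rewrite -addr_eq0 addrC eq11.
have e12 : c12 = - (x * y + y * z + l1 * (x * b + y * d)).
  by apply/eqP; rewrite -addr_eq0 addrC eq12.
have e21 : c21 = - (w * x + z * w + l2 * (w * a + z * c)).
  by apply/eqP; rewrite -addr_eq0 addrC eq21.
have e22 : c22 = - (w * y + z * z + l2 * (w * b + z * d)).
  by apply/eqP; rewrite -addr_eq0 addrC eq22.
rewrite /q1 /q2 /r11 /r12 /r21 /r22 /s11 /s12 /s21 /s22.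
rewrite !(hornerD, hornerN, hornerM, hornerX, hornerC) /t /D e11 e12 e21 e22.
by split; ring.
Qed.

Lemma trace_poly_root : q1.[t] * q2.[t] != 0 -> root trace_poly t.
Proof.
move=> q0; have [ex ey ew ez] := diagonal_entries.
have det1 : r11.[t] * s12.[t] - r12.[t] * s11.[t] = q1.[t] * c12.
  by rewrite /q1 /r11 /r12 /s11 /s12 !(hornerD, hornerN, hornerM, hornerX, hornerC); ring.
have det2 : r21.[t] * s22.[t] - r22.[t] * s21.[t] = - (q2.[t] * c21).
  by rewrite /q2 /r22 /r21 /s21 /s22 !(hornerD, hornerN, hornerM, hornerX, hornerC); ring.
have := trace_elimination q0 ex ey ew ez det1 det2; rewrite -/t => e.
rewrite rootE; apply/eqP; rewrite -[RHS]e /trace_poly /u /v /m /g12 /g21.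
by rewrite !(hornerD, hornerN, hornerM, hornerX, hornerC).
Qed.

End Roots.

End DiagonalQuadratic.

Lemma det2 (R : comNzRingType) (A : 'M[R]_2) : \det A = A 0 0 * A 1 1 - A 0 1 * A 1 0.
Proof.
have e1 : lift (0 : 'I_2) (0 : 'I_1) = 1 by apply: val_inj.
have e2 : lift (1 : 'I_2) (0 : 'I_1) = 0 by apply: val_inj.
rewrite (expand_det_row _ 0) big_ord_recl big_ord1 /cofactor !det_mx11 !mxE.
by rewrite !e1 !e2 /= expr0 expr1 mul1r mulN1r mulrN.
Qed.

(** The sum of the equations for x and z expresses u D through the trace, so the trace determines D,
    and then every entry. *)
Lemma trace_injective (F : fieldType) (q1 q2 r11 r12 r21 r22 s11 s12 s21 s22
    x y w z D x' y' w' z' D' : F) :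
  q1 * q2 != 0 -> r11 * q2 + r22 * q1 != 0 -> x + z = x' + z' ->
  [/\ q1 * x = D * r11 - s11, q1 * y = D * r12 - s12,
      q2 * w = D * r21 - s21 & q2 * z = D * r22 - s22] ->
  [/\ q1 * x' = D' * r11 - s11, q1 * y' = D' * r12 - s12,
      q2 * w' = D' * r21 - s21 & q2 * z' = D' * r22 - s22] ->
  [/\ x = x', y = y', w = w' & z = z'].
Proof.
rewrite mulf_eq0 negb_or => /andP[q10 q20] u0 tt [ex ey ew ez] [ex' ey' ew' ez'].
have DD : D = D'.
  apply/eqP; rewrite -subr_eq0 -(mulIr_eq0 _ (mulIf u0)).
  rewrite [eqbLHS](_ : _ = q2 * (D * r11 - s11) + q1 * (D * r22 - s22) -
    (q2 * (D' * r11 - s11) + q1 * (D' * r22 - s22))); last by ring.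
  rewrite -ex -ez -ex' -ez' [eqbLHS](_ : _ = q1 * q2 * (x + z - (x' + z'))); last by ring.
  by rewrite tt subrr mulr0.
split; [apply: (mulfI q10)|apply: (mulfI q10)|apply: (mulfI q20)|apply: (mulfI q20)].
- by rewrite ex ex' DD.
- by rewrite ey ey' DD.
- by rewrite ew ew' DD.
- by rewrite ez ez' DD.
Qed.

Lemma diagonalize2 (F : closedFieldType) (B : 'M[F]_2) :
  \tr B ^+ 2 - 4 * \det B != 0 ->
  exists P l1 l2, P \in unitmx /\
    P *m B = diag_mx (\row_i if i == 0 then l1 else l2) *m P :> 'M_2.
Proof.
move=> disc; pose p : {poly F} := 'X^2 - (\tr B) *: 'X + (\det B)%:P.
have [l1 /rootP pl1] : exists l, root p l.
  apply/closed_rootP; rewrite /p -addrA size_polyDl ?size_polyXn //.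
  apply: leq_ltn_trans (size_polyD _ _) _; rewrite gtn_max size_polyN.
  rewrite (leq_ltn_trans (size_scale_leq _ _)) ?size_polyX //.
  by rewrite (leq_ltn_trans (size_polyC_leq1 _)).
rewrite /p !(hornerD, hornerN, hornerZ, hornerXn, hornerX, hornerC) in pl1.
pose l2 := \tr B - l1.
have l12 : l1 != l2.
  apply: contra disc => /eqP l12.
  have dE : \det B = \tr B * l1 - l1 ^+ 2.
    by apply/eqP; rewrite -subr_eq0 -[eqbRHS]pl1; apply/eqP; ring.
  have tE : \tr B = l1 + l1 by rewrite {2}l12 /l2 addrC subrK.
  by apply/eqP; rewrite dE tE; ring.
have det_l l : \det (l%:M - B) = l ^+ 2 - \tr B * l + \det B.
  rewrite !det2 mxtrace2 !mxE !eqxx /= !mulr1n !mulr0n; ring.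
have /eqP/det0P[u1 u10 e1] : \det (l1%:M - B) = 0 by rewrite det_l.
have /eqP/det0P[u2 u20 e2] : \det (l2%:M - B) = 0.
  by rewrite det_l -pl1 /l2; ring.
have ev u l : u *m (l%:M - B) = 0 -> u *m B = l *: u :> 'rV_2.
  rewrite mulmxBr mul_mx_scalar => /eqP; rewrite subr_eq0 => /eqP->; exact: erefl.
move/ev: e1 => e1; move/ev: e2 => e2.
pose P : 'M[F]_2 := \matrix_(i, j) (if i == 0 then u1 0 j else u2 0 j).
have vP (v : 'rV_2) : v *m P = v 0 0 *: u1 + v 0 1 *: u2.
  by apply/matrixP => i j; rewrite ord1 mulmx2E !mxE.
exists P, l1, l2; split; last first.
  apply/row_matrixP => i; rewrite !row_mul; elim/ord2P: i.
    rewrite (_ : row 0 P = u1) ?e1; last by apply/matrixP => i j; rewrite !mxE ord1.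
    by rewrite vP !mxE /= mulr1n mulr0n scale0r addr0.
  rewrite (_ : row 1 P = u2) ?e2; last by apply/matrixP => i j; rewrite !mxE ord1.
  by rewrite vP !mxE /= mulr1n mulr0n scale0r add0r.
rewrite unitmxE unitfE; apply/det0P => -[v v0]; rewrite vP => vu.
have := congr1 (mulmxr B) vu; rewrite /= mul0mx mulmxDl -!scalemxAl e1 e2 => vu'.
have a0 : v 0 0 = 0.
  have : (v 0 0 * (l1 - l2)) *: u1 = 0.
    rewrite -[RHS]vu' -[LHS]addr0 -(scaler0 _ l2) -vu.
    by rewrite scalerDr !scalerA mulrBr scalerBl addrA [l2 * v 0 0]mulrC subrK (mulrC l2).
  by move/eqP; rewrite scaler_eq0 (negPf u10) orbF mulf_eq0 subr_eq0 (negPf l12) orbF => /eqP.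
have b0 : v 0 1 = 0.
  move: vu; rewrite a0 scale0r add0r => /eqP.
  by rewrite scaler_eq0 (negPf u20) orbF => /eqP.
by case/eqP: v0; apply/matrixP => i; rewrite ord1; apply: ord2P; rewrite mxE.
Qed.

(** * The bound 8 on the number of solutions *)

Section SolutionBound.

(** This and the next formula are the values at t of q1 q2 and of u, rewritten in traces and
    determinants, which need no diagonalisation. The first is the determinant of t plus the
    Kronecker product of B1 and B2. *)
Definition resolvent_det (R : pzRingType) (t1 d1 t2 d2 t : R) : R :=
  t ^+ 4 + t1 * t2 * t ^+ 3 + (d1 * t2 ^+ 2 + d2 * t1 ^+ 2 - 2 * (d1 * d2)) * t ^+ 2
  + t1 * t2 * (d1 * d2) * t + d1 ^+ 2 * d2 ^+ 2.

Definition resolvent_trace (R : pzRingType) (t1 d1 t2 d2 s t : R) : R :=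
  2 * t ^+ 3 + t1 * t2 * t ^+ 2 + (t1 ^+ 2 - 2 * d1) * d2 * t
  + (t1 * t2 - s) * t ^+ 2 + d1 * t2 ^+ 2 * t + d1 * d2 * s.

(** Where both resolvents are nonzero, a solution is determined by its trace, and the trace is a
    root of [trace_poly]. *)
Lemma quadratic_sol_bound (F : closedFieldType) (B1 B2 C : 'M[F]_2) (S : seq 'M[F]_2) :
  \tr B1 ^+ 2 - 4 * \det B1 != 0 -> uniq S ->
  (forall X, X \in S -> X *m X + B1 *m X *m B2 + C = 0) ->
  (forall X, X \in S ->
     resolvent_det (\tr B1) (\det B1) (\tr B2) (\det B2) (\tr X) != 0 /\
     resolvent_trace (\tr B1) (\det B1) (\tr B2) (\det B2) (\tr (B1 *m B2)) (\tr X) != 0) ->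
  (size S <= 8)%N.
Proof.
move=> disc uS solS ndS; have [P [l1 [l2 [Pu PB]]]] := diagonalize2 disc.
pose cj (M : 'M[F]_2) := P *m M *m invmx P.
have cjM M N : cj M *m cj N = cj (M *m N).
  by rewrite /cj !mulmxA mulmxKV.
have cjD M N : cj M + cj N = cj (M + N) by rewrite /cj mulmxDr mulmxDl.
have cj_tr M : \tr (cj M) = \tr M by rewrite mxtrace_mulC mulKmx.
have cj_det M : \det (cj M) = \det M.
  by rewrite !det_mulmx mulrC mulrA -det_mulmx mulVmx // det1 mul1r.
pose Dg : 'M[F]_2 := diag_mx (\row_i if i == 0 then l1 else l2).
have cjB1 : cj B1 = Dg by rewrite /cj PB mulmxK.
have [D00 D01 D10 D11] : [/\ Dg 0 0 = l1, Dg 0 1 = 0, Dg 1 0 = 0 & Dg 1 1 = l2].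
  by rewrite /Dg !mxE /= mulr1n mulr0n.
have t1E : \tr B1 = l1 + l2 by rewrite -cj_tr cjB1 mxtrace2 D00 D11.
have d1E : \det B1 = l1 * l2 by rewrite -cj_det cjB1 det2 D00 D11 D01 mul0r subr0.
have t2E := mxtrace2 (cj B2); have d2E := det2 (cj B2).
have sE : \tr (B1 *m B2) = l1 * cj B2 0 0 + l2 * cj B2 1 1.
  by rewrite -cj_tr -cjM cjB1 mxtrace2 !mulmx2E D00 D01 D10 D11 !mul0r addr0 add0r.
have eqs X : X \in S -> [/\
    cj X 0 0 * cj X 0 0 + cj X 0 1 * cj X 1 0
      + l1 * (cj X 0 0 * cj B2 0 0 + cj X 0 1 * cj B2 1 0) + cj C 0 0 = 0,
    cj X 0 0 * cj X 0 1 + cj X 0 1 * cj X 1 1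
      + l1 * (cj X 0 0 * cj B2 0 1 + cj X 0 1 * cj B2 1 1) + cj C 0 1 = 0,
    cj X 1 0 * cj X 0 0 + cj X 1 1 * cj X 1 0
      + l2 * (cj X 1 0 * cj B2 0 0 + cj X 1 1 * cj B2 1 0) + cj C 1 0 = 0 &
    cj X 1 0 * cj X 0 1 + cj X 1 1 * cj X 1 1
      + l2 * (cj X 1 0 * cj B2 0 1 + cj X 1 1 * cj B2 1 1) + cj C 1 1 = 0].
  move=> XS; have : cj X *m cj X + Dg *m (cj X *m cj B2) + cj C = 0.
    rewrite -cjB1 !cjM !cjD mulmxA solS // /cj mulmx0 mul0mx; exact: erefl.
  move=> e; have ee i j := congr1 (fun M : 'M_2 => M i j) e.
  move: (ee 0 0) (ee 0 1) (ee 1 0) (ee 1 1).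
  have addE (M N : 'M[F]_2) i j : (M + N) i j = M i j + N i j by rewrite mxE.
  have zeroE i j : (0 : 'M[F]_2) i j = 0 by rewrite mxE.
  by rewrite !addE !mulmx2E D00 D01 D10 D11 !mul0r !addr0 !add0r !zeroE.
have trE X : cj X 0 0 + cj X 1 1 = \tr X by rewrite -cj_tr mxtrace2.
have nd X : X \in S -> 
    (('X + (l1 * (cj B2 0 0 + cj B2 1 1))%:P) * 'X +
      (l1 ^+ 2 * (cj B2 0 0 * cj B2 1 1 - cj B2 0 1 * cj B2 1 0))%:P).[\tr X] *
    (('X + (l2 * (cj B2 0 0 + cj B2 1 1))%:P) * 'X +
      (l2 ^+ 2 * (cj B2 0 0 * cj B2 1 1 - cj B2 0 1 * cj B2 1 0))%:P).[\tr X] != 0 /\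
    ('X + (l1 * cj B2 1 1)%:P).[\tr X] *
    (('X + (l2 * (cj B2 0 0 + cj B2 1 1))%:P) * 'X +
      (l2 ^+ 2 * (cj B2 0 0 * cj B2 1 1 - cj B2 0 1 * cj B2 1 0))%:P).[\tr X] +
    ('X + (l2 * cj B2 0 0)%:P).[\tr X] *
    (('X + (l1 * (cj B2 0 0 + cj B2 1 1))%:P) * 'X +
      (l1 ^+ 2 * (cj B2 0 0 * cj B2 1 1 - cj B2 0 1 * cj B2 1 0))%:P).[\tr X] != 0.
  move=> /ndS; rewrite sE t1E d1E -(cj_tr B2) -(cj_det B2) t2E d2E => -[h1 h2].
  split; [move: h1|move: h2]; rewrite !(hornerD, hornerM, hornerX, hornerC);
    congr (_ != 0); rewrite /resolvent_det /resolvent_trace; ring.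
have tr_inj X Y : X \in S -> Y \in S -> \tr X = \tr Y -> X = Y.
  move=> XS YS XY; have [x1 x2 x3 x4] := eqs X XS; have [y1 y2 y3 y4] := eqs Y YS.
  have hx := diagonal_entries x1 x2 x3 x4; have hy := diagonal_entries y1 y2 y3 y4.
  rewrite (trE X) in hx; rewrite (trE Y) -XY in hy; have [n1 n2] := nd X XS.
  have [|e1 e2 e3 e4] := trace_injective n1 n2 _ hx hy; first by rewrite !trE.
  have : cj X = cj Y.
    by apply/matrixP; apply: ord2P; apply: ord2P.
  move/(congr1 (fun M => invmx P *m M *m P)).
  by rewrite /cj -!mulmxA !mulVmx // !mulmx1 !mulKmx.
pose f := trace_poly l1 l2 (cj B2 0 0) (cj B2 0 1) (cj B2 1 0) (cj B2 1 1)
  (cj C 0 0) (cj C 0 1) (cj C 1 0) (cj C 1 1).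
have f9 : size f = 9%N by apply: size_trace_poly.
rewrite -ltnS -(size_map (@mxtrace F 2)) -f9.
apply: max_poly_roots; first by rewrite -size_poly_gt0 f9.
- apply/allP => _ /mapP[X XS ->]; have [x1 x2 x3 x4] := eqs X XS.
  have [n1 _] := nd X XS.
  by rewrite -(trE X); apply: (trace_poly_root x1 x2 x3 x4); rewrite (trE X).
- by rewrite map_inj_in_uniq.
Qed.

End SolutionBound.

(** An independent tuple is a zero of no nonzero polynomial, and one rational evaluation suffices to
    see that a polynomial is nonzero. *)
Lemma independent_eval_neq0 n (F : fieldType) (r : {rmorphism rat -> F}) (A : 'I_3 -> 'M[F]_n)
    (A0 : 'I_3 -> 'M[rat]_n) P :
  ~ alg_dependent r (mxenv A) -> mmap (@idfun rat) (mxenv A0) P != 0 ->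
  mmap r (mxenv A) P != 0.
Proof.
move=> indA P0; apply/eqP => PA; apply: indA; exists P => //.
by apply: contraNneq P0 => ->; rewrite mmap0.
Qed.

Lemma map_resolvent_det (R S : comNzRingType) (g : {rmorphism R -> S}) t1 d1 t2 d2 t :
  g (resolvent_det t1 d1 t2 d2 t) = resolvent_det (g t1) (g d1) (g t2) (g d2) (g t).
Proof.
by rewrite /resolvent_det !(rmorph_nat, rmorphXn, rmorphN, rmorphM, rmorphD).
Qed.

Lemma map_resolvent_trace (R S : comNzRingType) (g : {rmorphism R -> S}) t1 d1 t2 d2 s t :
  g (resolvent_trace t1 d1 t2 d2 s t) =
  resolvent_trace (g t1) (g d1) (g t2) (g d2) (g s) (g t).
Proof.
by rewrite /resolvent_trace !(rmorph_nat, rmorphXn, rmorphN, rmorphM, rmorphD).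
Qed.

Lemma generic_sol_bound (Kbar : closedFieldType) (iota : {rmorphism genericK 2 -> Kbar})
    (S : seq 'M[Kbar]_2) :
  uniq S -> (forall X, X \in S -> sol_over iota X) -> (size S <= 8)%N.
Proof.
move=> uS solS; pose V k := mxvars 2 rat (k : 'I_3).
pose g (A : 'I_3 -> 'M[Kbar]_2) := mmap (rat_base iota) (mxenv A).
pose g0 (A : 'I_3 -> 'M[rat]_2) := mmap (@idfun rat) (mxenv A).
have V0 A k : map_mx (g0 A) (V k) = A k by apply: mmap_mxvars.
have VA A k : map_mx (g A) (V k) = A k by apply: mmap_mxvars.
have two_neq0 : (16 : rat) != 0 by [].
apply: (@quadratic_sol_bound _ (map_mx iota (generic_mx 2 (inord 0)))
  (map_mx iota (generic_mx 2 (inord 1))) (map_mx iota (generic_mx 2 (inord 2)))) => //.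
  pose P := \tr (V (inord 0)) ^+ 2 - 4 * \det (V (inord 0)).
  pose A0 := triple (delta_mx 0 0 : 'M[rat]_2) 0 0.
  have := @independent_eval_neq0 2 _ (rat_base iota) _ A0 P (@generic_independent 2 _ iota _).
  have map_disc (R : comNzRingType) (h : {rmorphism {mpoly rat[nvars 2]} -> R}) :
      h P = h (\tr (V (inord 0))) ^+ 2 - 4 * h (\det (V (inord 0))).
    by rewrite /P rmorphB rmorphXn rmorphM rmorph_nat.
  rewrite !map_disc.
  rewrite -!trace_map_mx -!det_map_mx !VA !V0; apply.
  by rewrite /A0 /triple inordK //= mxtrace2 det2 !mxE.
move=> X XS; have indX := @solution_independent 2 _ iota (rat_base iota) X (solS X XS).
(* The test point B1 = B2 = 0, X = 1: the trace is 2, and the resolvents t^4 and 2 t^3 both equal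
   16. It need not satisfy any equation with C, as it is B1, B2 and X that are independent. *)
pose A0 : 'I_3 -> 'M[rat]_2 := triple 0 0 1%:M.
split.
- have := independent_eval_neq0 (A0 := A0) (P := resolvent_det (\tr (V (inord 0)))
    (\det (V (inord 0))) (\tr (V (inord 1))) (\det (V (inord 1))) (\tr (V (inord 2)))) indX.
  rewrite !map_resolvent_det -!trace_map_mx -!det_map_mx !VA !V0 /A0 /triple !inordK //=; apply.
  by rewrite !mxtrace0 !det0 mxtrace1 /resolvent_det.
- have := independent_eval_neq0 (A0 := A0) (P := resolvent_trace (\tr (V (inord 0)))
    (\det (V (inord 0))) (\tr (V (inord 1))) (\det (V (inord 1)))
    (\tr (V (inord 0) *m V (inord 1))) (\tr (V (inord 2)))) indX.
  rewrite !map_resolvent_trace -!trace_map_mx -!det_map_mx !map_mxM !VA !V0 /A0 /triple !inordK //=.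
  apply; by rewrite mul0mx !mxtrace0 !det0 mxtrace1 /resolvent_trace.
Qed.

(** * Conjugate pairs of solutions *)

Section PairConjugation.

Variables (n : nat) (Kbar : closedFieldType) (iota : {rmorphism genericK n -> Kbar}).
Local Notation K := (genericK n).
Local Notation gen := (generic_mx n).

(** The difference of the two equations is B1 (Y - X) B2 = X^2 - Y^2. Solving it with the adjugate
    keeps everything polynomial in B1, X, Y, at the cost of the factor [pairdet]. *)
Let pairdet (R : comNzRingType) (A : 'I_3 -> 'M[R]_n) :=
  \det (A (inord 0) *m (A (inord 2) - A (inord 1))).
Let pairB2 (R : comNzRingType) (A : 'I_3 -> 'M[R]_n) : 'M[R]_n :=
  - (\adj (A (inord 0) *m (A (inord 2) - A (inord 1))) *m
     (A (inord 2) *m A (inord 2) - A (inord 1) *m A (inord 1))).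
Let pairC (R : comNzRingType) (A : 'I_3 -> 'M[R]_n) : 'M[R]_n :=
  - (pairdet A *: (A (inord 1) *m A (inord 1)) + A (inord 0) *m A (inord 1) *m pairB2 A).

Let map_pairdet (R S : comNzRingType) (g : {rmorphism R -> S}) (A : 'I_3 -> 'M[R]_n) :
  g (pairdet A) = pairdet (fun k => map_mx g (A k)).
Proof. by rewrite /pairdet -map_mxB -map_mxM det_map_mx. Qed.

Let map_pairB2 (R S : comNzRingType) (g : {rmorphism R -> S}) (A : 'I_3 -> 'M[R]_n) :
  map_mx g (pairB2 A) = pairB2 (fun k => map_mx g (A k)).
Proof. by rewrite /pairB2 map_mxN map_mxM map_mx_adj map_mxM !map_mxB !map_mxM. Qed.

Let map_pairC (R S : comNzRingType) (g : {rmorphism R -> S}) (A : 'I_3 -> 'M[R]_n) :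
  map_mx g (pairC A) = pairC (fun k => map_mx g (A k)).
Proof.
by rewrite /pairC map_mxN map_mxD map_mxZ !map_mxM map_pairdet map_pairB2.
Qed.

(* B1, X, Y determine B2 and C, provided X - Y is invertible. *)
Lemma pair_coefficients (F : fieldType) (f : {rmorphism K -> F}) X Y :
  sol_over f X -> sol_over f Y -> let A := triple (map_mx f (gen (inord 0))) X Y in
  pairB2 A = pairdet A *: map_mx f (gen (inord 1)) /\
  pairC A = pairdet A *: map_mx f (gen (inord 2)).
Proof.
move=> solX solY A; set B1 := map_mx f (gen (inord 0)).
have [A0 A1 A2] : [/\ A (inord 0) = B1, A (inord 1) = X & A (inord 2) = Y].
  by rewrite /A /triple !inordK.
have B2E : pairB2 A = pairdet A *: map_mx f (gen (inord 1)).
  rewrite /pairB2 /pairdet A0 A1 A2.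
  have -> : Y *m Y - X *m X = - (B1 *m (Y - X) *m map_mx f (gen (inord 1))).
    apply/eqP; rewrite -addr_eq0 mulmxBr mulmxBl addrACA -opprD subr_eq0.
    by rewrite -(inj_eq (addIr (map_mx f (gen (inord 2))))) solX solY.
  by rewrite mulmxN opprK mulmxA mul_adj_mx mul_scalar_mx.
split=> //; rewrite /pairC B2E A0 A1 -scalemxAr -scalerDr -scalerN; congr (_ *: _).
by apply/eqP; rewrite eq_sym -addr_eq0 addrC; apply/eqP.
Qed.

Lemma pairdet_neq0 X Y : \det (X - Y) != 0 ->
  pairdet (triple (map_mx iota (gen (inord 0))) X Y) != 0.
Proof.
move=> XY; rewrite /pairdet /triple !inordK //= det_mulmx mulf_neq0 //; last first.
  by rewrite -opprB -scaleN1r detZ mulf_neq0 // expf_neq0 // oppr_eq0 oner_eq0.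
pose A0 : 'I_3 -> 'M[rat]_n := fun _ => 1%:M.
have := @independent_eval_neq0 n _ (rat_base iota) _ A0 (\det (mxvars n rat (inord 0)))
  (@generic_independent n _ iota _).
by rewrite -!det_map_mx !mmap_mxvars; apply; rewrite det1 oner_neq0.
Qed.

Lemma pair_independent X Y : sol_over iota X -> sol_over iota Y -> \det (X - Y) != 0 ->
  ~ alg_dependent (rat_base iota) (mxenv (triple (map_mx iota (gen (inord 0))) X Y)).
Proof.
move=> solX solY XY dep; apply: (@generic_independent n _ iota (rat_base iota)).
have [B2E CE] := pair_coefficients solX solY.
pose V k := mxvars n rat (k : 'I_3).
set A := triple _ _ _ in dep B2E CE.
have VA k : map_mx (mmap (rat_base iota) (mxenv A)) (V k) = A k by apply: mmap_mxvars.
have GE : mmap (rat_base iota) (mxenv A) (pairdet V) = pairdet A.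
  by rewrite map_pairdet /pairdet !VA.
apply: (alg_dependent_rational (G := pairdet V) (f := fun v =>
    mxenv (triple (pairdet V *: V (inord 0)) (pairB2 V) (pairC V)) v) _ _ dep).
  by rewrite GE pairdet_neq0.
have mapZ M : map_mx (mmap (rat_base iota) (mxenv A)) (pairdet V *: M) =
    pairdet A *: map_mx (mmap (rat_base iota) (mxenv A)) M.
  by rewrite map_mxZ; congr (_ *: _); apply: GE.
move=> v; rewrite GE (mxenv_map (mmap (rat_base iota) _)).
have -> : pairdet A * mxenv (fun k => map_mx iota (gen k)) v =
    mxenv (fun k => map_mx ( *%R (pairdet A)) (map_mx iota (gen k))) v.
  exact: (mxenv_map ( *%R (pairdet A))).
apply: eq_mxenv => k; rewrite (generic_triple iota k) (triple_map (map_mx ( *%R (pairdet A)))).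
rewrite (triple_map (map_mx (mmap (rat_base iota) (mxenv A)))) map_pairB2 map_pairC mapZ.
have ext (R : comNzRingType) (U W : 'I_3 -> 'M[R]_n) : U =1 W ->
    pairB2 U = pairB2 W /\ pairC U = pairC W.
  by move=> /funext->.
have [-> ->] := ext _ _ A VA; rewrite VA B2E CE.
have scE (M : 'M[Kbar]_n) : map_mx ( *%R (pairdet A)) M = pairdet A *: M.
  by apply/matrixP => i j; rewrite !mxE.
by rewrite !scE (_ : A (inord 0) = map_mx iota (gen (inord 0))) // /A /triple inordK.
Qed.

Definition mxpair (T : Type) (x y : T) (b : bool) := if b then x else y.

(** All such pairs are images of one universal pair. The three generic matrices are reread as B1, X,
    Y; [W] is the equation that they determine, and [h] embeds K into itself by sending the generic
    coefficients to [W]. Each pair of solutions gives g from K to [Kbar] with g h = iota. *)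
Lemma pair_conj X Y X' Y' :
  sol_over iota X -> sol_over iota Y -> \det (X - Y) != 0 ->
  sol_over iota X' -> sol_over iota Y' -> \det (X' - Y') != 0 ->
  conj_over iota iota (mxenv (mxpair X Y)) (mxenv (mxpair X' Y')).
Proof.
move=> solX solY XY solX' solY' XY'.
pose U : 'I_3 -> 'M[K]_n := gen; pose d := pairdet U.
pose W : 'I_3 -> 'M[K]_n := triple (gen (inord 0)) (d^-1 *: pairB2 U) (d^-1 *: pairC U).
have lift Z Z' : sol_over iota Z -> sol_over iota Z' -> \det (Z - Z') != 0 ->
    exists g : {rmorphism K -> Kbar}, [/\ map_mx g (gen (inord 1)) = Z,
      map_mx g (gen (inord 2)) = Z' & forall k, map_mx g (W k) = map_mx iota (gen k)].
  move=> solZ solZ' ZZ'; have indZ := pair_independent solZ solZ' ZZ'.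
  have [B2E CE] := pair_coefficients solZ solZ'.
  have [g gE] := generic_morph indZ; set A := triple _ _ _ in indZ gE B2E CE.
  have gU : (fun k => map_mx g (U k)) = A by apply/funext.
  have dE : g d = pairdet A by rewrite map_pairdet gU.
  have d0 : pairdet A != 0 by apply: pairdet_neq0.
  exists g; split; rewrite ?gE /A /triple ?inordK //.
  move=> k; rewrite (generic_triple iota k) /W (triple_map (map_mx g)) !map_mxZ.
  rewrite map_pairB2 map_pairC gU.
  rewrite fmorphV dE B2E CE !scalerA mulVf // !scale1r gE.
  by rewrite (_ : A (inord 0) = map_mx iota (gen (inord 0))) // /A /triple inordK.
have [g [g1 g2 gW]] := lift X Y solX solY XY.
have [g' [g'1 g'2 g'W]] := lift X' Y' solX' solY' XY'.
have [|h hE] := @generic_morph n _ (rat_base idfun) W.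
  move=> /(alg_dependent_morph g) dep; apply: (@generic_independent n _ iota (rat_base iota)).
  apply: alg_dependent_ext dep; first exact: rat_morph_unique.
  by move=> v; rewrite (mxenv_map g); apply: eq_mxenv.
have conj_gen (t : {rmorphism K -> Kbar}) Z Z' : map_mx t (gen (inord 1)) = Z ->
    map_mx t (gen (inord 2)) = Z' -> (forall k, map_mx t (W k) = map_mx iota (gen k)) ->
    conj_over h iota (mxenv (mxpair (gen (inord 1)) (gen (inord 2)))) (mxenv (mxpair Z Z')).
  move=> t1 t2 tW; have th : forall a, t (h a) = iota a.
    apply: (generic_morph_eq (f := t \o h)) => k.
    by rewrite map_mx_comp hE tW.
  apply: eq_conj_over (frefl _) _ (conj_over_morph _ th) => v.
  by rewrite (mxenv_map t); apply: eq_mxenv; case.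
exact: conj_over_trans (conj_over_sym (conj_gen _ _ _ g1 g2 gW)) (conj_gen _ _ _ g'1 g'2 g'W).
Qed.

End PairConjugation.

(** * Lifting a double solution *)

Section SeriesSign.

Variable k : fieldType.
Local Notation E := (series k).

Definition ssign (a : E) : E := Series (fun i => (-1) ^+ i * scoef a i).
Fact ssign_zmod : zmod_morphism ssign.
Proof. by move=> a b; apply: seriesP => i /=; rewrite mulrBr. Qed.
Fact ssign_monoid : monoid_morphism ssign.
Proof.
split=> [|a b]; apply: seriesP => i /=.
  by rewrite coef1; case: i => [|i]; rewrite ?expr0 ?mul1r // mulr0.
rewrite mulr_sumr; apply: eq_bigr => j _.
have -> : (-1) ^+ i = (-1) ^+ j * (-1) ^+ (i - j) :> k.
  by rewrite -exprD subnKC // -ltnS.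
by rewrite mulrACA.
Qed.
HB.instance Definition _ := GRing.isZmodMorphism.Build _ _ ssign ssign_zmod.
HB.instance Definition _ := GRing.isMonoidMorphism.Build _ _ ssign ssign_monoid.

Lemma ssignK : involutive ssign.
Proof. by move=> a; apply: seriesP => i /=; rewrite mulrA -exprMn mulrNN mul1r expr1n mul1r. Qed.

Lemma ssign_const c : ssign (sconst c) = sconst c.
Proof.
apply: seriesP => i /=; rewrite coefC.
by case: i => [|i]; rewrite ?expr0 ?mul1r // mulr0.
Qed.

Lemma ssign_var : ssign svar = - svar.
Proof.
apply: seriesP => i /=; rewrite coefX.
by case: i => [|[|i]]; rewrite ?expr1 ?mulr1 ?mulr0 ?oppr0.
Qed.

Lemma sresidue_sign a : sresidue (ssign a) = sresidue a.
Proof. by rewrite /sresidue /= expr0 mul1r. Qed.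

End SeriesSign.

Arguments ssign {k} a : simpl never.

Section SeriesClose.

Variables (k : fieldType) (n : nat).
Local Notation E := (series k).
Implicit Types X Y : 'M[E]_n.

Lemma series_close_refl i X : series_close i X X.
Proof. by exists 0; rewrite scaler0 addr0. Qed.

Lemma series_closeD i X X' Y Y' :
  series_close i X Y -> series_close i X' Y' -> series_close i (X + X') (Y + Y').
Proof. by move=> [Z ->] [Z' ->]; exists (Z + Z'); rewrite scalerDr addrACA. Qed.

Lemma series_closeZ i X Y a : series_close i X Y -> series_close i (a *: X) (a *: Y).
Proof.
by move=> [Z ->]; exists (a *: Z); rewrite scalerDr !scalerA [a * _]mulrC.
Qed.

Lemma series_closeM i X X' Y Y' :
  series_close i X Y -> series_close i X' Y' -> series_close i (X *m X') (Y *m Y').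
Proof.
move=> [Z ->] [Z' ->]; exists (Y *m Z' + Z *m Y' + svar ^+ i *: (Z *m Z')).
rewrite mulmxDl !mulmxDr !(scalerDr) -!(scalemxAl, scalemxAr) !addrA.
by [].
Qed.

End SeriesClose.

Section MatrixTwo.

Definition mx2 (R : Type) (a b c d : R) : 'M[R]_2 :=
  \matrix_(i, j) if i == 0 then if j == 0 then a else b else if j == 0 then c else d.

Lemma eq_mx2 (R : Type) (A B : 'M[R]_2) :
  [/\ A 0 0 = B 0 0, A 0 1 = B 0 1, A 1 0 = B 1 0 & A 1 1 = B 1 1] -> A = B.
Proof. by case=> *; apply/matrixP; apply: ord2P; apply: ord2P. Qed.

Lemma mx2_eta (R : Type) (A : 'M[R]_2) : A = mx2 (A 0 0) (A 0 1) (A 1 0) (A 1 1).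
Proof. by apply: eq_mx2; rewrite !mxE. Qed.

Lemma map_mx2 (R S : Type) (f : R -> S) a b c d :
  map_mx f (mx2 a b c d) = mx2 (f a) (f b) (f c) (f d).
Proof. by apply: eq_mx2; rewrite !mxE. Qed.

Lemma mx2M (R : pzSemiRingType) (a b c d a' b' c' d' : R) :
  mx2 a b c d *m mx2 a' b' c' d' =
  mx2 (a * a' + b * c') (a * b' + b * d') (c * a' + d * c') (c * b' + d * d').
Proof. by apply: eq_mx2; rewrite !mulmx2E !mxE. Qed.

Lemma mx2D (R : pzSemiRingType) (a b c d a' b' c' d' : R) :
  mx2 a b c d + mx2 a' b' c' d' = mx2 (a + a') (b + b') (c + c') (d + d').
Proof. by apply: eq_mx2; rewrite !mxE. Qed.

Lemma mx2Z (R : pzSemiRingType) (e a b c d : R) :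
  e *: mx2 a b c d = mx2 (e * a) (e * b) (e * c) (e * d).
Proof. by apply: eq_mx2; rewrite !mxE. Qed.

Lemma mx2N (R : pzRingType) (a b c d : R) : - mx2 a b c d = mx2 (- a) (- b) (- c) (- d).
Proof. by apply: eq_mx2; rewrite !mxE. Qed.

Lemma mx2_inj (R : Type) (a b c d a' b' c' d' : R) :
  mx2 a b c d = mx2 a' b' c' d' -> [/\ a = a', b = b', c = c' & d = d'].
Proof.
move=> e; have ee i j := congr1 (fun M : 'M_2 => M i j) e.
by have := (ee 0 0, ee 0 1, ee 1 0, ee 1 1); rewrite !mxE /= => -[[[-> ->] ->] ->].
Qed.

Lemma mx2_0 (R : pzSemiRingType) : 0 = mx2 0 0 0 0 :> 'M[R]_2.
Proof. by apply: eq_mx2; rewrite !mxE. Qed.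

End MatrixTwo.

Section Fold.

Variable k : fieldType.
Hypothesis char0 : has_pchar0 k.
Local Notation E := (series k).
Local Notation eta := (@svar k).

(* With the coefficients fold_b1, fold_b2, fold_c the equation has the double
   solution fold_x and six simple ones; adding - eta^2 to fold_c separates the
   double one into fold_x + eta fold_z and fold_x - eta fold_z up to O(eta^2). *)
Definition fold_b1 (R : pzSemiRingType) : 'M[R]_2 := mx2 0 8 4 0.
Definition fold_b2 (R : pzSemiRingType) : 'M[R]_2 := mx2 0 1 2 0.
Definition fold_c (R : pzRingType) : 'M[R]_2 := mx2 (- 96) 0 0 (- 36).
Definition fold_x (R : pzSemiRingType) : 'M[R]_2 := mx2 8 0 0 2.
Definition fold_z (R : pzRingType) : 'M[R]_2 := mx2 1 0 0 (- 1).

Variables (D1 D2 D3 : 'M[E]_2).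
Let B1 := fold_b1 E + eta ^+ 4 *: D1.
Let B2 := fold_b2 E + eta ^+ 4 *: D2.
Let C := fold_c E - (eta ^+ 2)%:M + eta ^+ 4 *: D3.

Let T (V : 'M[E]_2) := quadratic_diff (fold_x E) (fold_b1 E) (fold_b2 E) V
  + eta *: (fold_z E *m V + V *m fold_z E).

(* The determinant of T is eta times a unit, so eta T^-1 is integral. *)
Let fold_inverse : exists M : 'M[E]_2 -> 'M[E]_2,
  (forall a Y Z, M (Y + a *: Z) = M Y + a *: M Z) /\ (forall Y, T (M Y) = eta *: Y).
Proof.
have nat_neq0 m : (0 < m)%N -> (m%:R : k) != 0 by move=> m0; rewrite (pcharf0P _).1 // -lt0n.
(* Cramer's rule: [T] has determinant - eta (24 + 4 eta) on the diagonal entries, and on the other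
   two it is the matrix with rows (10, 8) and (8, 10), of determinant 36. *)
have [w ww] : exists w, (- (24 + 4 * eta)) * w = 1.
  apply: series_unit_residue; rewrite rmorphN rmorphD rmorphM /= sresidue_var mulr0 addr0.
  by rewrite rmorph_nat oppr_eq0 nat_neq0.
have [c cc] : exists c : E, 36 * c = 1.
  by apply: series_unit_residue; rewrite rmorph_nat nat_neq0.
exists (fun Y => mx2 (w * ((4 - 2 * eta) * Y 0 0 - 16 * Y 1 1))
  (eta * c * (10 * Y 0 1 - 8 * Y 1 0)) (eta * c * (10 * Y 1 0 - 8 * Y 0 1))
  (w * (- (4 * Y 0 0) + (16 + 2 * eta) * Y 1 1))); split=> [a Y Z|Y].
  by rewrite mx2Z mx2D !mxE; congr mx2; ring.
rewrite /T /quadratic_diff /fold_x /fold_b1 /fold_b2 /fold_z !(mx2M, mx2D, mx2Z).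
rewrite [in RHS](mx2_eta Y) mx2Z; congr mx2.
- transitivity ((- (24 + 4 * eta) * w) * (eta * Y 0 0)); [ring | by rewrite ww mul1r].
- transitivity ((36 * c) * (eta * Y 0 1)); [ring | by rewrite cc mul1r].
- transitivity ((36 * c) * (eta * Y 1 0)); [ring | by rewrite cc mul1r].
- transitivity ((- (24 + 4 * eta) * w) * (eta * Y 1 1)); [ring | by rewrite ww mul1r].
Qed.

(** [fold_z] spans the kernel of the derivative at [fold_x], and its square is 1, which the term -
    eta^2 cancels. What is left of the equation is eta^2 (T V + eta^2 N V) = 0, and V = - eta M (N
    V) solves it by contraction. *)
Lemma fold_solution : exists V : 'M[E]_2,
  let X := fold_x E + eta *: fold_z E + eta ^+ 2 *: V in
  X *m X + B1 *m X *m B2 + C = 0.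
Proof.
have [M [linM TM]] := fold_inverse.
pose X V := fold_x E + eta *: fold_z E + eta ^+ 2 *: V.
pose N V := V *m V + D3 + (D1 *m X V *m fold_b2 E + fold_b1 E *m X V *m D2
  + eta ^+ 4 *: (D1 *m X V *m D2)).
have [|[V fV] _] := @contraction_fixpoint k 2 (fun V => - (eta *: M (N V))).
  move=> i V V' VV'.
  have XX : series_close i (X V) (X V').
    by apply: series_closeD; [apply: series_close_refl | apply: series_closeZ].
  have [Z NN] : series_close i (N V) (N V').
    do !(apply: series_closeD || apply: series_closeM || apply: series_closeZ
      || exact: series_close_refl || exact: XX || exact: VV').
  exists (- M Z); rewrite NN linM scalerDr opprD scalerA scalerN.
  by rewrite exprS.
have TZ a Y : T (a *: Y) = a *: T Y.
  by rewrite /T /quadratic_diff -!(scalemxAl, scalemxAr) !scalerDr !scalerA [eta * a]mulrC.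
have TV : T V + eta ^+ 2 *: N V = 0.
  by rewrite -{1}fV -scaleNr TZ TM scalerA mulNr -expr2 scaleNr addNr.
exists V => /=; rewrite -/(X V) -[RHS](scaler0 _ (eta ^+ 2)) -TV.
rewrite /N /X /B1 /B2 /C /T /quadratic_diff /fold_x /fold_b1 /fold_b2 /fold_c /fold_z.
rewrite (mx2_eta V) (mx2_eta D1) (mx2_eta D2) (mx2_eta D3).
have -> : (eta ^+ 2)%:M = mx2 (eta ^+ 2) 0 0 (eta ^+ 2).
  by apply: eq_mx2; rewrite !mxE /= !mulr1n !mulr0n.
rewrite !(mx2M, mx2D, mx2Z, mx2N); congr mx2; ring.
Qed.

End Fold.

Lemma map_fold (R S : nzRingType) (g : {rmorphism R -> S}) :
  [/\ map_mx g (fold_b1 R) = fold_b1 S, map_mx g (fold_b2 R) = fold_b2 S,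
      map_mx g (fold_c R) = fold_c S & map_mx g (fold_x R) = fold_x S].
Proof.
by split; rewrite map_mx2 ?rmorphN ?rmorph0 ?rmorph1 ?rmorph_nat ?rmorphN ?rmorph_nat.
Qed.

Lemma det_mx2 (R : comNzRingType) (a b c d : R) : \det (mx2 a b c d) = a * d - b * c.
Proof. by rewrite det2 !mxE. Qed.

(** * The six simple solutions of the special equation *)

Section SimpleSolutions.

Variable k : fieldType.
Hypothesis char0 : has_pchar0 k.
Variables y z : k.
Hypotheses (y2 : y ^+ 2 = 17%:R) (z2 : z ^+ 2 = 63%:R).

(** For X = [mx2 x p q v] the off-diagonal equations force p = q = 0 or (x + v)^2 = 64. In the
    diagonal case the parabolas x^2 + 16 v = 96 and v^2 + 4 x = 36 are tangent at (8, 2), which is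
    [fold_x], and meet again at (0, 6) and (-16, -10). Trace 8 gives q = - p, x = 1, p^2 = 17; trace
    -8 gives q = p, x = -7, p^2 = 63. *)
Definition simple_seq : seq 'M[k]_2 :=
  [:: mx2 0 0 0 6; mx2 (- 16) 0 0 (- 10); mx2 1 y (- y) 7; mx2 1 (- y) y 7;
      mx2 (- 7) z z (- 1); mx2 (- 7) (- z) (- z) (- 1)].

Let nat_neq0 m : (0 < m)%N -> (m%:R : k) != 0.
Proof. by move=> m0; rewrite (pcharf0P _).1 // -lt0n. Qed.

Let nat_mul0 m (a : k) : (0 < m)%N -> m%:R * a = 0 -> a = 0.
Proof. by move=> m0 /eqP; rewrite mulf_eq0 (negPf (nat_neq0 m0)) => /eqP. Qed.

Let nat_cancel m (a b : k) : (0 < m)%N -> a = b -> a - b <> m%:R.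
Proof. by move=> m0 -> e; have := nat_neq0 m0; rewrite -e subrr eqxx. Qed.

Let y0 : y != 0. Proof. by rewrite -sqrf_eq0 y2 nat_neq0. Qed.
Let z0 : z != 0. Proof. by rewrite -sqrf_eq0 z2 nat_neq0. Qed.

Let double_neq (a : k) : a != 0 -> a <> - a.
Proof.
move=> a0 /eqP; rewrite -subr_eq0 opprK -mulr2n -mulr_natl mulf_eq0.
by rewrite (negPf a0) orbF (negPf (nat_neq0 _)).
Qed.

Lemma simple_uniq : uniq simple_seq.
Proof.
rewrite /simple_seq /= !inE !negb_or !andbT.
repeat match goal with |- is_true (_ && _) => apply/andP; split end;
  apply/eqP; move=> h; case: (mx2_inj h) => [e1 e2 e3 e4];
  move: (double_neq y0) (double_neq z0) => hy hz //.
all: try by [case: hy|case: hz].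
all: try (apply: (nat_cancel _ e1 (m := 16)); [done|ring]).
all: try (apply: (nat_cancel _ (esym e1) (m := 1)); [done|ring]).
all: try (apply: (nat_cancel _ e1 (m := 7)); [done|ring]).
all: try (apply: (nat_cancel _ (esym e1) (m := 17)); [done|ring]).
all: try (apply: (nat_cancel _ (esym e1) (m := 9)); [done|ring]).
all: try (apply: (nat_cancel _ e1 (m := 8)); [done|ring]).
Qed.

Lemma simple_solution x : x \in simple_seq ->
  x *m x + fold_b1 k *m x *m fold_b2 k + fold_c k = 0.
Proof.
move=> xS; rewrite mx2_0 /fold_b1 /fold_b2 /fold_c.
move: xS; rewrite !inE => /or4P[/eqP->|/eqP->|/eqP->|/or3P[/eqP->|/eqP->|/eqP->]];
  rewrite !(mx2M, mx2D); congr mx2; try ring.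
all: (transitivity (17%:R - y ^+ 2); [ring | by rewrite y2 subrr]) ||
     (transitivity (z ^+ 2 - 63%:R); [ring | by rewrite z2 subrr]).
Qed.

(** A vanishing certificate: m t is a combination of the four entries of the linearised equation and
    of a relation [u], so that only a [ring] identity remains. *)
Let lin m (t p q r s u p' q' r' s' u' : k) : (0 < m)%N ->
  p = 0 -> q = 0 -> r = 0 -> s = 0 -> u = 0 ->
  p' * p + q' * q + r' * r + s' * s + u' * u = m%:R * t -> t = 0.
Proof. by move=> m0 -> -> -> -> ->; rewrite !mulr0 !addr0 => /esym/(nat_mul0 m0). Qed.

(** At a diagonal matrix the derivative splits into a diagonal block of determinant 4 x v - 64 and
    an off-diagonal one of determinant (x + v)^2 - 64. The sign alternatives keep m and m' natural
    numbers. *)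
Let injective_diag m m' (x v a b c d : k) : (0 < m)%N -> (0 < m')%N ->
  4 * x * v - 64 = m%:R \/ 4 * x * v - 64 = - m%:R ->
  64 - (x + v) ^+ 2 = m'%:R \/ 64 - (x + v) ^+ 2 = - m'%:R ->
  quadratic_diff (mx2 x 0 0 v) (fold_b1 k) (fold_b2 k) (mx2 a b c d) = 0 -> mx2 a b c d = 0.
Proof.
rewrite mx2_0 /quadratic_diff !(mx2M, mx2D).
move=> m0 m'0 hm hm' h; case: (mx2_inj h) => [e1 e2 e3 e4].
have [[i im] [i' im']] : (exists i, i * (4 * x * v - 64) = m%:R) /\
    exists i, i * (64 - (x + v) ^+ 2) = m'%:R.
  by split; [case: hm | case: hm'] => ->; [exists 1|exists (-1)|exists 1|exists (-1)]; ring.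
congr mx2.
- apply: (lin m0 e1 e2 e3 e4 (erefl 0)
      (p' := i * (2 * v)) (q' := 0) (r' := 0) (s' := - 16 * i) (u' := 0)); rewrite -im; ring.
- apply: (lin m'0 e1 e2 e3 e4 (erefl 0)
      (p' := 0) (q' := - i' * (x + v)) (r' := i' * 8) (s' := 0) (u' := 0)); rewrite -im'; ring.
- apply: (lin m'0 e1 e2 e3 e4 (erefl 0)
      (p' := 0) (q' := i' * 8) (r' := - i' * (x + v)) (s' := 0) (u' := 0)); rewrite -im'; ring.
- apply: (lin m0 e1 e2 e3 e4 (erefl 0)
      (p' := - 4 * i) (q' := 0) (r' := 0) (s' := i * (2 * x)) (u' := 0)); rewrite -im; ring.
Qed.

Let injective_y (s a b c d : k) : s ^+ 2 = 17 ->
  quadratic_diff (mx2 1 s (- s) 7) (fold_b1 k) (fold_b2 k) (mx2 a b c d) = 0 -> mx2 a b c d = 0.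
Proof.
move/eqP; rewrite mx2_0 /quadratic_diff !(mx2M, mx2D) -subr_eq0 => /eqP u h.
case: (mx2_inj h) => [e1 e2 e3 e4].
have a0 : a = 0.
  apply: (lin (m := 68) _ e1 e2 e3 e4 u
      (p' := - 17) (q' := s) (r' := - s) (s' := 17) (u' := - 2 * (a + d))) => //; ring.
have d0 : d = 0.
  apply: (lin (m := 68) _ e1 e2 e3 e4 u
      (p' := 17) (q' := s) (r' := - s) (s' := - 17) (u' := - 2 * (a + d))) => //; ring.
rewrite {}a0 {}d0 in e1 e2 e3 e4 *; congr mx2.
- apply: (lin (m := 272) _ e1 e2 e3 e4 u
      (p' := - 8 * s) (q' := 17) (r' := 0) (s' := 0) (u' := 8 * (c - b))) => //; ring.
- apply: (lin (m := 272) _ e1 e2 e3 e4 u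
      (p' := 8 * s) (q' := 17) (r' := 0) (s' := 0) (u' := - 8 * (c - b))) => //; ring.
Qed.

Let injective_z (s a b c d : k) : s ^+ 2 = 63 ->
  quadratic_diff (mx2 (- 7) s s (- 1)) (fold_b1 k) (fold_b2 k) (mx2 a b c d) = 0 -> mx2 a b c d = 0.
Proof.
move/eqP; rewrite mx2_0 /quadratic_diff !(mx2M, mx2D) -subr_eq0 => /eqP u h.
case: (mx2_inj h) => [e1 e2 e3 e4].
have a0 : a = 0.
  apply: (lin (m := 252) _ e1 e2 e3 e4 u
      (p' := - 7) (q' := s) (r' := s) (s' := 7) (u' := - 2 * (a + d))) => //; ring.
have d0 : d = 0.
  apply: (lin (m := 252) _ e1 e2 e3 e4 u
      (p' := 7) (q' := s) (r' := s) (s' := - 7) (u' := - 2 * (a + d))) => //; ring.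
rewrite {}a0 {}d0 in e1 e2 e3 e4 *; congr mx2.
- apply: (lin (m := 1008) _ e1 e2 e3 e4 u
      (p' := 8 * s) (q' := - 63) (r' := 0) (s' := 0) (u' := - 8 * (b + c))) => //; ring.
- apply: (lin (m := 1008) _ e1 e2 e3 e4 u
      (p' := 8 * s) (q' := 63) (r' := 0) (s' := 0) (u' := - 8 * (b + c))) => //; ring.
Qed.

Lemma simple_injective x : x \in simple_seq ->
  forall H, quadratic_diff x (fold_b1 k) (fold_b2 k) H = 0 -> H = 0.
Proof.
move=> xS H; rewrite (mx2_eta H).
move: xS; rewrite !inE => /or4P[/eqP->|/eqP->|/eqP->|/or3P[/eqP->|/eqP->|/eqP->]].
- by apply: (@injective_diag 64 28) => //; [right|left]; ring.
- by apply: (@injective_diag 576 612) => //; [left|right]; ring.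
- exact: injective_y.
- by rewrite -{2}[y]opprK; apply: injective_y; rewrite sqrrN.
- exact: injective_z.
- by apply: injective_z; rewrite sqrrN.
Qed.

(** [pair_conj] needs invertible differences with the split solution, and a determinant with nonzero
    residue is nonzero. *)
Lemma simple_det x : x \in simple_seq -> \det (fold_x k - x) != 0.
Proof.
move=> xS; have det_nat m e : (0 < m)%N -> e = - m%:R -> e != 0 :> k.
  by move=> m0 ->; rewrite oppr_eq0 nat_neq0.
move: xS; rewrite !inE => /or4P[/eqP->|/eqP->|/eqP->|/or3P[/eqP->|/eqP->|/eqP->]];
  rewrite /fold_x mx2N mx2D det_mx2.
- by apply: (det_nat 32%N) => //; ring.
- by rewrite (_ : _ - _ = 288%:R) ?nat_neq0 //; ring.
- by apply: (det_nat 18%N) => //; transitivity (y ^+ 2 - 35%:R); [ring | rewrite y2; ring].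
- by apply: (det_nat 18%N) => //; transitivity (y ^+ 2 - 35%:R); [ring | rewrite y2; ring].
- by apply: (det_nat 18%N) => //; transitivity (45%:R - z ^+ 2); [ring | rewrite z2; ring].
- by apply: (det_nat 18%N) => //; transitivity (45%:R - z ^+ 2); [ring | rewrite z2; ring].
Qed.

End SimpleSolutions.

Lemma quadratic_fixed (R : comNzRingType) (g : {rmorphism R -> R}) n (X B1 B2 C : 'M[R]_n) :
  map_mx g B1 = B1 -> map_mx g B2 = B2 -> map_mx g C = C ->
  X *m X + B1 *m X *m B2 + C = 0 ->
  map_mx g X *m map_mx g X + B1 *m map_mx g X *m B2 + C = 0.
Proof.
by move=> e1 e2 e3 /(congr1 (map_mx g)); rewrite map_mx_quadratic map_mx0 e1 e2 e3.
Qed.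

Section FoldConfiguration.

Variable k : closedFieldType.
Hypothesis char0 : has_pchar0 k.
Local Notation E := (series k).
Local Notation eta := (@svar k).

Lemma residue_shift n (M N : 'M[E]_n) : map_mx sresidue (M + eta *: N) = map_mx sresidue M.
Proof. by apply/matrixP => i j; rewrite !mxE rmorphD rmorphM /= sresidue_var mul0r addr0. Qed.

Lemma residue_sign n (M : 'M[E]_n) : map_mx sresidue (map_mx ssign M) = map_mx sresidue M.
Proof. by apply/matrixP => i j; rewrite !mxE sresidue_sign. Qed.

Lemma sign_shift n (M N : 'M[E]_n) :
  map_mx ssign (M + eta *: N) = map_mx ssign M - eta *: map_mx ssign N.
Proof. by apply/matrixP => i j; rewrite !mxE rmorphD rmorphM /= ssign_var mulNr. Qed.

Section Coefficients.

Variables B1 B2 C X0 W : 'M[E]_2.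
Hypotheses (rB1 : map_mx sresidue B1 = fold_b1 k) (rB2 : map_mx sresidue B2 = fold_b2 k).
Hypothesis rC : map_mx sresidue C = fold_c k.
Hypotheses (sB1 : map_mx ssign B1 = B1) (sB2 : map_mx ssign B2 = B2) (sC : map_mx ssign C = C).
Let F X := X *m X + B1 *m X *m B2 + C.
Hypotheses (X0E : X0 = fold_x E + eta *: W) (rW : map_mx sresidue W = fold_z k).
Hypothesis FX0 : F X0 = 0.

(** The eight solutions are [X0], its image under [ssign], and the Hensel lifts of the six simple
    solutions. *)
Lemma fold_configuration : exists X : 'I_(2 + 6) -> 'M[E]_2,
  [/\ forall i, X i *m X i + B1 *m X i *m B2 + C = 0, injective X,
      forall i, map_mx ssign (X i) = X (tperm (lshift 6 0) (lshift 6 1) i)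
    & forall i, i != lshift 6 0 -> \det (X (lshift 6 0) - X i) != 0].
Proof.
have sqrt_ex m : exists s : k, s ^+ 2 = m%:R.
  have [s sE] := @solve_monicpoly k 2 (fun i => if i == 0%N then m%:R else 0) isT.
  by exists s; rewrite sE !big_ord_recl big_ord0 /= expr0 mulr1 mul0r !addr0.
have [[y y2] [z z2]] := (sqrt_ex 17%N, sqrt_ex 63%N).
have [S SE] : exists S, S = simple_seq y z by exists (simple_seq y z).
pose x (i : 'I_6) := S`_i.
have xS i : x i \in simple_seq y z by rewrite /x SE mem_nth.
have x_inj : injective x.
  by move=> i j /eqP; rewrite /x SE nth_uniq ?simple_uniq // => /eqP/val_inj.
have henselP i := @hensel_quadratic k 2 B1 B2 C (x i).
have sol_x i : x i *m x i + map_mx sresidue B1 *m x i *m map_mx sresidue B2 + map_mx sresidue C = 0.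
  by rewrite rB1 rB2 rC; apply: simple_solution (xS i).
have inj_x i H : quadratic_diff (x i) (map_mx sresidue B1) (map_mx sresidue B2) H = 0 -> H = 0.
  by rewrite rB1 rB2; apply: (simple_injective char0 y2 z2 (xS i)).
have /choice[Y YE] i : exists Y, F Y = 0 /\ map_mx sresidue Y = x i.
  by have [[Y FY rY] _] := henselP i (sol_x i) (@inj_x i); exists Y.
(* Hensel uniqueness: the image under [ssign] solves the same equation and has the same residue. *)
have sY i : map_mx ssign (Y i) = Y i.
  have [FY rY] := YE i; have [_ uniqY] := henselP i (sol_x i) (@inj_x i).
  apply: (uniqY _ _ (quadratic_fixed sB1 sB2 sC FY) FY _ rY).
  by rewrite residue_sign.
have [X1 X1E] : exists X1, X1 = map_mx ssign X0 by eexists.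
pose X (i : 'I_(2 + 6)) : 'M[E]_2 :=
  match split i with inl b => if b == 0 then X0 else X1 | inr l => Y l end.
have XL b : X (lshift 6 b) = if b == 0 then X0 else X1.
  by rewrite /X -[lshift _ _]/(unsplit (inl b)) unsplitK.
have XR l : X (rshift 2 l) = Y l by rewrite /X -[rshift _ _]/(unsplit (inr l)) unsplitK.
have [_ _ _ fxE] := map_fold (@sresidue k); have [_ _ _ sxE] := map_fold (@ssign k).
have r0 : map_mx sresidue X0 = fold_x k by rewrite X0E residue_shift.
have rdet (M : 'M[E]_2) : \det (map_mx sresidue M) != 0 -> \det M != 0.
  by rewrite det_map_mx; apply: contraNneq => ->; rewrite rmorph0.
(* Both residues are [fold_x], so eta is factored out first: (X0 - X1) / eta has residue 2 [fold_z],
   of determinant - 4. *)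
have d01 : \det (X0 - X1) != 0.
  have -> : X0 - X1 = eta *: (W + map_mx ssign W).
    rewrite X1E X0E sign_shift sxE opprD opprK addrACA subrr add0r.
    exact: esym (scalerDr _ _ _).
  rewrite detZ mulf_neq0 ?expf_neq0 ?svar_neq0 //; apply: rdet.
  rewrite map_mxD residue_sign rW mx2D det_mx2.
  by rewrite (_ : _ - _ = - 4%:R) ?oppr_eq0 ?(pcharf0P _).1 //; ring.
have dY (M : 'M[E]_2) l : map_mx sresidue M = fold_x k -> \det (M - Y l) != 0.
  move=> rM; apply: rdet; rewrite map_mxB rM (YE l).2; exact: (simple_det char0 y2 z2 (xS l)).
have r1 : map_mx sresidue X1 = fold_x k by rewrite X1E residue_sign.
have det_neq (M N : 'M[E]_2) : \det (M - N) != 0 -> M <> N.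
  by move=> + MN; rewrite MN subrr det0 eqxx.
have FX1 : F X1 = 0 by rewrite X1E; exact: (quadratic_fixed sB1 sB2 sC FX0).
exists X; split.
- move=> i; case: (split_ordP i) => l ->; last by rewrite XR; exact: (YE l).1.
  by rewrite XL; case: ifP => _; [exact: FX0 | exact: FX1].
- move=> i j; case: (split_ordP i) => b ->; case: (split_ordP j) => c ->; rewrite ?(XL, XR).
  + elim/ord2P: b; elim/ord2P: c => //= e; first by case: (det_neq _ _ d01).
    by case: (det_neq _ _ d01).
  + by case: ifP => _ e; case: (det_neq _ _ _ e); apply: dY.
  + by case: ifP => _ /esym e; case: (det_neq _ _ _ e); apply: dY.
  + move=> e; congr rshift; apply: x_inj; by rewrite -(YE b).2 -(YE c).2 e.
- move=> i; case: (split_ordP i) => b ->.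
    elim/ord2P: b; first by rewrite tpermL !XL.
    by rewrite tpermR !XL /= X1E; apply/matrixP => r c; rewrite !mxE ssignK.
  by rewrite tpermD ?XR.
- have XL0 : X (lshift 6 0) = X0 by rewrite XL.
  have XL1 : X (lshift 6 1) = X1 by rewrite XL.
  move=> i; rewrite XL0; case: (split_ordP i) => b ->; last by rewrite XR => _; apply: dY.
  elim/ord2P: b; first by case/eqP.
  by move=> _; rewrite XL1; exact: d01.
Qed.

End Coefficients.

End FoldConfiguration.

Lemma sign_var_even (k : fieldType) n (M : 'M[series k]_n) (N : 'M[k]_n) d :
  map_mx ssign (M + svar ^+ d.*2 *: map_mx sconst N) =
  map_mx ssign M + svar ^+ d.*2 *: map_mx sconst N.
Proof.
apply/matrixP => i j; rewrite !mxE rmorphD rmorphM rmorphXn /= ssign_var ssign_const.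
by rewrite -mul2n !exprM sqrrN.
Qed.

Lemma fold_family (Kbar : closedFieldType) (iota : {rmorphism genericK 2 -> Kbar}) :
  exists (F : fieldType) (f : {rmorphism genericK 2 -> F}) (s : {rmorphism F -> F})
    (T : 'I_(2 + 6) -> 'M[F]_2),
  [/\ forall a, s (f a) = f a, forall i, sol_over f (T i), injective T,
      forall i, map_mx s (T i) = T (tperm (lshift 6 0) (lshift 6 1) i)
    & forall i, i != lshift 6 0 -> \det (T (lshift 6 0) - T i) != 0].
Proof.
have char0 : has_pchar0 Kbar by move=> p; rewrite (fmorph_pchar iota) generic_char0.
pose P : nzRingType := {poly Kbar}; pose E := series Kbar; pose eta : E := svar.
pose x : 'I_3 -> 'M[P]_2 := triple (fold_b1 P) (fold_b2 P) (fold_c P - ('X^2)%:M).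
pose q : 'I_3 -> 'M[rat]_2 := triple (fold_b1 _) (fold_b2 _) (fold_c _ - 1%:M).
(* There are no auxiliary indeterminates here. The order 4 is the first even one beyond that of -
   eta^2, so that eta -> - eta fixes the coefficients; at eta = 1 the special part is rational. *)
have [l|f fE] := @deformation_morph 2 Kbar iota Kbar Kbar idfun idfun idfun (fun _ _ => id)
    (fun _ => erefl) x q 4.
  pose ev : {rmorphism P -> Kbar} := horner_eval 1 \o map_poly idfun.
  have [e1 e2 e3 _] := map_fold ev; have [r1 r2 r3 _] := map_fold (rat_base iota).
  rewrite (triple_map (map_mx ev)) (triple_map (map_mx (rat_base iota))).
  rewrite e1 e2 r1 r2 !map_mxB e3 r3 !map_scalar_mx rmorph1.
  by rewrite (_ : ev 'X^2 = 1) // /ev /= /horner_eval map_polyXn hornerXn expr1n.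
pose D l := map_mx iota (generic_mx 2 l).
pose h : {rmorphism P -> E} := series_poly \o map_poly idfun.
have hX : h 'X = eta by rewrite /h /= map_polyX.
pose gen0 : 'I_3 -> 'M[E]_2 := triple (fold_b1 E) (fold_b2 E) (fold_c E - (eta ^+ 2)%:M).
pose M l := gen0 l + eta ^+ 4 *: map_mx sconst (D l).
have fM l : map_mx f (generic_mx 2 l) = map_mx (@tofrac E) (M l).
  rewrite fE; congr map_mx; rewrite map_mxD map_mxZ; congr (_ + _).
    have [e1 e2 e3 _] := map_fold h.
    rewrite (triple_map (map_mx h)) e1 e2 map_mxB e3 map_scalar_mx.
    by rewrite rmorphXn hX.
  rewrite -[X in X *: _]/(h 'X^4) rmorphXn hX; congr (_ *: _).
  apply/matrixP => i j; rewrite !mxE /=; congr series_poly.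
  by rewrite map_polyC.
have [b1E b2E cE _] := map_fold (@sresidue Kbar).
have [sb1E sb2E scE _] := map_fold (@ssign Kbar).
have resM l : map_mx sresidue (M l) = map_mx sresidue (gen0 l).
  by rewrite /M exprS -scalerA residue_shift.
have gen0E : [/\ gen0 (inord 0) = fold_b1 E, gen0 (inord 1) = fold_b2 E
    & gen0 (inord 2) = fold_c E - (eta ^+ 2)%:M].
  by split; rewrite /gen0 /triple inordK.
have [g0 g1 g2] := gen0E.
have var2 (r : {rmorphism E -> Kbar}) : r eta = 0 ->
    map_mx r (gen0 (inord 2)) = map_mx r (fold_c E).
  by move=> reta; rewrite g2 map_mxB map_scalar_mx rmorphXn reta expr0n raddf0 subr0.
have signG l : map_mx ssign (gen0 l) = gen0 l.
  rewrite /gen0 (triple_map (map_mx (@ssign Kbar))) sb1E sb2E map_mxB scE map_scalar_mx.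
  by rewrite rmorphXn /= ssign_var sqrrN.
have signM l : map_mx ssign (M l) = M l by rewrite /M (sign_var_even _ _ 2) signG.
have [V FV] := fold_solution char0 (map_mx sconst (D (inord 0)))
  (map_mx sconst (D (inord 1))) (map_mx sconst (D (inord 2))).
pose W : 'M[E]_2 := fold_z E + eta *: V.
have WE : fold_x E + eta *: W = fold_x E + eta *: fold_z E + eta ^+ 2 *: V.
  by rewrite /W scalerDr scalerA -expr2 addrA.
have [|||||||||X [solX X_inj sX dX]] := @fold_configuration Kbar char0
  (M (inord 0)) (M (inord 1)) (M (inord 2)) (fold_x E + eta *: W) W.
- by rewrite resM g0.
- by rewrite resM g1.
- by rewrite resM (var2 (@sresidue Kbar)) //; exact: sresidue_var.
- exact: signM.
- exact: signM.
- exact: signM.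
- by [].
- by rewrite residue_shift map_mx2 rmorph1 rmorph0 rmorphN rmorph1.
- rewrite WE /M g0 g1 g2; exact: FV.
have [|s sE] := @frac_lift E _ (@tofrac E \o ssign).
  move=> a b /tofrac_inj; exact: (inv_inj (@ssignK _)).
exists {fraction E}, f, s, (fun i => map_mx (@tofrac E) (X i)); split.
- apply: (generic_morph_eq (f := s \o f)) => l.
  rewrite map_mx_comp fM; transitivity (map_mx (@tofrac E) (map_mx ssign (M l))).
    by apply/matrixP => i j; rewrite !mxE sE.
  by rewrite signM.
- by move=> i; rewrite /sol_over !fM -map_mx_quadratic solX map_mx0.
- move=> i j e; apply: X_inj; apply/matrixP => a b; apply: (@tofrac_inj E).
  by move/matrixP/(_ a b): e; rewrite !mxE.
- move=> i; rewrite -sX; apply/matrixP => a b; by rewrite !mxE sE.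
- by move=> i i0; rewrite -map_mxB det_map_mx tofrac_eq0 dX.
Qed.

(** * Symmetric Galois groups *)

Lemma adjoin_sub_set (K : fieldType) (Kbar : closedFieldType) (iota : {rmorphism K -> Kbar})
    (S S' : Kbar -> Prop) : (forall x, S x -> S' x) ->
  forall x, adjoin iota S x -> adjoin iota S' x.
Proof.
move=> SS' x; elim=> {x}.
- exact: adjoin_base.
- by move=> x /SS'; apply: adjoin_gen.
- by move=> x y _ hx _; apply: adjoin_sub.
- by move=> x y _ hx _; apply: adjoin_mul.
- by move=> x _; apply: adjoin_inv.
Qed.

Section SymmetricFamily.

Variables (n d : nat).
Local Notation K := (genericK n).
Variables (Kbar : closedFieldType) (iota : {rmorphism K -> Kbar}).
Hypothesis alg : algebraic_closure iota.
Variables (T : 'I_d -> 'M[Kbar]_n) (e0 e1 : 'I_d).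
Hypothesis T_inj : injective T.
Hypothesis solT : forall X, sol_over iota X <-> exists i, X = T i.
Hypothesis swap : conj_over iota iota (mxenv T) (mxenv (fun i => T (tperm e0 e1 i))).
Hypothesis stab : forall i, i != e0 ->
  conj_over iota iota (mxenv (mxpair (T e0) (T e1))) (mxenv (mxpair (T e0) (T i))).

Local Notation env := (mxenv T).
Local Notation m := #|{: 'I_d * 'I_n * 'I_n}|.

(** A conjugate of the family of all solutions consists of solutions again; this is the closure
    condition of [closed_tuple_splitting]. *)
Lemma symmetric_closed (y : 'I_m -> Kbar) :
  conj_over iota iota env y -> forall v, exists w, y v = env w.
Proof.
have [A yA] := mxenv_surj y => Ty v; rewrite yA /mxenv; case: (enum_val v) => -[a r] c.
have TA : conj_over iota iota env (mxenv A) by apply: eq_conj_over Ty.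
have /solT[i ->] : sol_over iota (A a) by apply/(sol_over_conj a TA)/solT; exists a.
by exists (enum_rank (i, r, c)); rewrite [RHS]mxenvE.
Qed.

Section Splitting.

Variables (L : splittingFieldType K) (j : {rmorphism L -> Kbar}) (u : 'I_m -> L).
Hypotheses (jA : forall a, j a%:A = iota a) (ju : forall v, j (u v) = env v).
Hypothesis genL : <<1 & codom u>>%VS = fullv.
Local Notation G := 'Gal({:L} / 1)%G.

Let U i : 'M[L]_n := \matrix_(r, c) u (enum_rank (i, r, c)).

Let jU i : map_mx j (U i) = T i.
Proof. by apply/matrixP => r c; rewrite !mxE ju mxenvE. Qed.

Let U_inj : injective U.
Proof. by move=> a b ab; apply: T_inj; rewrite -!jU ab. Qed.

Let solU i : sol_over (in_alg L) (U i).
Proof.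
have c : conj_over (in_alg L) iota (mxenv U) (mxenv (fun i => map_mx j (U i))).
  apply: eq_conj_over (frefl _) _ (@conj_over_morph K _ L Kbar (in_alg L) iota j (mxenv U) jA).
  by move=> v; apply: mxenv_map.
by apply/(sol_over_conj i c); rewrite jU; apply/solT; exists i.
Qed.

Let fix_alg (g : gal_of {:L}) (a : K) : g a%:A = a%:A.
Proof. by rewrite -[a%:A]/(in_alg L a) rmorph_alg. Qed.

Let gal_permutes (g : gal_of {:L}) : exists s : 'S_d, forall i, map_mx g (U i) = U (s i).
Proof.
have /choice[t tE] i : exists k, map_mx g (U i) = U k.
  have jgA a : (j \o g) (in_alg L a) = iota a by rewrite /= fix_alg jA.
  have /solT[k kE] := sol_over_morph jgA (solU i).
  exists k; apply/matrixP => r c; apply: (fmorph_inj j).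
  by have := congr1 (fun M : 'M_n => M r c) kE; rewrite -jU !mxE.
have t_inj : injective t.
  move=> a b tab; apply: U_inj; apply/matrixP => r c; apply: (fmorph_inj g).
  by have := congr1 (fun M : 'M_n => M r c) (tE a); rewrite tab -tE !mxE.
by exists (perm t_inj) => i; rewrite permE.
Qed.

Let gal_swap : exists2 g, g \in G & forall i, map_mx g (U i) = U (tperm e0 e1 i).
Proof.
apply: (gal_mx_conj (U' := fun i => U (tperm e0 e1 i)) jA).
by apply: eq_conj_over swap; apply: eq_mxenv => i; rewrite jU.
Qed.

Let gal_stab i : i != e0 ->
  exists g, [/\ g \in G, map_mx g (U e0) = U e0 & map_mx g (U e1) = U i].
Proof.
move=> /stab c.
have [|g gG gE] := @gal_mx_conj n Kbar iota L j _ (mxpair (U e0) (U e1)) (mxpair (U e0) (U i)) jA.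
  by apply: eq_conj_over c; apply: eq_mxenv => -[]; rewrite /= jU.
by exists g; split; [| exact: (gE true) | exact: (gE false)].
Qed.

Let uE v : exists a r c, v = enum_rank (a, r, c) /\ u v = U a r c.
Proof.
case E : (enum_val v) => [[a r] c]; exists a, r, c.
by rewrite mxE -E enum_valK.
Qed.

(** The action on the solutions is faithful because their entries generate L. The image contains the
    transposition of e0 and e1, and its conjugates by automorphisms that fix [U e0] and send [U e1]
    to [U i]. *)
Lemma symmetric_gal_isog : G \isog [set: 'S_d].
Proof.
have /choice[s sE] := gal_permutes.
have sM : {in G &, {morph s : g h / (g * h)%g >-> (g * h)%g}}.
  move=> g h _ _; apply/permP => i; apply: U_inj; rewrite -sE permM -!sE.
  by apply/matrixP => r c; rewrite !mxE galM ?memvf.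
have s_uniq (g : gal_of {:L}) (t : 'S_d) : (forall i, map_mx g (U i) = U (t i)) -> s g = t.
  by move=> gt; apply/permP => i; apply: U_inj; rewrite -sE gt.
pose phi := Morphism sM.
have phi_inj : ('injm phi)%g.
  apply/subsetP => g /morphpreP[gG /set1P sg1]; apply/set1P/eqP/gal_eqP => x _.
  rewrite gal_id; have : (fullv <= fixedField [set g])%VS.
    rewrite -genL; apply/Fadjoin_seqP; split; first exact: sub1v.
    move=> _ /codomP[v ->]; apply/fixedFieldP => [|h /set1P->]; first exact: memvf.
    have [a [r [c [_ ->]]]] := uE v.
    have := congr1 (fun M : 'M_n => M r c) (sE g a).
    by rewrite [s g]sg1 perm1 mxE.
  by move/subvP/(_ x (memvf x))/fixedFieldP => fx; apply: fx (memvf x) _ (set11 g).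
suff <- : (phi @* G)%g = [set: 'S_d] by apply: sub_isog.
apply/eqP; rewrite eqEsubset subsetT /= -(gen_tperm e0) gen_subG.
apply/subsetP => _ /imsetP[i _ ->].
have [->|i0] := eqVneq i e0; first by rewrite tperm1 group1.
have [g gG /s_uniq gE] := gal_swap; have [h [hG h0 h1]] := gal_stab i0.
have -> : tperm e0 i = phi (g ^ h)%g.
  rewrite morphJ //= gE tpermJ; congr tperm; apply: U_inj; by rewrite -sE.
by apply: mem_morphim; rewrite ?groupJ.
Qed.

(** Automorphisms permute the indices of the entries, so the product is invariant. Entries that
    coincide only give multiple roots, which do not affect the splitting field. *)
Lemma symmetric_resolvent : exists p : {poly K},
  map_poly (in_alg L) p = \prod_v ('X - (u v)%:P).
Proof.
set q := \prod_v _.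
have galL : galois 1 {:L}.
  apply/and3P; split; [exact: sub1v | | exact: normalFieldf].
  apply/separableP => y _; apply: pcharf0_separable => p.
  by rewrite (fmorph_pchar (in_alg L)) generic_char0.
have fix_q (g : gal_of {:L}) : map_poly g q = q.
  have [s sE] := gal_permutes g.
  pose t (v : 'I_m) : 'I_m := enum_rank (s (enum_val v).1.1, (enum_val v).1.2, (enum_val v).2).
  have tE a r c : t (enum_rank (a, r, c)) = enum_rank (s a, r, c) by rewrite /t enum_rankK.
  have t_inj : injective t.
    move=> v w; have [a [r [c [-> _]]]] := uE v; have [a' [r' [c' [-> _]]]] := uE w.
    by rewrite !tE => /enum_rank_inj[/perm_inj-> -> ->].
  rewrite rmorph_prod [RHS](reindex_inj t_inj) /=; apply: eq_bigr => v _.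
  rewrite map_polyXsubC; congr ('X - _%:P).
  have [a [r [c [-> _]]]] := uE v; rewrite tE.
  by have := congr1 (fun M : 'M_n => M r c) (sE a); rewrite !mxE.
have [|p pE] := @map_poly_intro _ _ (in_alg L) q; last by exists p.
move=> i; suff /vlineP[a aE] : q`_i \in 1%VS by exists a.
rewrite -(galois_fixedField galL); apply/fixedFieldP => [|g _]; first exact: memvf.
by rewrite -coef_map fix_q.
Qed.

End Splitting.

Lemma symmetric_complexity : solvability_complexity iota (sol_over iota) d [set: 'S_d]%G.
Proof.
split.
  exists (codom T); split; first by rewrite map_inj_uniq ?enum_uniq.
    by rewrite size_codom card_ord.
  by move=> X; split=> [/solT[i ->]|/codomP[i ->]]; [apply: codom_f | apply/solT; exists i].
have [L [j [u [jA ju genL]]]] := closed_tuple_splitting (@generic_char0 n) alg symmetric_closed.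
have [p pE] := symmetric_resolvent jA ju.
have big_codom (R : comNzRingType) (x : 'I_m -> R) :
    \prod_v ('X - (x v)%:P) = \prod_(z <- codom x) ('X - z%:P).
  by rewrite big_image.
exists p; split.
  exists L; split; last exact: (symmetric_gal_isog jA ju genL).
  exists (codom u) => //; rewrite -big_codom pE; exact: eqpxx.
have ip : map_poly iota p = \prod_(z <- codom env) ('X - z%:P).
  rewrite -big_codom; transitivity (map_poly j (map_poly (in_alg L) p)).
    by rewrite -map_poly_comp; apply: eq_map_poly => a; rewrite /= jA.
  rewrite pE rmorph_prod; apply: eq_bigr => v _; by rewrite /= map_polyXsubC ju.
move=> x; split; apply: adjoin_sub_set => y; rewrite ip root_prod_XsubC.
  move=> [_ [r [c [/solT[i ->] ->]]]]; apply/codomP.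
  by exists (enum_rank (i, r, c)); rewrite mxenvE.
case/codomP=> v ->; rewrite /mxenv; case: (enum_val v) => -[i r] c.
by exists (T i), r, c; split=> //; apply/solT; exists i.
Qed.

End SymmetricFamily.

Lemma complexity_two (Kbar : closedFieldType) (iota : {rmorphism genericK 2 -> Kbar}) :
  algebraic_closure iota ->
  solvability_complexity iota (sol_over iota) 8 [set: 'S_8]%G.
Proof.
move=> alg; have [F [f [s [T [sf solT T_inj sT dT]]]]] := fold_family iota.
have [T' TT'] := solution_tuple_transfer iota solT.
have solT' i : sol_over iota (T' i) by apply/(sol_over_conj i TT').
have T'_inj : injective T' by move=> i j /(eq_conj_mx i j TT')/T_inj.
have dT' i : i != lshift 6 0 -> \det (T' (lshift 6 0) - T' i) != 0.
  move=> /dT; rewrite -(mmap_mxvars f T) -(mmap_mxvars f T i) -map_mxB det_map_mx TT'.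
  by rewrite -det_map_mx map_mxB !mmap_mxvars.
(* The family is indexed by 2 + 6, which computes to 8; the bound excludes any further solution. *)
apply: (symmetric_complexity alg (e0 := lshift 6 0) (e1 := lshift 6 1) T'_inj).
- move=> X; split=> [solX|[i ->]] //.
  have [/codomP[i]|XT] := boolP (X \in codom T'); first by exists i.
  have := @generic_sol_bound Kbar iota (X :: codom T').
  rewrite /= XT map_inj_uniq ?enum_uniq // size_codom card_ord => /(_ isT) big.
  by have /big : forall Y, Y \in X :: codom T' -> sol_over iota Y
    by move=> Y /predU1P[->|/codomP[i ->]].
- apply: conj_over_trans (conj_over_sym TT') _.
  apply: conj_over_trans (conj_over_mxenv_reindex (tperm (lshift 6 0) (lshift 6 1)) TT').
  apply: eq_conj_over (frefl _) _ (conj_over_morph (mxenv T) sf) => v.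
  by rewrite (mxenv_map s); apply: eq_mxenv => i; rewrite sT.
- by move=> i i0; apply: pair_conj; rewrite ?dT'.
Qed.

Theorem proposition3 (n : nat) (hn : (2 <= n)%N)
  (Kbar : closedFieldType) (iota : {rmorphism genericK n -> Kbar})
  (hKbar : algebraic_closure iota) :
  let B1 := generic_mx n (inord 0) in
  let B2 := generic_mx n (inord 1) in
  let C := generic_mx n (inord 2) in
  let sol := quadratic_sol iota B1 B2 C in
  (n = 2%N -> solvability_complexity iota sol 8 [set: 'S_8]%G)
  /\ ((2 < n)%N -> finitely_many_solutions sol /\ eq_nonsolvable iota sol).
Proof.
split=> [n2|n3].
  by subst n; apply: complexity_two.
case: n => // n in hn iota hKbar n3 *.
split; [exact: (finitely_many_generic iota) | exact: (higher_nonsolvable hKbar n3)].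
Qed.
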